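(* Let $r\ge2$ and assume that the rank $r-1$ irregular vector $v_0=|I^{(r-1)}\rangle$ is normalized to satisfy its full lower Virasoro deformation equations $$L_0v_0=\bigl(\Delta_{c_0'}+\mathcal D^{(r-1)}_0\bigr)v_0,\qquad L_iv_0=\bigl(\Lambda'_i+\mathcal D^{(r-1)}_i\bigr)v_0\quad(1\le i\le r-2).$$ Let $W=|\widetilde I^{(r)}\rangle$ be the canonical integer-rank irregular vector, i.e. the unique formal series $$W=c_r^{\nu_r}\exp\left(\sum_{k=1}^{r-1}\frac{g_k}{c_r^k}\right)\sum_{k\ge0}c_r^kv_k,\qquad \nu_r,g_k\in\mathcal A,\ v_k\in M_{\mathcal A},$$ with the given $v_0$, satisfying $L_*W=c_r^r\frac{\partial}{\partial c_r}W$ and $L_nW=\Lambda_nW$ for $r\le n\le 2r$. Then there exists a non-zero scalar formal function $f=f(c_0',c_0,c_1,\ldots,c_{r-1})$, unique up to multiplication by a non-zero function of $c_0'$ and $c_0$, such that $|I^{(r)}\rangle:=fW$ satisfies $$R_i|I^{(r)}\rangle=0,\qquad 0\le i\le r-1.$$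
   Context: Virasoro algebra: $\mathrm{Vir}=\bigoplus_{n\in\mathbb Z}\mathbb C L_n\oplus\mathbb C\mathbf c$, $[L_m,L_n]=(m-n)L_{m+n}+\frac{\mathbf c}{12}(m^3-m)\delta_{m+n,0}$, with $\mathbf c$ acting by $1+6Q^2$. $Q,c_0,c_0',c_1,\ldots,c_r$ are independent parameters; $\Delta_a=a(Q-a)$. Weights: with $c_i=0$ for $i<0$ or $i>r$, $\Lambda_n=((n+1)Q-2c_0)c_n-\sum_{k=1}^{n-1}c_kc_{n-k}$ for $n\ge1$ (so $\Lambda_n=0$ for $n>2r$). $\Lambda'_n=((n+1)Q-2c_0')c_n-\sum_{k=1}^{n-1}c_kc_{n-k}$ where here $c_j=0$ for $j\ge r$. Coefficient rings: $\mathcal A=\mathbb C(Q,c_0,c_0')[c_1,\ldots,c_{r-1},c_{r-1}^{-1}]$, and its Laurent extension $\mathcal A_{\mathrm{Laur}}=\mathbb C(Q,c_0,c_0')[c_1^{\pm1},\ldots,c_{r-1}^{\pm1}]$. $M_{\mathcal A}$ is the rank $r-1$ irregular Verma module over $\mathcal A$: the $\mathrm{Vir}$-module induced from the subalgebra generated by $L_n$ ($n\ge r-1$) and $\mathbf c$ acting on $\mathcal Av_0$ by $L_nv_0=\Lambda'_nv_0$ $(n\ge r-1)$; PBW basis $L_{-\lambda_1+r-1}\cdots L_{-\lambda_\ell+r-1}v_0$ over partitions $\lambda$. Vector fields: $\mathcal D_n=\sum_{k=1}^{r-n}k\,c_{n+k}\frac{\partial}{\partial c_k}$ for $0\le n\le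 r-1$ (rank $r$), and $\mathcal D^{(r-1)}_n=\sum_{k=1}^{r-1-n}k\,c_{n+k}\frac{\partial}{\partial c_k}$ for $0\le n\le r-2$ (rank $r-1$). Action of parameter derivatives on vectors: $\partial_{c_j}$ ($1\le j\le r-1$) acts on $M_{\mathcal A}$ by the Leibniz rule over $\mathcal A$ and commutes with the PBW generators $L_p$ ($p<r-1$), so it is determined by $\partial_{c_j}v_0$; the rank $r-1$ lower deformation equations determine $\partial_{c_j}v_0$, since the $\mathcal D^{(r-1)}_n$ form a frame after inverting $c_{r-1}$. $\partial_{c_r}$ annihilates $M_{\mathcal A}$. On formal series $P\sum c_r^kv_k$ with prefactor $P=c_r^{\nu_r}\exp(\sum_k g_k/c_r^k)$ derivatives act by the Leibniz rule with $\partial P=(\partial\log P)P$. Canonical operator: $M$ is the $r\times r$ matrix with $M_{i,k}=k\,c_{i+k-1}$ if $i+k-1\le r$, else $0$; $D_0=L_0-\Delta_{c_0}$, $D_n=L_n-\Lambda_n$ ($1\le n\le r-1$); $L_*=c_r^r\sum_{n=0}^{r-1}(M^{-1})_{r,n+1}D_n$. Operators $R_i$: $R_0=L_0-\Delta_{c_0}-\mathcal D_0$ and $R_i=L_i-\Lambda_i-\mathcal D_i$ for $1\le i\le r-1$. Scalar formal function of $c_0',c_0,c_1,\ldots,c_{r-1}$: a formal exponential $f=e^h$ (with $\partial f=(\partial h)f$), where $dh$ is a closed one-form in $c_1,\ldots,c_{r-1}$ with coefficients in $\mathcal A_{\mathrm{Laur}}$ (logarithmic terms in $h$ are allowed); $f$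 does not depend on $c_r$. *)

(* Defs.v *)
From HB Require Import structures.
From mathcomp Require Import all_boot all_order all_algebra.
From mathcomp Require Import reals complex mpoly ring.

Set Implicit Arguments.
Unset Strict Implicit.
Unset Printing Implicit Defensive.

Import Order.TTheory GRing.Theory Num.Theory.
Local Open Scope ring_scope.

Lemma repr_tofrac (D : idomainType) (x : {fraction D}) :
  x = FracField.tofrac \n_(repr x) / FracField.tofrac \d_(repr x).
Proof.
set u := repr x; have d0 : \d_u != 0 := denom_ratioP u.
have nz : FracField.tofrac \d_u != 0 by rewrite tofrac_eq0.
apply: (mulIf nz); rewrite divfK //.
rewrite -[x in LHS]reprK -/u !piE.
apply/eqmodP; rewrite /= FracField.equivfE /FracField.mulf !numden_Ratio ?oner_neq0 ?mulr1 //.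
  by rewrite mulrC.
Qed.

(* The quotient rule, on a chosen representative; see frac_derivE. *)
Definition frac_deriv (D : idomainType) (d : D -> D) (x : {fraction D}) :
    {fraction D} :=
  let u := repr x in
  FracField.tofrac (d \n_u * \d_u - \n_u * d \d_u)
    / FracField.tofrac \d_u ^+ 2.

Lemma quotient_rule (T : comPzRingType) (n d a b n' d' a' b' : T) :
  a * d = n * b -> a' * d + a * d' = n' * b + n * b' ->
  (n' * d - n * d') * b ^+ 2 = (a' * b - a * b') * d ^+ 2.
Proof.
move=> e e'.
have -> : (n' * d - n * d') * b ^+ 2
   = d * b * (n' * b + n * b') - (n * b) * (b * d' + d * b') by ring.
by rewrite -e' -e; ring.
Qed.

Lemma frac_derivE (D : idomainType) (d : D -> D)
    (dM : forall a b, d (a * b) = d a * b + a * d b) (a b : D) : b != 0 ->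
  frac_deriv d (FracField.tofrac a / FracField.tofrac b)
    = FracField.tofrac (d a * b - a * d b) / FracField.tofrac b ^+ 2.
Proof.
move=> b0; rewrite /frac_deriv.
move: (repr_tofrac (FracField.tofrac a / FracField.tofrac b)).
set u := repr _; have := denom_ratioP u.
move: (\n_u) (\d_u) => p q q0 hx.
have anb : a * q = p * b.
  apply/eqP; rewrite -tofrac_eq !rmorphM /= -eqr_div ?tofrac_eq0 //.
  by rewrite hx.
have danb : d a * q + a * d q = d p * b + p * d b by rewrite -!dM anb.
apply/eqP; rewrite eqr_div ?expf_neq0 ?tofrac_eq0 // -!rmorphXn -!rmorphM /=.
by rewrite (quotient_rule anb danb).
Qed.

(* C(Q, c_0, c_0'), with C = R[i]. *)
Definition baseField (R : realType) : fieldType := {fraction {mpoly R[i][3]}}.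

(* The i-th variable of {mpoly K[r.-1]} is c_{i+1}. *)
Definition parPoly (R : realType) (r : nat) : idomainType :=
  {mpoly (baseField R)[r.-1]}.

(* C(Q, c_0, c_0')(c_1, ..., c_{r-1}); the rings A and A_Laur below are
   subrings of it. *)
Definition parField (R : realType) (r : nat) : fieldType :=
  {fraction (parPoly R r)}.

Definition polyF (R : realType) (r : nat) (p : {mpoly (baseField R)[r.-1]}) :
    parField R r :=
  @FracField.tofrac (parPoly R r) p.

Definition baseF (R : realType) (r : nat) (x : baseField R) : parField R r :=
  polyF (r := r) (x%:MP).

Definition Qb (R : realType) : baseField R :=
  FracField.tofrac ('X_(inord 0) : {mpoly R[i][3]}).
Definition c0b (R : realType) : baseField R :=
  FracField.tofrac ('X_(inord 1) : {mpoly R[i][3]}).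
Definition c0pb (R : realType) : baseField R :=
  FracField.tofrac ('X_(inord 2) : {mpoly R[i][3]}).

Definition Qpar (R : realType) (r : nat) : parField R r := baseF r (Qb R).
Definition c0 (R : realType) (r : nat) : parField R r := baseF r (c0b R).
Definition c0p (R : realType) (r : nat) : parField R r := baseF r (c0pb R).

(* c_k for 1 <= k <= r-1, and 0 for every other k. *)
Definition clow (R : realType) (r k : nat) : parField R r :=
  \sum_(i < r.-1 | i.+1 == k) polyF 'X_i.

(* The parameter c_r is the variable of {poly (parField R r)}: this is c_k for
   1 <= k <= r, and 0 for every other k. *)
Definition cpar (R : realType) (r k : nat) : {poly (parField R r)} :=
  if k == r then 'X else (clow R r k)%:P.

Definition fracderiv (R : realType) (r : nat) (i : 'I_r.-1)
    (x : parField R r) : parField R r :=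
  frac_deriv (D := parPoly R r) (mderiv i) x.

(* d/dc_k on parField for 1 <= k <= r-1. *)
Definition dpar (R : realType) (r k : nat) (x : parField R r) : parField R r :=
  \sum_(i < r.-1 | i.+1 == k) fracderiv i x.

(* A = C(Q, c_0, c_0')[c_1, ..., c_{r-1}, c_{r-1}^-1]. *)
Definition inA (R : realType) (r : nat) (x : parField R r) : Prop :=
  exists (p : {mpoly (baseField R)[r.-1]}) (N : nat),
    x = polyF p / clow R r r.-1 ^+ N.

(* A_Laur = C(Q, c_0, c_0')[c_1^{+-1}, ..., c_{r-1}^{+-1}]. *)
Definition inALaur (R : realType) (r : nat) (x : parField R r) : Prop :=
  exists (p : {mpoly (baseField R)[r.-1]}) (m : 'X_{1..r.-1}),
    x = polyF p / polyF 'X_[m].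

Definition Delta (R : realType) (r : nat) (a : parField R r) : parField R r :=
  a * (Qpar R r - a).

(* Lambda_n, n >= 1. *)
Definition Lam (R : realType) (r n : nat) : {poly (parField R r)} :=
  (n.+1%:R * Qpar R r - 2%:R * c0 R r)%:P * cpar R r n
    - \sum_(1 <= k < n) cpar R r k * cpar R r (n - k).

(* Lambda'_n, n >= 1. *)
Definition Lamlow (R : realType) (r n : nat) : parField R r :=
  (n.+1%:R * Qpar R r - 2%:R * c0p R r) * clow R r n
    - \sum_(1 <= k < n) clow R r k * clow R r (n - k).

Definition is_Vir_rep (R : realType) (r : nat) (M : lmodType (parField R r))
    (L : int -> {linear M -> M}) : Prop :=
  forall (m n : int) (x : M),
    L m (L n x) - L n (L m x) =
      (m - n)%:~R *: L (m + n) x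
      + (if m + n == 0
         then ((1 + 6%:R * Qpar R r ^+ 2) / 12%:R * (m ^+ 3 - m)%:~R) *: x
         else 0).

(* L_n v = Lambda'_n v for n >= r-1. *)
Definition is_low_whittaker (R : realType) (r : nat)
    (M : lmodType (parField R r)) (L : int -> {linear M -> M}) (v : M) : Prop :=
  forall n : nat, (r.-1 <= n)%N -> L n%:Z v = Lamlow R r n *: v.

Definition is_part (l : seq nat) : bool :=
  sorted geq l && all (fun a => 0 < a)%N l.

(* L_{-l_1+r-1} (L_{-l_2+r-1} (... v0)). *)
Definition pbw (R : realType) (r : nat) (M : lmodType (parField R r))
    (L : int -> {linear M -> M}) (v0 : M) (l : seq nat) : M :=
  foldr (fun (a : nat) (x : M) => L (r.-1%:Z - a%:Z) x) v0 l.

(* M with its vector v0 is the module M_A with scalars extended from A to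
   parField; verma_ind is the universal property of the induced module. *)
Record is_irregular_verma (R : realType) (r : nat)
    (M : lmodType (parField R r)) (L : int -> {linear M -> M}) (v0 : M) :
    Prop := IsIrregularVerma {
  verma_rep : is_Vir_rep L;
  verma_vec : is_low_whittaker L v0;
  verma_ind : forall (N : lmodType (parField R r))
      (L' : int -> {linear N -> N}) (w : N),
    is_Vir_rep L' -> is_low_whittaker L' w ->
    exists phi : {linear M -> N},
      [/\ phi v0 = w, (forall n x, phi (L n x) = L' n (phi x)) &
       forall psi : {linear M -> N}, psi v0 = w ->
         (forall n x, psi (L n x) = L' n (psi x)) -> psi =1 phi];
  verma_span : forall x : M, exists (s : seq (seq nat))
      (a : seq nat -> parField R r),
    all is_part s /\ x = \sum_(l <- s) a l *: pbw L v0 l;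
  verma_free : forall (s : seq (seq nat)) (a : seq nat -> parField R r),
    all is_part s -> uniq s ->
    \sum_(l <- s) a l *: pbw L v0 l = 0 -> {in s, forall l, a l = 0}
}.

(* M_A inside M: the A-span of the PBW basis. *)
Definition inMA (R : realType) (r : nat) (M : lmodType (parField R r))
    (L : int -> {linear M -> M}) (v0 : M) (x : M) : Prop :=
  exists (s : seq (seq nat)) (a : seq nat -> parField R r),
    [/\ all is_part s, {in s, forall l, inA (a l)} &
     x = \sum_(l <- s) a l *: pbw L v0 l].

(* D k is the action of d/dc_k on M, for 1 <= k <= r-1. *)
Record is_par_derivation (R : realType) (r : nat) (M : lmodType (parField R r))
    (L : int -> {linear M -> M}) (D : nat -> {additive M -> M}) : Prop :=
    IsParDerivation {
  par_leibniz : forall k a x, (1 <= k < r)%N ->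
    D k (a *: x) = dpar k a *: x + a *: D k x;
  par_comm : forall k (p : int) x, (1 <= k < r)%N -> p < r.-1%:Z ->
    D k (L p x) = L p (D k x)
}.

(* The vector field D^{(r-1)}_n, 0 <= n <= r-2. *)
Definition vf_low (R : realType) (r : nat) (M : lmodType (parField R r))
    (D : nat -> {additive M -> M}) (n : nat) (x : M) : M :=
  \sum_(1 <= k < r - n) (k%:R * clow R r (n + k)) *: D k x.

Definition lower_deformation (R : realType) (r : nat)
    (M : lmodType (parField R r)) (L : int -> {linear M -> M})
    (D : nat -> {additive M -> M}) (v0 : M) : Prop :=
  L 0 v0 = Delta (c0p R r) *: v0 + vf_low D 0 v0 /\
  (forall i : nat, (1 <= i <= r - 2)%N ->
    L i%:Z v0 = Lamlow R r i *: v0 + vf_low D i v0).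

(* s n m is the coefficient of c_r^n (log c_r)^m. Logarithms arise when
   d/dc_j acts on c_r^{nu_r}, as nu_r may a priori depend on c_j. *)
Definition fser (M : Type) := int -> nat -> M.

Definition ser_of (M : zmodType) (v : nat -> M) : fser M :=
  fun n m => match n, m with Posz k, 0%N => v k | _, _ => 0 end.

Definition ser_scale (F : fieldType) (M : lmodType F) (a : F) (s : fser M) :
    fser M :=
  fun n m => a *: s n m.

(* multiplication by a scalar polynomial in c_r *)
Definition ser_pmul (F : fieldType) (M : lmodType F) (p : {poly F})
    (s : fser M) : fser M :=
  fun n m => \sum_(i < size p) p`_i *: s (n - i%:Z) m.

Definition ser_log (M : zmodType) (s : fser M) : fser M :=
  fun n m => if m is m'.+1 then s n m' else 0.

Definition ser_dcr (F : fieldType) (M : lmodType F) (s : fser M) : fser M :=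
  fun n m => (n + 1)%:~R *: s (n + 1) m + m.+1%:R *: s (n + 1) m.+1.

(* The prefactor e^h c_r^nu exp(sum_{1 <= k < r} g_k / c_r^k), where
   pf_dlog j = dh/dc_j for 1 <= j <= r-1 and h does not depend on c_r. *)
Record prefactor (F : Type) := Prefactor {
  pf_dlog : nat -> F;
  pf_nu : F;
  pf_g : nat -> F
}.

(* P^-1 d/dc_k (P s), for 1 <= k <= r; the two branches expand
   d log P / dc_r and d log P / dc_k. *)
Definition nabla (R : realType) (r : nat) (M : lmodType (parField R r))
    (D : nat -> {additive M -> M}) (P : prefactor (parField R r)) (k : nat)
    (s : fser M) : fser M :=
  fun n m =>
    if k == r then
      ser_dcr s n m + pf_nu P *: s (n + 1) m
      - \sum_(1 <= i < r) (i%:R * pf_g P i) *: s (n + i.+1%:Z) m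
    else
      D k (s n m) + pf_dlog P k *: s n m
      + dpar k (pf_nu P) *: ser_log s n m
      + \sum_(1 <= i < r) dpar k (pf_g P i) *: s (n + i%:Z) m.

(* P^-1 D_n (P s) for the rank r vector field D_n. *)
Definition vf (R : realType) (r : nat) (M : lmodType (parField R r))
    (D : nat -> {additive M -> M}) (P : prefactor (parField R r)) (n : nat)
    (s : fser M) : fser M :=
  fun a b => \sum_(1 <= k < (r - n).+1)
    ser_pmul (k%:R * cpar R r (n + k)) (nabla D P k s) a b.

Definition weight (R : realType) (r n : nat) : {poly (parField R r)} :=
  if n == 0%N then (Delta (c0 R r))%:P else Lam R r n.

(* The operators D_n = L_n - Lambda_n, with D_0 = L_0 - Delta_{c_0}. *)
Definition Dop (R : realType) (r : nat) (M : lmodType (parField R r))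
    (L : int -> {linear M -> M}) (n : nat) (s : fser M) : fser M :=
  fun a b => L n%:Z (s a b) - ser_pmul (weight R r n) s a b.

(* P^-1 R_n (P s). *)
Definition Rop (R : realType) (r : nat) (M : lmodType (parField R r))
    (L : int -> {linear M -> M}) (D : nat -> {additive M -> M})
    (P : prefactor (parField R r)) (n : nat) (s : fser M) : fser M :=
  fun a b => Dop L n s a b - vf D P n s a b.

(* The r x r matrix M (r.-1.+1 = r as r > 0), with 0-based indices, over the
   field of rational functions of c_r. *)
Definition Mmat (R : realType) (r : nat) :
    'M[{fraction {poly (parField R r)}}]_(r.-1.+1) :=
  \matrix_(i, k) FracField.tofrac
    (if (i + k + 1 <= r)%N then k.+1%:R * cpar R r (i + k + 1) else 0).

(* The polynomial equal to x, when x is one. *)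
Definition fracpoly (F : fieldType) (x : {fraction {poly F}}) : {poly F} :=
  \n_(repr x) %/ \d_(repr x).

Lemma fracpolyK (F : fieldType) (p : {poly F}) :
  fracpoly (FracField.tofrac p) = p.
Proof.
rewrite /fracpoly; set x := FracField.tofrac p; set u := repr x.
have d0 : \d_u != 0 := denom_ratioP u.
suff -> : \n_u = p * \d_u by rewrite mulpK.
apply/eqP; rewrite -tofrac_eq rmorphM /= -/x {1}(repr_tofrac x) -/u.
by rewrite divfK // tofrac_eq0.
Qed.


(* c_r^r (M^-1)_{r,n+1}; it is a polynomial in c_r because M is anti-triangular
   with antidiagonal entries k c_r, so that det M = +- r! c_r^r. *)
Definition Lstar_coef (R : realType) (r : nat) (n : 'I_r.-1.+1) :
    {poly (parField R r)} :=
  fracpoly (FracField.tofrac ('X^r) * invmx (Mmat R r) ord_max n).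

Definition Lstar (R : realType) (r : nat) (M : lmodType (parField R r))
    (L : int -> {linear M -> M}) (s : fser M) : fser M :=
  fun a b => \sum_(n < r.-1.+1) ser_pmul (Lstar_coef R n) (Dop L n s) a b.

(* W = c_r^nu exp(sum g_k / c_r^k) sum_k c_r^k v_k is the canonical vector. *)
Record is_canonical (R : realType) (r : nat) (M : lmodType (parField R r))
    (L : int -> {linear M -> M}) (D : nat -> {additive M -> M}) (v0 : M)
    (nu : parField R r) (g : nat -> parField R r) (v : nat -> M) : Prop :=
    IsCanonical {
  can_nu : inA nu;
  can_g : forall k, (1 <= k < r)%N -> inA (g k);
  can_v : forall k, inMA L v0 (v k);
  can_v0 : v 0%N = v0;
  can_Lstar : Lstar L (ser_of v) =2
    ser_pmul 'X^r (nabla D (Prefactor (fun=> 0) nu g) r (ser_of v));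
  can_L : forall n : nat, (r <= n <= 2 * r)%N ->
    (fun a b => L n%:Z (ser_of v a b)) =2 ser_pmul (Lam R r n) (ser_of v)
}.

(* The scalar formal function sf_coef * e^h, where sf_dlog j = dh/dc_j for
   1 <= j <= r-1 (other values of sf_dlog are irrelevant). *)
Record scalar_fun (R : realType) (r : nat) := ScalarFun {
  sf_coef : baseField R;
  sf_dlog : nat -> parField R r
}.

Definition is_scalar_fun (R : realType) (r : nat) (f : scalar_fun R r) : Prop :=
  (forall j, (1 <= j < r)%N -> inALaur (sf_dlog f j)) /\
  (forall i j, (1 <= i < r)%N -> (1 <= j < r)%N ->
    dpar i (sf_dlog f j) = dpar j (sf_dlog f i)).

Definition sf_nonzero (R : realType) (r : nat) (f : scalar_fun R r) : Prop :=
  sf_coef f != 0.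

(* f' = kappa f *)
Definition sf_is_multiple (R : realType) (r : nat) (kappa : baseField R)
    (f f' : scalar_fun R r) : Prop :=
  sf_coef f' = kappa * sf_coef f /\
  (forall j, (1 <= j < r)%N -> sf_dlog f' j = sf_dlog f j).

(* R_i (f W) = 0 for 0 <= i <= r-1. *)
Definition solves_R (R : realType) (r : nat) (M : lmodType (parField R r))
    (L : int -> {linear M -> M}) (D : nat -> {additive M -> M})
    (nu : parField R r) (g : nat -> parField R r) (v : nat -> M)
    (f : scalar_fun R r) : Prop :=
  forall i, (i <= r.-1)%N ->
    Rop L D (Prefactor (sf_dlog f) nu g) i
      (ser_scale (baseF r (sf_coef f)) (ser_of v)) =2 (fun _ _ => 0).

(* Main.v *)
Require Import Defs.
From HB Require Import structures.
From mathcomp Require Import all_boot all_order all_algebra.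
From mathcomp Require Import boolp functions reals perm complex mpoly ring zify.

Set Implicit Arguments.
Unset Strict Implicit.
Unset Printing Implicit Defensive.

Import Order.TTheory GRing.Theory Num.Theory.
Local Open Scope ring_scope.

(* Set R_n = L_n - Lambda_n - D_n, with D_n the vector fields of the statement. The
   Virasoro relations, the commutation of the D_n and the quadratic shape of Lambda_n
   give [R_m, R_n] = (m - n) R_(m+n) as soon as the parameter derivatives are flat and
   commute with the L_p; for r - 1 this identity, applied to v0, yields precisely that
   flatness on the lower Verma module.

   In the lower Verma module the vectors with L_n u = Lambda'_n u for all n >= r form
   the line of v0 (weight filtration of the PBW basis). Hence a series in c_r killed by
   R_n for n >= r is determined, order by order, by scalars. Let X_j be the combinations
   of R_0, ..., R_(r-1) that have the form A_j - d/dc_j. Then X_j W is again killed by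
   R_n for n >= r, and X_r W = 0 gives X_r X_j W = 0; comparing leading coefficients, this
   forces X_j W = h_j W with h_j independent of c_r. Commutativity of the X_j shows that
   sum_j h_j dc_j is closed, h_j is read off a coefficient of X_j W and so lies in A, and
   e^h with dh = sum_j h_j dc_j is the only correction that kills every X_j, hence every
   R_i. *)

(** * Linear combinations in a module *)

(** Why the comparison of leading coefficients decides: put Z_j = c_r^r X_j. On a log-free series
    with leading term b c_r^d v0 that is killed by R_n for n >= r, the coefficient of Z_r at order d
    + r - 1 is - d b v0 and the lower ones vanish. This gain of r - 1 orders is not visible in the
    operator: it holds because the series agrees with b c_r^d W to leading order and Z_r W = 0.
    Since Z_r Z_j W = - r c_r^(r-1) Z_j W, only d = r survives in characteristic 0.

    The obstacle is that nu_r may depend on c_j. Then d/dc_j of c_r^nu_r brings in log c_r, and Z_j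
    W contains - (d nu_r / dc_j) c_r^r log(c_r) W. Once this is split off, the equation has a source
    proportional to d nu_r / dc_j exactly at the resonant exponent r, where nothing can absorb it;
    so the derivative is 0.

    Two devices: c_0 (or c_0') is entry 0 of the parameter sequence, so that Delta and Lambda_n are
    one quadratic formula; and c_r is never inverted in the series, only c_r^r times the inverse
    frame is used, over polynomials in c_r. *)

Lemma subr_eqD (V : zmodType) (x y z : V) : x - y = z -> x = z + y.
Proof. by move=> <-; rewrite subrK. Qed.

Section LinearCoercion.
Variables (B : comNzRingType) (U V : lmodType B) (f : {linear U -> V}).

Lemma linD x y : f (x + y) = f x + f y. Proof. exact: linearD. Qed.

Lemma linB x y : f (x - y) = f x - f y. Proof. exact: linearB. Qed.

Lemma linZ p x : f (p *: x) = p *: f x. Proof. exact: linearZ. Qed.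

End LinearCoercion.

Section ModuleNormalization.
Variables (B : comNzRingType) (V : lmodType B).

Inductive mexp :=
  MAtom of nat | MZero | MAdd of mexp & mexp | MOpp of mexp | MScale of B & mexp.

Fixpoint meval (env : seq V) (e : mexp) : V :=
  match e with
  | MAtom i => nth 0 env i
  | MZero => 0
  | MAdd a b => meval env a + meval env b
  | MOpp a => - meval env a
  | MScale p a => p *: meval env a
  end.

Fixpoint mcoef (e : mexp) (i : nat) : B :=
  match e with
  | MAtom j => if Nat.eqb j i then 1 else 0
  | MZero => 0
  | MAdd a b => mcoef a i + mcoef b i
  | MOpp a => - mcoef a i
  | MScale p a => p * mcoef a i
  end.

Fixpoint matoms_lt (n : nat) (e : mexp) : bool :=
  match e with
  | MAtom j => Nat.ltb j n
  | MZero => true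
  | MAdd a b => matoms_lt n a && matoms_lt n b
  | MOpp a => matoms_lt n a
  | MScale p a => matoms_lt n a
  end.

Lemma mevalE env e : matoms_lt (size env) e ->
  meval env e = \sum_(i < size env) mcoef e i *: nth 0 env i.
Proof.
elim: e => [j|a|a IHa b IHb|a IHa|p a IHa] /=.
- move=> /PeanoNat.Nat.ltb_lt/ssrnat.ltP hj.
  rewrite (bigD1 (Ordinal hj)) //= PeanoNat.Nat.eqb_refl scale1r big1 ?addr0 // => i.
  rewrite -val_eqE /= => /eqP ne.
  by case: (PeanoNat.Nat.eqb_spec j i) => [e|_]; rewrite ?scale0r //; case: ne.
- by rewrite big1 // => i _; rewrite scale0r.
- move=> /andP[/IHa -> /IHb ->]; rewrite -big_split.
  by apply: eq_bigr => i _; rewrite scalerDl.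
- by move=> /IHa ->; rewrite -sumrN; apply: eq_bigr => i _; rewrite scaleNr.
- by move=> /IHa ->; rewrite scaler_sumr; apply: eq_bigr => i _; rewrite scalerA.
Qed.

(** A nested conjunction rather than a quantified statement, so that [cbn] leaves one ring identity
    per atom. *)
Fixpoint mcoefs_eq (n : nat) (e f : mexp) : Prop :=
  if n is m.+1 then mcoef e m = mcoef f m /\ mcoefs_eq m e f else True.

Lemma mcoefs_eqP env e f :
    matoms_lt (size env) e && matoms_lt (size env) f ->
    mcoefs_eq (size env) e f ->
  meval env e = meval env f.
Proof.
move=> /andP[he hf] h; rewrite !mevalE //; apply: eq_bigr => i _; congr (_ *: _).
elim: (size env) i h => [[]//|n IHn] i /= [hn h].
have [lt_in|] := ltnP i n; first exact: (IHn (Ordinal lt_in)).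
by move=> le_ni; have -> : val i = n by apply/eqP; rewrite eqn_leq le_ni -ltnS ltn_ord.
Qed.

End ModuleNormalization.

(* Syntactic equality up to the inferred structure instances, which may be
   reached along different inheritance paths. *)
Ltac mod_same x y :=
  first
  [ constr_eq x y
  | lazymatch x with ?f ?a => lazymatch y with ?g ?b =>
      mod_same a b; mod_same f g end end
  | lazymatch type of x with
    | GRing.PzSemiRing.type => unify x y
    | GRing.PzRing.type => unify x y
    | GRing.NzRing.type => unify x y
    | GRing.LSemiModule.type _ => unify x y
    | GRing.Lmodule.type _ => unify x y
    | Algebra.Nmodule.type => unify x y
    | Algebra.Zmodule.type => unify x y
    | Algebra.BaseAddMagma.type => unify x y
    | Algebra.BaseZmodule.type => unify x y
    end ].

Ltac mod_index x env :=
  lazymatch env with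
  | ?y :: ?t => match constr:(tt) with
      | _ => let _ := match constr:(tt) with _ => mod_same x y end in constr:(O)
      | _ => let i := mod_index x t in constr:(S i)
      end
  end.

Ltac mod_insert x env :=
  lazymatch env with
  | [::] => constr:(x :: env)
  | ?y :: ?t => match constr:(tt) with
      | _ => let _ := match constr:(tt) with _ => mod_same x y end in constr:(env)
      | _ => let t' := mod_insert x t in constr:(y :: t')
      end
  end.

Ltac mod_atoms e env :=
  lazymatch e with
  | GRing.add ?a ?b => let env := mod_atoms a env in mod_atoms b env
  | GRing.opp ?a => mod_atoms a env
  | GRing.zero => constr:(env)
  | GRing.scale ?p ?a => mod_atoms a env
  | _ => mod_insert e env
  end.

Ltac mod_reify B e env :=
  lazymatch e with
  | GRing.add ?a ?b =>
      let a := mod_reify B a env in let b := mod_reify B b env in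
      constr:(@MAdd B a b)
  | GRing.opp ?a => let a := mod_reify B a env in constr:(@MOpp B a)
  | GRing.zero => constr:(@MZero B)
  | GRing.scale ?p ?a => let a := mod_reify B a env in constr:(@MScale B p a)
  | _ => let i := mod_index e env in constr:(@MAtom B i)
  end.

(* Proves an equality of linear combinations in V by comparing, with ring, the
   coefficients of each atom. *)
Ltac module_eq V :=
  lazymatch type of V with
  | GRing.Lmodule.type ?B =>
    lazymatch goal with
    | |- @eq ?T ?a ?b =>
      let env := mod_atoms a (@nil T) in
      let env := mod_atoms b env in
      let ea := mod_reify B a env in
      let eb := mod_reify B b env in
      refine (@mcoefs_eqP B V env ea eb _ _);
      [ reflexivity | cbn [mcoefs_eq mcoef size Nat.eqb]; repeat split; try ring ]
    end
  end.

(** * Brackets of the operators R_n *)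

Section Witt.
Variables (B : comNzRingType) (s : nat) (c : nat -> B) (Q : B).
Variable d : 'I_s -> {additive B -> B}.
Hypothesis dM : forall k a b, d k (a * b) = d k a * b + a * d k b.
Hypothesis dc : forall k n, d k (c n) = (n == k.+1)%:R.
Hypothesis dQ : forall k, d k Q = 0.
Hypothesis c_big : forall n, (s < n)%N -> c n = 0.

Definition frame (n : nat) (k : 'I_s) : B := k.+1%:R * c (n + k.+1).

Definition vfd (n : nat) (p : B) : B := \sum_k frame n k * d k p.

(** The end terms k = 0 and k = n of the sum give the - 2 c_0 c_n of Lambda_n; at n = 0 the formula
    is Delta at c_0. *)
Definition wt (n : nat) : B :=
  n.+1%:R * Q * c n - \sum_(k < n.+1) c k * c (n - k).

Lemma vfdD n p q : vfd n (p + q) = vfd n p + vfd n q.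
Proof. by rewrite /vfd -big_split; apply: eq_bigr => k _; rewrite raddfD mulrDr. Qed.

Lemma vfdN n p : vfd n (- p) = - vfd n p.
Proof. by rewrite /vfd -sumrN; apply: eq_bigr => k _; rewrite raddfN mulrN. Qed.

Lemma vfd_sum n I (t : seq I) (F : I -> B) :
  vfd n (\sum_(i <- t) F i) = \sum_(i <- t) vfd n (F i).
Proof.
rewrite /vfd exchange_big; apply: eq_bigr => k _.
by rewrite raddf_sum mulr_sumr.
Qed.

Lemma vfdM n p q : vfd n (p * q) = vfd n p * q + p * vfd n q.
Proof.
rewrite /vfd mulr_suml mulr_sumr -big_split; apply: eq_bigr => k _ /=.
by rewrite dM; ring.
Qed.

Lemma d1 k : d k 1 = 0.
Proof. by have := dM k 1 1; rewrite !mulr1 mul1r => /(canLR (addrK _)); rewrite subrr. Qed.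

Lemma dnat k n : d k n%:R = 0.
Proof. by rewrite -[n%:R]/(1 *+ n) raddfMn d1 mul0rn. Qed.

Lemma vfd_nat n m : vfd n m%:R = 0.
Proof. by rewrite /vfd big1 // => k _; rewrite dnat mulr0. Qed.

(** Uniform in n: at n = 0 no [d k] sees [c 0] and the factor n is 0, and beyond s both sides
    vanish. All brackets below thereby become index computations. *)
Lemma vfd_c m n : vfd m (c n) = n%:R * c (m + n).
Proof.
case: n => [|n].
  by rewrite /vfd mul0r big1 // => k _; rewrite dc /= mulr0.
case: (ltnP n s) => hn; last first.
  rewrite c_big // [c (m + n.+1)]c_big ?mulr0; last by rewrite ltn_addl.
  by rewrite /vfd big1 // => k _; rewrite raddf0 mulr0.
rewrite /vfd (bigD1 (Ordinal hn)) //= dc eqxx mulr1 big1 ?addr0 // => k.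
rewrite dc eqSS -val_eqE /= eq_sym => /negPf ->; exact: mulr0.
Qed.

Lemma frame_bracket m n k :
  vfd m (frame n k) - vfd n (frame m k) = (n%:R - m%:R) * frame (m + n) k.
Proof.
rewrite /frame !vfdM !vfd_nat !mul0r !add0r !vfd_c !addnA [(n + m)%N]addnC.
by rewrite !natrD; ring.
Qed.

(** Put N = m + n. The shift j = m + k in one sum and the reflection j = m - k in the other join
    them into the sum of (j - m) c_j c_(N-j) over 0 <= j <= N. The doubling is there to symmetrize
    under j -> N - j, which turns the coefficient into N - 2m = n - m. *)
Lemma wt_bracket_quad m n :
  (\sum_(k < n.+1) k%:R * c (m + k) * c (n - k)
   - \sum_(k < m.+1) k%:R * c (n + k) * c (m - k)) *+ 2
  = (n%:R - m%:R) * \sum_(k < (m + n).+1) c k * c (m + n - k).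
Proof.
set N := (m + n)%N.
have e1 : \sum_(k < n.+1) k%:R * c (m + k) * c (n - k)
    = \sum_(m <= j < N.+1) (j%:R - m%:R) * c j * c (N - j).
  rewrite -[X in \sum_(X <= _ < _) _](add0n m) big_addn /N subSn ?leq_addr // addKn big_mkord.
  apply: eq_bigr => k _; rewrite natrD [(k + m)%N]addnC.
  by rewrite subnDl; ring.
have e2 : \sum_(k < m.+1) k%:R * c (n + k) * c (m - k)
    = \sum_(0 <= j < m) (m%:R - j%:R) * c j * c (N - j).
  rewrite -(big_mkord xpredT (fun k => k%:R * c (n + k) * c (m - k))).
  rewrite big_nat_rev /= add0n big_nat_recr //= subSS subnn !mul0r addr0.
  apply: eq_big_nat => j /andP[_ hj]; rewrite subSS subKn 1?ltnW //.
  rewrite natrB 1?ltnW //.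
  have -> : (n + (m - j) = N - j)%N by rewrite /N; lia.
  by ring.
rewrite e1 e2.
have -> : \sum_(m <= j < N.+1) (j%:R - m%:R) * c j * c (N - j)
   - \sum_(0 <= j < m) (m%:R - j%:R) * c j * c (N - j)
   = \sum_(0 <= j < N.+1) (j%:R - m%:R) * c j * c (N - j).
  rewrite [RHS](big_cat_nat (n := m)) //=; last by rewrite /N; lia.
  rewrite addrC -sumrN; congr (_ + _); apply: eq_bigr => j _; ring.
rewrite mulr2n {1}big_nat_rev /= add0n -big_split /= -(big_mkord xpredT (fun k => c k * c (N - k))).
rewrite mulr_sumr; apply: eq_big_nat => j /andP[_ hj].
rewrite subSS subKn // natrB // /N natrD; ring.
Qed.

Lemma wt_bracket m n :
  vfd m (wt n) - vfd n (wt m) = (n%:R - m%:R) * wt (m + n).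
Proof.
have vw a b : vfd a (wt b) = b.+1%:R * Q * (b%:R * c (a + b))
    - (\sum_(k < b.+1) k%:R * c (a + k) * c (b - k)) *+ 2.
  rewrite /wt vfdD vfdN !vfdM vfd_nat vfd_c vfd_sum.
  have -> : vfd a Q = 0 by rewrite /vfd big1 // => k _; rewrite dQ mulr0.
  congr (_ - _); first by ring.
  have e : \sum_(k < b.+1) vfd a (c k * c (b - k))
     = \sum_(0 <= k < b.+1) (k%:R * c (a + k) * c (b - k))
     + \sum_(0 <= k < b.+1) c k * ((b - k)%:R * c (a + (b - k))).
    rewrite -big_split big_mkord; apply: eq_bigr => k _ /=.
    by rewrite vfdM !vfd_c.
  rewrite e [X in _ + X]big_nat_rev /= add0n mulr2n big_mkord; congr (_ + _).
  rewrite big_mkord; apply: eq_bigr => k _.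
  have hk : (k <= b)%N by rewrite -ltnS.
  by rewrite subSS subKn //; ring.
rewrite !vw [(n + m)%N]addnC /wt mulrBr -wt_bracket_quad mulrnBl.
rewrite -!natr1 !natrD; ring.
Qed.

End Witt.

(** * Bracket of the R_n with its curvature terms *)

Section Bracket.
Variables (B : comNzRingType) (V : lmodType B) (s : nat) (c : nat -> B) (Q : B).
Variables (d : 'I_s -> {additive B -> B}) (N : 'I_s -> {additive V -> V}).
Variable L : nat -> {linear V -> V}.
Hypothesis dM : forall k a b, d k (a * b) = d k a * b + a * d k b.
Hypothesis dc : forall k n, d k (c n) = (n == k.+1)%:R.
Hypothesis dQ : forall k, d k Q = 0.
Hypothesis c_big : forall n, (s < n)%N -> c n = 0.
Hypothesis N_leib : forall k p v, N k (p *: v) = d k p *: v + p *: N k v.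
Hypothesis L_vir : forall m n v,
  L m (L n v) - L n (L m v) = (m%:R - n%:R) *: L (m + n)%N v.

Definition vfv n v : V := \sum_k frame c n k *: N k v.

Definition Rfl n v : V := L n v - wt c Q n *: v - vfv n v.

Lemma vfvD n u v : vfv n (u + v) = vfv n u + vfv n v.
Proof. by rewrite /vfv -big_split; apply: eq_bigr => k _; rewrite raddfD scalerDr. Qed.

Lemma vfvN n u : vfv n (- u) = - vfv n u.
Proof. by rewrite /vfv -sumrN; apply: eq_bigr => k _; rewrite raddfN scalerN. Qed.

Lemma vfvZ n p v : vfv n (p *: v) = vfd c d n p *: v + p *: vfv n v.
Proof.
rewrite /vfv /vfd scaler_suml scaler_sumr -big_split; apply: eq_bigr => k _ /=.
by rewrite N_leib scalerDr !scalerA [p * _]mulrC.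
Qed.

Lemma vfv_sum n I (t : seq I) (F : I -> V) :
  vfv n (\sum_(i <- t) F i) = \sum_(i <- t) vfv n (F i).
Proof.
rewrite /vfv exchange_big; apply: eq_bigr => k _.
by rewrite raddf_sum scaler_sumr.
Qed.

Lemma RflZ n p v : Rfl n (p *: v) = p *: Rfl n v - vfd c d n p *: v.
Proof.
rewrite /Rfl vfvZ linearZ /=; module_eq V.
Qed.

Lemma RflD n u v : Rfl n (u + v) = Rfl n u + Rfl n v.
Proof.
rewrite /Rfl vfvD linearD /=; module_eq V.
Qed.

Lemma RflN n u : Rfl n (- u) = - Rfl n u.
Proof. by rewrite /Rfl vfvN linearN scalerN -!opprD. Qed.

Lemma Rfl_sum n I (t : seq I) (F : I -> V) :
  Rfl n (\sum_(i <- t) F i) = \sum_(i <- t) Rfl n (F i).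
Proof.
rewrite /Rfl vfv_sum linear_sum scaler_sumr -!sumrN -!big_split.
exact: eq_bigr.
Qed.

Definition comLN m k v := L m (N k v) - N k (L m v).
Definition comNN k l v := N k (N l v) - N l (N k v).

Lemma vfv_vfv m n v :
  vfv m (vfv n v) - vfv n (vfv m v)
  = \sum_k (vfd c d m (frame c n k) - vfd c d n (frame c m k)) *: N k v
    + \sum_k \sum_l (frame c m k * frame c n l) *: comNN k l v.
Proof.
have e a b : vfv a (vfv b v) = \sum_k vfd c d a (frame c b k) *: N k v
   + \sum_k \sum_l (frame c a k * frame c b l) *: N k (N l v).
  rewrite {2}/vfv vfv_sum.
  under eq_bigr do rewrite vfvZ.
  rewrite big_split /=; congr (_ + _).
  rewrite [RHS]exchange_big; apply: eq_bigr => l _ /=.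
  rewrite /vfv scaler_sumr; apply: eq_bigr => k _.
  by rewrite scalerA mulrC.
rewrite !e opprD addrACA -sumrN -big_split /=; congr (_ + _).
  by apply: eq_bigr => k _; rewrite scalerBl.
rewrite [X in _ - X]exchange_big -sumrN -big_split /=; apply: eq_bigr => k _.
rewrite -sumrN -big_split /=; apply: eq_bigr => l _.
by rewrite [frame c n l * _]mulrC -scalerBr.
Qed.

Lemma L_vfv m n v :
  L m (vfv n v) - vfv n (L m v) = \sum_k frame c n k *: comLN m k v.
Proof.
rewrite /vfv linear_sum -sumrN -big_split; apply: eq_bigr => k _ /=.
by rewrite linearZ -scalerBr.
Qed.

(** The weights and the vector fields satisfy the relations dual to those of the L_n ([wt_bracket],
    [frame_bracket]), so only the failures of commutation [comNN] and [comLN] are left over. They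
    stay explicit because in rank r - 1 their vanishing is to be deduced from this very formula at
    v0. *)
Lemma Rfl_bracket m n v :
  Rfl m (Rfl n v) - Rfl n (Rfl m v)
  = (m%:R - n%:R) *: Rfl (m + n) v
    + \sum_k \sum_l (frame c m k * frame c n l) *: comNN k l v
    - \sum_k frame c n k *: comLN m k v
    + \sum_k frame c m k *: comLN n k v.
Proof.
have e a b : Rfl a (Rfl b v) = L a (L b v) - wt c Q b *: L a v - L a (vfv b v)
   - wt c Q a *: L b v + (wt c Q a * wt c Q b) *: v + wt c Q a *: vfv b v
   - vfv a (L b v) + vfd c d a (wt c Q b) *: v + wt c Q b *: vfv a v
   + vfv a (vfv b v).
  rewrite {1}/Rfl {1 2 3}/Rfl !vfvD !vfvN vfvZ !(linB (L _)) (linZ (L _)).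
  module_eq V.
have FF : \sum_k (vfd c d m (frame c n k) - vfd c d n (frame c m k)) *: N k v
   = (n%:R - m%:R) *: vfv (m + n) v.
  rewrite /vfv scaler_sumr; apply: eq_bigr => k _.
  by rewrite (frame_bracket dM dc c_big) scalerA.
have /subr_eqD LL := L_vir m n v; rewrite !e LL.
have := vfv_vfv m n v; rewrite FF => /subr_eqD ->.
rewrite -!L_vfv.
have /subr_eqD -> := wt_bracket dM dc dQ c_big m n.
rewrite /Rfl; module_eq V.
Qed.

End Bracket.

(** * Inverting the frame: the operators Z_j and their commutation *)

Section FrameInverse.
Variables (B : comNzRingType) (V : lmodType B) (s : nat) (c : nat -> B) (Q : B).
Variables (d : 'I_s -> {additive B -> B}) (N : 'I_s -> {additive V -> V}).
Variable L : nat -> {linear V -> V}.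
Hypothesis dM : forall k a b, d k (a * b) = d k a * b + a * d k b.
Hypothesis dc : forall k n, d k (c n) = (n == k.+1)%:R.
Hypothesis dQ : forall k, d k Q = 0.
Hypothesis c_big : forall n, (s < n)%N -> c n = 0.
Hypothesis N_leib : forall k p v, N k (p *: v) = d k p *: v + p *: N k v.
Hypothesis L_vir : forall m n v,
  L m (L n v) - L n (L m v) = (m%:R - n%:R) *: L (m + n)%N v.
Hypothesis N_flat : forall k l v, N k (N l v) = N l (N k v).
Hypothesis LN_comm : forall m k v, L m (N k v) = N k (L m v).
Variables (x : B) (ell : 'M[B]_s).
Hypothesis ellM : ell *m \matrix_(n, k) frame c n k = x%:M.
Hypothesis Mell : (\matrix_(n, k) frame c n k) *m ell = x%:M.

Notation Rf := (Rfl c Q N L).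

(* Zfl j is x times (the inverse frame applied to Rfl), i.e. x (A_j - N_j); the
   factor x = c_r^r clears the denominators, so nothing is inverted. *)
Definition Zfl (j : 'I_s) (v : V) : V := \sum_n ell j n *: Rf n v.

Lemma Rfl_flat_bracket m n v :
  Rf m (Rf n v) - Rf n (Rf m v) = (m%:R - n%:R) *: Rf (m + n) v.
Proof.
rewrite (Rfl_bracket dM dc dQ c_big N_leib L_vir).
rewrite [X in _ + X - _ + _]big1 => [|k _]; last first.
  by rewrite big1 // => l _; rewrite /comNN N_flat subrr scaler0.
rewrite [X in _ - X + _]big1 => [|k _]; last by rewrite /comLN LN_comm subrr scaler0.
rewrite [X in _ - _ + X]big1 => [|k _]; last by rewrite /comLN LN_comm subrr scaler0.
by rewrite subr0 !addr0.
Qed.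

Lemma Rfl0 n : Rf n 0 = 0.
Proof. by rewrite -[X in Rf n X](subrr 0) RflD RflN subrr. Qed.

Lemma Rfl_add_eq0 m n v :
  Rf m v = 0 -> Rf n v = 0 -> (m%:R - n%:R) *: Rf (m + n) v = 0.
Proof. by move=> hm hn; rewrite -Rfl_flat_bracket hm hn !Rfl0 subrr. Qed.

Lemma ellM_entry (j k : 'I_s) : \sum_n ell j n * frame c n k = x *+ (j == k).
Proof.
have /matrixP/(_ j k) := ellM; rewrite !mxE => <-.
by apply: eq_bigr => n _; rewrite mxE.
Qed.

Lemma Mell_entry (m n : 'I_s) : \sum_k frame c m k * ell k n = x *+ (m == n).
Proof.
have /matrixP/(_ m n) := Mell; rewrite !mxE => <-.
by apply: eq_bigr => k _; rewrite mxE.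
Qed.

(** Extends the entries of [ellM] to every positive shift: for a > s the left side vanishes with
    [c], the right side because j < s. *)
Lemma ell_shift j a : (0 < a)%N ->
  \sum_(n < s) ell j n * (a%:R * c (n + a)) = x *+ (a == j.+1).
Proof.
case: a => // a _; case: (ltnP a s) => ha.
  by have /= := ellM_entry j (Ordinal ha); rewrite eq_sym eqSS -val_eqE.
rewrite big1 => [|n _]; last by rewrite c_big ?mulr0 // ltn_addl.
by rewrite eqSS eqn_leq leqNgt (leq_trans (ltn_ord j) ha).
Qed.

Lemma Rfl_Zfl (m : 'I_s) v : x *: Rf m v = \sum_k frame c m k *: Zfl k v.
Proof.
under eq_bigr do rewrite scaler_sumr.
rewrite exchange_big /=.
under eq_bigr => n _ do (under eq_bigr do rewrite scalerA;
  rewrite -scaler_suml Mell_entry).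
rewrite (bigD1 m) //= eqxx mulr1n big1 ?addr0 // => n.
by rewrite eq_sym => /negPf ->; rewrite mulr0n scale0r.
Qed.

Lemma ZflD j u v : Zfl j (u + v) = Zfl j u + Zfl j v.
Proof.
by rewrite /Zfl -big_split; apply: eq_bigr => n _; rewrite RflD scalerDr.
Qed.

Lemma ZflN j u : Zfl j (- u) = - Zfl j u.
Proof. by rewrite /Zfl -sumrN; apply: eq_bigr => n _; rewrite RflN scalerN. Qed.

Lemma Zfl_sum j I (t : seq I) (F : I -> V) :
  Zfl j (\sum_(i <- t) F i) = \sum_(i <- t) Zfl j (F i).
Proof.
rewrite /Zfl exchange_big; apply: eq_bigr => n _.
by rewrite Rfl_sum scaler_sumr.
Qed.

Lemma ell_sum_frame (U : lmodType B) j (F : 'I_s -> U) :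
  \sum_n ell j n *: (\sum_k frame c n k *: F k) = x *: F j.
Proof.
under eq_bigr do rewrite scaler_sumr.
rewrite exchange_big /=.
under eq_bigr => n _ do (under eq_bigr do rewrite scalerA;
  rewrite -scaler_suml ellM_entry).
rewrite (bigD1 j) //= eqxx mulr1n big1 ?addr0 // => n.
by rewrite eq_sym => /negPf ->; rewrite mulr0n scale0r.
Qed.

Lemma ZflE j v :
  Zfl j v = \sum_n ell j n *: (L n v - wt c Q n *: v) - x *: N j v.
Proof.
rewrite -(@ell_sum_frame _ j (fun k => N k v)) -sumrN -big_split.
by apply: eq_bigr => n _ /=; rewrite -scalerBr.
Qed.

Lemma ZflZ j p v : Zfl j (p *: v) = p *: Zfl j v - (x * d j p) *: v.
Proof.
have e : x * d j p = \sum_n ell j n * vfd c d n p.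
  exact/esym/(@ell_sum_frame B^o j (fun k => d k p)).
rewrite e /Zfl scaler_sumr scaler_suml -sumrN -big_split; apply: eq_bigr => n _ /=.
rewrite (RflZ _ _ _ N_leib) scalerBr !scalerA [p * _]mulrC //.
Qed.

Hypothesis x_tf : forall v : V, x *: v = 0 -> v = 0.
Variable w : V.
Hypothesis Rw : forall n, (s <= n)%N -> Rf n w = 0.

Let G i j := \sum_k (\sum_n ell j n * d i (frame c n k)) *: Zfl k w.

(** The outer Z_i differentiates the coefficients of the inner one, giving - x d_i(ell) R_n w. Here
    x R_n w is re-expanded in the Z_k w, and the product rule on ell * frame = x moves the
    derivative from ell to the frame, where it is explicit. *)
Lemma Zfl_Zfl i j : Zfl i (Zfl j w) =
  \sum_n \sum_m (ell j n * ell i m) *: Rf m (Rf n w) - d i x *: Zfl j w + G i j.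
Proof.
rewrite {2}/Zfl Zfl_sum.
under eq_bigr do rewrite ZflZ.
rewrite big_split /= -addrA; congr (_ + _).
  apply: eq_bigr => n _; rewrite /Zfl scaler_sumr.
  by apply: eq_bigr => m _; rewrite scalerA.
have -> : \sum_n - ((x * d i (ell j n)) *: Rf n w) =
   - \sum_k (\sum_n d i (ell j n) * frame c n k) *: Zfl k w.
  rewrite sumrN; congr (- _).
  under [RHS]eq_bigr do rewrite scaler_suml.
  rewrite exchange_big; apply: eq_bigr => n _ /=.
  rewrite mulrC -scalerA Rfl_Zfl scaler_sumr.
  by apply: eq_bigr => k _; rewrite scalerA.
have -> : d i x *: Zfl j w = \sum_k d i (x *+ (j == k)) *: Zfl k w.
  rewrite (bigD1 j) //= eqxx mulr1n big1 ?addr0 // => k.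
  by rewrite eq_sym => /negPf ->; rewrite mulr0n raddf0 scale0r.
rewrite -!sumrN /G -big_split; apply: eq_bigr => k _ /=.
rewrite -ellM_entry [d i (\sum_n _)]raddf_sum -!scaleNr -scalerDl; congr (_ *: _).
rewrite -!sumrN -big_split; apply: eq_bigr => n _ /=.
by rewrite dM; ring.
Qed.

Lemma dframe i n (k : 'I_s) : d i (frame c n k) = k.+1%:R *+ (n + k == i)%N.
Proof.
rewrite /frame dM (dnat dM) mul0r add0r dc addnS eqSS.
by case: eqP => _; rewrite ?mulr1 ?mulr0.
Qed.

(** After multiplication by x each R_(m+n) w expands in the Z_k w. Writing m - n = (m + k + 1) - (n
    + k + 1) splits the coefficient into two halves, each contracted by [ell_shift] over one of the
    two indices; what is left is ell times a derivative of the frame, which is [G]. Absence of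
    x-torsion removes the factor. *)
Lemma ell_ell_bracket i j :
  \sum_(n < s) \sum_(m < s) (ell j n * ell i m) *: ((m%:R - n%:R) *: Rf (m + n) w)
  = G j i - G i j.
Proof.
apply/eqP; rewrite -subr_eq0; apply/eqP/x_tf.
rewrite scalerBr scaler_sumr.
have e (n m : 'I_s) : x *: (ell j n * ell i m *: ((m%:R - n%:R) *: Rf (m + n)%N w)) =
   \sum_(k < s) ((ell i m * (k.+1%:R * (ell j n * ((m + k).+1%:R * c (n + (m + k).+1)))))
         - (ell j n * (k.+1%:R * (ell i m * ((n + k).+1%:R * c (m + (n + k).+1)))))) *: Zfl k w.
  have -> : x *: (ell j n * ell i m *: ((m%:R - n%:R) *: Rf (m + n)%N w))
     = (ell j n * ell i m * (m%:R - n%:R)) *: \sum_(k < s) frame c (m + n) k *: Zfl k w.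
    (* For m + n >= s there is no frame row to expand in, but R_(m+n) w = 0 and the coefficients
       vanish as well. *)
    case: (ltnP (m + n) s) => h.
      by rewrite -(Rfl_Zfl (Ordinal h)) !scalerA /= -[in LHS]mulrA [in RHS]mulrC.
    rewrite Rw // !scaler0 big1 ?scaler0 // => k _.
    by rewrite /frame c_big ?mulr0 ?scale0r //; lia.
  rewrite scaler_sumr; apply: eq_bigr => k _; rewrite scalerA; congr (_ *: _).
  have -> : (n + (m + k).+1 = m + n + k.+1)%N by lia.
  have -> : (m + (n + k).+1 = m + n + k.+1)%N by lia.
  by rewrite /frame -!natr1 !natrD; ring.
have -> : \sum_(n < s) x *: \sum_(m < s) (ell j n * ell i m) *: ((m%:R - n%:R) *: Rf (m + n) w)
  = \sum_(k < s) (\sum_(n < s) \sum_(m < s) ((ell i m * (k.+1%:R * (ell j n * ((m + k).+1%:R * c (n + (m + k).+1)))))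
         - (ell j n * (k.+1%:R * (ell i m * ((n + k).+1%:R * c (m + (n + k).+1))))))) *: Zfl k w.
  under eq_bigr => n _ do (rewrite scaler_sumr; under eq_bigr => m _ do rewrite e).
  under [RHS]eq_bigr do (rewrite scaler_suml; under eq_bigr do rewrite scaler_suml).
  rewrite [RHS]exchange_big; apply: eq_bigr => n _.
  by rewrite [RHS]exchange_big.
rewrite /G -sumrB scaler_sumr -sumrB big1 // => k _.
rewrite -scalerBl scalerA -scalerBl.
have h a b : \sum_(m < s) ell a m * (k.+1%:R * (\sum_(n < s) ell b n *
      ((m + k).+1%:R * c (n + (m + k).+1)))) = x * \sum_(n < s) ell a n * d b (frame c n k).
  rewrite mulr_sumr; apply: eq_bigr => m _.
  rewrite ell_shift // dframe eqSS.
  by case: (m + k == b)%N; rewrite ?mulr0n ?mulr1n; ring.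
under eq_bigr do rewrite sumrB.
rewrite sumrB exchange_big /=.
have -> : \sum_(j0 < s) \sum_(i0 < s)
      ell i j0 * (k.+1%:R * (ell j i0 * ((j0 + k).+1%:R * c (i0 + (j0 + k).+1))))
   = x * \sum_(n < s) ell i n * d j (frame c n k).
  rewrite -h; apply: eq_bigr => m _; rewrite -!mulr_sumr.
  by congr (_ * _).
have -> : \sum_(i0 < s) \sum_(i1 < s)
      ell j i0 * (k.+1%:R * (ell i i1 * ((i0 + k).+1%:R * c (i1 + (i0 + k).+1))))
   = x * \sum_(n < s) ell j n * d i (frame c n k).
  rewrite -h; apply: eq_bigr => m _; rewrite -!mulr_sumr.
  by congr (_ * _).
by rewrite mulrBr subrr scale0r.
Qed.

(** This is [X_i, X_j] w = 0 for X_j = Z_j / x, with x cleared: the right side is what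
    differentiating the factors x produces. *)
Lemma Zfl_bracket i j :
  Zfl i (Zfl j w) - Zfl j (Zfl i w) = d j x *: Zfl i w - d i x *: Zfl j w.
Proof.
rewrite !Zfl_Zfl.
have -> : \sum_n \sum_m (ell i n * ell j m) *: Rf m (Rf n w) =
   \sum_n \sum_m (ell j n * ell i m) *: Rf n (Rf m w).
  rewrite exchange_big; apply: eq_bigr => n _; apply: eq_bigr => m _.
  by rewrite mulrC.
have := ell_ell_bracket i j.
under eq_bigr => n _ do under eq_bigr => m _ do rewrite -Rfl_flat_bracket scalerBr.
under eq_bigr => n _ do rewrite sumrB.
rewrite sumrB => /subr_eqD ->.
set S := (X in _ + X - _ + _ - _); set S' := (X in _ - (X - _ + _)).
have -> : S = S' by []; module_eq V.
Qed.

Lemma Zfl0 j : Zfl j 0 = 0.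
Proof. by rewrite -[X in Zfl j X](subrr 0) ZflD ZflN subrr. Qed.

Lemma Zfl_Zfl_ker i j : Zfl i w = 0 -> Zfl i (Zfl j w) = - (d i x *: Zfl j w).
Proof.
move=> h; have := Zfl_bracket i j; rewrite h Zfl0 subr0 scaler0 sub0r; exact.
Qed.

(** For m >= s the vector field of index m is zero, so R_m is linear over the coefficients, and
    [R_m, R_n] is a multiple of R_(m+n) with m + n >= s again. *)
Lemma Rfl_Zfl_whittaker m (j : 'I_s) : (s <= m)%N -> Rf m (Zfl j w) = 0.
Proof.
move=> hm; rewrite /Zfl Rfl_sum big1 // => n _.
rewrite (RflZ _ _ _ N_leib) /vfd big1 => [|k _]; last first.
  by rewrite /frame c_big ?mulr0 ?mul0r //; lia.
have /subr_eqD -> := Rfl_flat_bracket m n w.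
rewrite (Rw hm) [Rf (m + n) w]Rw; last by lia.
have -> : Rf n 0 = 0 by rewrite -[0 in LHS](scale0r 0) (RflZ _ _ _ N_leib) raddf0 ?scaler0 ?scale0r ?subrr.
by rewrite scaler0 addr0 scaler0 scale0r subr0.
Qed.

End FrameInverse.

(** * The inverse frame and its coefficients *)

Section FrameDet.
Variables (B : comNzRingType) (s : nat) (c : nat -> B).
Hypothesis c_big : forall n, (s < n)%N -> c n = 0.

Definition frame_mx : 'M[B]_s := \matrix_(n, k) frame c n k.

(* Reversing the rows makes the frame lower triangular, with diagonal k c_s. *)
Lemma det_frame_mx :
  exists b : bool, \det frame_mx = (-1) ^+ b * (s`!%:R * c s ^+ s).
Proof.
pose p : 'S_s := perm (@rev_ord_inj s).
exists (p : bool).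
have trig : is_trig_mx (row_perm p frame_mx).
  apply/is_trig_mxP => i j lt_ij; rewrite !mxE permE /frame /= c_big ?mulr0 //.
  by have := ltn_ord i; have := ltn_ord j; lia.
have := det_trig trig; rewrite [in \det _]row_permE det_mulmx det_perm => e.
apply: (canRL (signrMK _)); rewrite e.
transitivity (\prod_(i < s) (i.+1%:R * c s)).
  apply: eq_bigr => i _; rewrite !mxE permE /frame /=; congr (_ * c _).
  by have := ltn_ord i; lia.
rewrite big_split /= prodr_const card_ord; congr (_ * _).
by rewrite -natr_prod fact_prod big_add1 /= big_mkord.
Qed.

Lemma frame_mx_inv u x : u * \det frame_mx = x ->
  (u *: \adj frame_mx) *m frame_mx = x%:M
  /\ frame_mx *m (u *: \adj frame_mx) = x%:M.
Proof.
move=> <-; rewrite -scalemxAl -scalemxAr mul_adj_mx mul_mx_adj.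
by rewrite !scale_scalar_mx.
Qed.

End FrameDet.

(** * Subrings as predicates *)

Section Subring.
Variable B : comNzRingType.

(** Serves four purposes: the ring A, polynomials in c_r with coefficients in A, the constants of a
    derivation, and the whole field. *)
Record is_subring (S : B -> Prop) : Prop := IsSubring {
  subring1 : S 1;
  subringB : forall x y, S x -> S y -> S (x - y);
  subringM : forall x y, S x -> S y -> S (x * y)
}.

Variable S : B -> Prop.
Hypothesis hS : is_subring S.

Lemma subring0 : S 0.
Proof. by rewrite -(subrr 1); apply: (subringB hS); apply: (subring1 hS). Qed.

Lemma subringN x : S x -> S (- x).
Proof. by rewrite -sub0r; apply: (subringB hS); apply: subring0. Qed.

Lemma subringD x y : S x -> S y -> S (x + y).
Proof. by move=> hx hy; rewrite -[y]opprK; apply: (subringB hS) => //; apply: subringN. Qed.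

Lemma subring_sum I (t : seq I) (P : pred I) F :
  (forall i, P i -> S (F i)) -> S (\sum_(i <- t | P i) F i).
Proof. by move=> h; apply: big_ind => //; [apply: subring0 | apply: subringD]. Qed.

Lemma subring_prod I (t : seq I) (P : pred I) F :
  (forall i, P i -> S (F i)) -> S (\prod_(i <- t | P i) F i).
Proof.
by move=> h; apply: big_ind => //; [apply: (subring1 hS) | apply: (subringM hS)].
Qed.

Lemma subringX x n : S x -> S (x ^+ n).
Proof. by move=> hx; rewrite -[n]card_ord -prodr_const; apply: subring_prod. Qed.

Lemma subring_nat n : S n%:R.
Proof.
elim: n => [|n IHn]; first exact: subring0.
by rewrite -natr1; apply: subringD => //; apply: (subring1 hS).
Qed.

Lemma subring_int (n : int) : S n%:~R.
Proof.
case: n => n; first exact: subring_nat.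
by rewrite NegzE mulrNz; apply: subringN; apply: subring_nat.
Qed.

Lemma subring_sign (b : bool) : S ((-1) ^+ b).
Proof. by apply: subringX; apply: subringN; apply: (subring1 hS). Qed.

Lemma subring_det n (A : 'M[B]_n) : (forall i j, S (A i j)) -> S (\det A).
Proof.
move=> hA; apply: subring_sum => p _; apply: (subringM hS).
  exact: subring_sign.
by apply: subring_prod.
Qed.

Lemma subring_adj n (A : 'M[B]_n) i j :
  (forall i j, S (A i j)) -> S (\adj A i j).
Proof.
move=> hA; rewrite mxE; apply: (subringM hS).
  by apply: subringX; apply: subringN; apply: (subring1 hS).
by apply: subring_det => k l; rewrite !mxE.
Qed.

End Subring.

Lemma subring_poly (B : comNzRingType) (S : B -> Prop) : is_subring S ->
  is_subring (fun p : {poly B} => forall i, S p`_i).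
Proof.
move=> hS; split=> [i|p q hp hq i|p q hp hq i].
- by rewrite coef1; apply: subring_nat.
- by rewrite coefB; apply: (subringB hS).
- by rewrite coefM; apply: subring_sum => // j _; apply: (subringM hS).
Qed.

Lemma subringT (B : comNzRingType) : is_subring (fun _ : B => True).
Proof. by split. Qed.

(** * Derivations of a fraction field *)

Lemma quotient_deriv_add (F : fieldType) (a b a' b' p q p' q' : F) :
    b != 0 -> b' != 0 ->
  ((p * b' + a * q' + (p' * b + a' * q)) * (b * b')
     - (a * b' + a' * b) * (q * b' + b * q')) / (b * b') ^+ 2
  = (p * b - a * q) / b ^+ 2 + (p' * b' - a' * q') / b' ^+ 2.
Proof. by move=> b0 b0'; field; rewrite b0 b0'. Qed.

Lemma quotient_deriv_mul (F : fieldType) (a b a' b' p q p' q' : F) :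
    b != 0 -> b' != 0 ->
  ((p * a' + a * p') * (b * b') - a * a' * (q * b' + b * q')) / (b * b') ^+ 2
  = (p * b - a * q) / b ^+ 2 * (a' / b') + a / b * ((p' * b' - a' * q') / b' ^+ 2).
Proof. by move=> b0 b0'; field; rewrite b0 b0'. Qed.

Section FractionDerivation.
Variables (A : idomainType) (d : A -> A).
Hypothesis dD : forall a b, d (a + b) = d a + d b.
Hypothesis dM : forall a b, d (a * b) = d a * b + a * d b.
Notation tf := (@FracField.tofrac A).
Notation fd := (frac_deriv d).

Lemma frac_ind (P : {fraction A} -> Prop) :
  (forall a b, b != 0 -> P (tf a / tf b)) -> forall x, P x.
Proof. by move=> h x; rewrite (repr_tofrac x); apply: h; apply: denom_ratioP. Qed.

Lemma frac_deriv1 : d 1 = 0.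
Proof. by have := dM 1 1; rewrite !mulr1 mul1r => /(canLR (addrK _)); rewrite subrr. Qed.

Lemma frac_derivD x y : fd (x + y) = fd x + fd y.
Proof.
elim/frac_ind: x => a b b0; elim/frac_ind: y => a' b' b0'.
have tb0 : tf b != 0 by rewrite tofrac_eq0.
have tb0' : tf b' != 0 by rewrite tofrac_eq0.
rewrite addf_div // -!rmorphM -rmorphD !frac_derivE ?mulf_neq0 // !dD !dM.
rewrite !(rmorphB, rmorphD, rmorphM) /=; exact: quotient_deriv_add.
Qed.

Lemma frac_derivM x y : fd (x * y) = fd x * y + x * fd y.
Proof.
elim/frac_ind: x => a b b0; elim/frac_ind: y => a' b' b0'.
have tb0 : tf b != 0 by rewrite tofrac_eq0.
have tb0' : tf b' != 0 by rewrite tofrac_eq0.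
rewrite mulf_div -!rmorphM !frac_derivE ?mulf_neq0 // !dM.
rewrite !(rmorphB, rmorphD, rmorphM) /=; exact: quotient_deriv_mul.
Qed.

Lemma frac_deriv_tofrac a : fd (tf a) = tf (d a).
Proof.
have -> : tf a = tf a / tf 1 by rewrite rmorph1 divr1.
by rewrite frac_derivE ?oner_neq0 // frac_deriv1 mulr0 subr0 mulr1 rmorph1 expr1n divr1.
Qed.

End FractionDerivation.

(** No second-order quotient rule: with t = a / b, both compositions are applied to t b = a, where
    they agree on a and b, and the difference on t is a multiple of b that can be cancelled. *)
Lemma frac_deriv_comm (A : idomainType) (d e : A -> A)
    (dD : forall a b, d (a + b) = d a + d b)
    (dM : forall a b, d (a * b) = d a * b + a * d b)
    (eD : forall a b, e (a + b) = e a + e b)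
    (eM : forall a b, e (a * b) = e a * b + a * e b)
    (de : forall a, d (e a) = e (d a)) x :
  frac_deriv d (frac_deriv e x) = frac_deriv e (frac_deriv d x).
Proof.
elim/frac_ind: x => a b b0.
have tb0 : FracField.tofrac b != 0 by rewrite tofrac_eq0.
have := divfK tb0 (FracField.tofrac a); move: (_ / _) => t ht.
have := frac_derivM eM t (FracField.tofrac b).
have := frac_derivM dM t (FracField.tofrac b).
rewrite ht !frac_deriv_tofrac // => h1 h2.
apply: (mulIf tb0).
have := congr1 (frac_deriv e) h1; have := congr1 (frac_deriv d) h2.
rewrite (frac_derivD dD dM) 2!(frac_derivM dM _ (FracField.tofrac _)) !(frac_deriv_tofrac dM) => e2.
rewrite (frac_derivD eD eM) 2!(frac_derivM eM _ (FracField.tofrac _)) !(frac_deriv_tofrac eM) -!de e2.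
move: (frac_deriv d (frac_deriv e t)) (frac_deriv e (frac_deriv d t)) => y z.
move: (frac_deriv e t) (frac_deriv d t) (FracField.tofrac b) => u v tb.
move: (FracField.tofrac (d b)) (FracField.tofrac (e b)) => p q.
move: (FracField.tofrac _) => o h.
apply: (addIr (u * p + (v * q + t * o))).
by rewrite addrA h; ring.
Qed.

(** * The parameter field *)

Section ParameterField.
Variables (R : realType) (r : nat).
Hypothesis hr : (2 <= r)%N.
Notation K := (parField R r).
Notation F := (baseField R).

Lemma polyFD (p q : {mpoly F[r.-1]}) : polyF (p + q) = polyF p + polyF q :> K.
Proof. exact: rmorphD. Qed.

Lemma polyFN (p : {mpoly F[r.-1]}) : polyF (- p) = - polyF p :> K.
Proof. exact: rmorphN. Qed.

Lemma polyFM (p q : {mpoly F[r.-1]}) : polyF (p * q) = polyF p * polyF q :> K.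
Proof. exact: rmorphM. Qed.

Lemma polyF1 : polyF (1 : {mpoly F[r.-1]}) = 1 :> K.
Proof. exact: rmorph1. Qed.

Lemma polyF0 : polyF (0 : {mpoly F[r.-1]}) = 0 :> K.
Proof. exact: rmorph0. Qed.

Lemma polyFX (p : {mpoly F[r.-1]}) n : polyF (p ^+ n) = polyF p ^+ n :> K.
Proof. exact: rmorphXn. Qed.

Lemma polyF_eq0 (p : {mpoly F[r.-1]}) : (polyF p == 0 :> K) = (p == 0).
Proof. exact: tofrac_eq0. Qed.

Lemma base_natr_eq0 n : (n%:R == 0 :> F) = (n == 0%N).
Proof.
rewrite -(rmorph_nat (@FracField.tofrac _)) tofrac_eq0.
rewrite -(rmorph_nat (@mpolyC 3 _)) mpolyC_eq0.
exact: pnatr_eq0.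
Qed.

Lemma baseF_eq0 (x : F) : (baseF r x == 0) = (x == 0).
Proof. by rewrite /baseF polyF_eq0 mpolyC_eq0. Qed.

Lemma baseF1 : baseF r (1 : F) = 1.
Proof. by rewrite /baseF mpolyC1 polyF1. Qed.

Lemma par_natr_eq0 n : (n%:R == 0 :> K) = (n == 0%N).
Proof.
rewrite -base_natr_eq0 -baseF_eq0 /baseF /polyF.
by rewrite (rmorph_nat (@mpolyC r.-1 _)) rmorph_nat.
Qed.

Lemma fracderivD (i : 'I_r.-1) (x y : K) :
  fracderiv i (x + y) = fracderiv i x + fracderiv i y.
Proof. by apply: frac_derivD; [exact: mderivD | exact: mderivM]. Qed.

Lemma fracderivM (i : 'I_r.-1) (x y : K) :
  fracderiv i (x * y) = fracderiv i x * y + x * fracderiv i y.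
Proof. by apply: frac_derivM; exact: mderivM. Qed.

Lemma fracderiv_polyF (i : 'I_r.-1) p :
  fracderiv i (polyF p) = polyF (mderiv i p) :> K.
Proof. by apply: frac_deriv_tofrac; exact: mderivM. Qed.

Lemma dparD k (x y : K) : dpar k (x + y) = dpar k x + dpar k y.
Proof. by rewrite /dpar -big_split; apply: eq_bigr => i _; apply: fracderivD. Qed.

Lemma dpar_is_nmod_morphism k : nmod_morphism (@dpar R r k).
Proof.
split=> [|x y]; last exact: dparD.
by apply: (addrI (dpar k 0)); rewrite -dparD !addr0.
Qed.

HB.instance Definition _ k :=
  GRing.isNmodMorphism.Build K K (@dpar R r k) (dpar_is_nmod_morphism k).

Lemma dpar0 k : dpar k (0 : K) = 0.
Proof. exact: (raddf0 (@dpar R r k)). Qed.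

Lemma dparM k (x y : K) : dpar k (x * y) = dpar k x * y + x * dpar k y.
Proof.
rewrite /dpar mulr_suml mulr_sumr -big_split; apply: eq_bigr => i _.
exact: fracderivM.
Qed.

Lemma dpar_polyF k p : dpar k (polyF p) =
  polyF (\sum_(i < r.-1 | i.+1 == k) mderiv i p) :> K.
Proof.
rewrite /dpar (big_morph _ polyFD polyF0).
by apply: eq_bigr => i _; apply: fracderiv_polyF.
Qed.

Lemma dpar_comm k l (x : K) : dpar k (dpar l x) = dpar l (dpar k x).
Proof.
rewrite /dpar; under eq_bigr => i _ do rewrite -/(fracderiv _ _).
have e (i : 'I_r.-1) (P : pred 'I_r.-1) (f : 'I_r.-1 -> K) :
   fracderiv i (\sum_(j | P j) f j) = \sum_(j | P j) fracderiv i (f j).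
  apply: (big_morph _ (fracderivD i)).
  by apply: (addrI (fracderiv i 0)); rewrite -fracderivD !addr0.
under eq_bigr do rewrite e.
under [RHS]eq_bigr do rewrite e.
rewrite exchange_big; apply: eq_bigr => i _; apply: eq_bigr => j _.
apply: frac_deriv_comm; try exact: mderivM; try exact: mderivD.
by move=> a; rewrite mderiv_comm.
Qed.

Lemma dpar_base k (x : F) : dpar k (baseF r x) = 0.
Proof.
rewrite /baseF dpar_polyF big1 ?polyF0 // => i _; exact: mderivC.
Qed.

Lemma dpar_int k (z : int) : dpar k (z%:~R : K) = 0.
Proof.
have h : dpar k (1 : K) = 0 by rewrite -baseF1 dpar_base.
by rewrite (raddfMz (@dpar R r k)) /= h mul0rz.
Qed.

Lemma clowE (i : 'I_r.-1) : clow R r i.+1 = polyF 'X_i.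
Proof.
rewrite /clow (bigD1 i) //= big1 ?addr0 // => j /andP[/eqP[] ij].
by rewrite -val_eqE /= ij eqxx.
Qed.

Lemma clow_out k : (k == 0%N) || (r <= k)%N -> clow R r k = 0.
Proof.
move=> h; rewrite /clow big1 // => i /eqP ik.
by have := ltn_ord i; case/orP: h => [/eqP|]; lia.
Qed.

Lemma dpar_clow k l : (0 < k < r)%N -> dpar k (clow R r l) = (l == k)%:R.
Proof.
case: k => // k /andP[_ hk].
have hk' : (k < r.-1)%N by lia.
have eD x : dpar k.+1 x = fracderiv (Ordinal hk') x.
  rewrite /dpar (bigD1 (Ordinal hk')) //= big1 ?addr0 // => j /andP[/eqP[] ij].
  by rewrite -val_eqE /= ij eqxx.
have [h|h] := boolP ((l == 0%N) || (r <= l)%N).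
  have /negPf -> : l != k.+1 by case/orP: h => [/eqP-> //|]; lia.
  by rewrite clow_out // dpar0 mulr0n.
case: l h => // l; rewrite /= -ltnNge => h.
have hl' : (l < r.-1)%N by lia.
rewrite eD (clowE (Ordinal hl')) fracderiv_polyF mderivX mnmE /= eqSS.
rewrite -val_eqE /=; case: (eqVneq l k) => e; last by rewrite scale0r polyF0.
rewrite scale1r; have -> : (U_(Ordinal hl') - U_(Ordinal hk') = 0 :> 'X_{1.. r.-1})%MM.
  by apply/mnmP => j; rewrite !mnmE -!val_eqE /= e subnn.
by rewrite mpolyX0 polyF1.
Qed.

Lemma clow_last_neq0 : clow R r r.-1 != 0.
Proof.
have h : (r.-2 < r.-1)%N by lia.
have -> : r.-1 = (Ordinal h).+1 by rewrite /=; lia.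
rewrite clowE polyF_eq0; apply/eqP => /(congr1 (mcoeff U_(Ordinal h))).
by rewrite mcoeffX eqxx mcoeff0 => /eqP; rewrite oner_eq0.
Qed.

Lemma inA_polyF p : inA (polyF p : K).
Proof. by exists p, 0%N; rewrite expr0 divr1. Qed.

Lemma inA_baseF x : inA (baseF r x : K).
Proof. exact: inA_polyF. Qed.

Lemma clow_polyF k : exists p, clow R r k = polyF p.
Proof.
by exists (\sum_(i < r.-1 | i.+1 == k) 'X_i); rewrite (big_morph _ polyFD polyF0).
Qed.

Lemma inA_clow k : inA (clow R r k).
Proof. by have [p ->] := clow_polyF k; apply: inA_polyF. Qed.

Lemma inA_subring : is_subring (@inA R r).
Proof.
have nz := clow_last_neq0; have [q hq] := clow_polyF r.-1.
split; first by rewrite -polyF1; apply: inA_polyF.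
- move=> _ _ [p [n ->]] [p' [n' ->]].
  exists (p * q ^+ n' - p' * q ^+ n), (n + n')%N.
  rewrite polyFD polyFN !polyFM !polyFX -hq -mulNr addf_div ?expf_neq0 //.
  by rewrite exprD mulNr.
- move=> _ _ [p [n ->]] [p' [n' ->]].
  by exists (p * p'), (n + n')%N; rewrite mulf_div polyFM exprD.
Qed.

Lemma inA_inv_clow : inA (clow R r r.-1)^-1.
Proof. by exists 1, 1%N; rewrite polyF1 mul1r expr1. Qed.

Lemma natV_baseF n : (n%:R^-1 : K) = baseF r (n%:R^-1 : F).
Proof.
case: n => [|n]; first by rewrite !invr0 /baseF mpolyC0 polyF0.
have h : (n.+1%:R : K) != 0 by rewrite par_natr_eq0.
apply: (mulIf h); rewrite mulVf //.
have -> : (n.+1%:R : K) = baseF r (n.+1%:R : F).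
  by rewrite /baseF /polyF (rmorph_nat (@mpolyC r.-1 _)) rmorph_nat.
by rewrite /baseF -polyFM -mpolyCM mulVf ?base_natr_eq0 // mpolyC1 polyF1.
Qed.

Lemma inA_natV n : inA (n%:R^-1 : K).
Proof. by rewrite natV_baseF; apply: inA_baseF. Qed.

(** Stability of A under derivatives is needed for the terms d g_i / dc_k that come from the
    prefactor. *)
Lemma inA_dpar k (x : K) : inA x -> inA (dpar k x).
Proof.
have SA := inA_subring; have nz := clow_last_neq0.
move=> [p [n ->]]; set c := clow R r r.-1.
have iV : inA (c ^- n) by rewrite -exprVn; exact: (subringX SA n inA_inv_clow).
have dV : dpar k (c ^- n) = - (c ^- n) ^+ 2 * dpar k (c ^+ n).
  have nz' : c ^+ n != 0 by rewrite expf_neq0.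
  apply: (mulIf nz'); have := dparM k (c ^- n) (c ^+ n).
  have -> : dpar k (c ^- n * c ^+ n) = 0.
    by rewrite mulVf // -baseF1 dpar_base.
  move=> /eqP; rewrite eq_sym addr_eq0 => /eqP ->.
  by rewrite expr2 mulNr mulNr -!mulrA [dpar _ _ * _]mulrC mulKf.
rewrite dparM dV; apply: (subringD SA).
  by apply: (subringM SA) => //; rewrite dpar_polyF; apply: inA_polyF.
apply: (subringM SA); first exact: inA_polyF.
apply: (subringM SA); first by apply/(subringN SA)/(subringX SA).
have [q hq] := clow_polyF r.-1.
by rewrite /c hq -polyFX dpar_polyF; apply: inA_polyF.
Qed.

Lemma inA_inALaur (x : K) : inA x -> inALaur x.
Proof.
have h : (r.-2 < r.-1)%N by lia.
move=> [p [n ->]]; exists p, (U_(Ordinal h) *+ n)%MM.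
have e : r.-1 = (Ordinal h).+1 by rewrite /=; lia.
by rewrite [in LHS]e clowE -polyFX mpolyXn.
Qed.

End ParameterField.

(** * The irregular Verma module *)

Section Straightening.
Variables (R : realType) (r : nat).
Hypothesis hr : (2 <= r)%N.
Notation K := (parField R r).
Notation e := r.-1.
Variables (M : lmodType K) (L : int -> {linear M -> M}) (v0 : M).
Hypothesis hM : is_irregular_verma L v0.
Notation pbw := (pbw L v0).

Lemma Lamlow_double : Lamlow R r (e + e) = - clow R r e ^+ 2.
Proof.
rewrite /Lamlow (@clow_out R r hr (e + e)%N) ?mulr0 ?sub0r; last by apply/orP; right; lia.
congr (- _); rewrite (bigD1_seq e) ?mem_index_iota ?iota_uniq //=; last by lia.
rewrite addnK -expr2 big1_seq ?addr0 // => k /andP[ne]; rewrite mem_index_iota => hk.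
case: (ltnP k e) => h; last by rewrite (@clow_out R r hr k) ?mul0r //; apply/orP; right; lia.
by rewrite (@clow_out R r hr (e + e - k)%N) ?mulr0 //; apply/orP; right; lia.
Qed.

Lemma Lamlow_big n : (e + e < n)%N -> Lamlow R r n = 0.
Proof.
move=> hn; rewrite /Lamlow (@clow_out R r hr n) ?mulr0 ?sub0r; last by apply/orP; right; lia.
rewrite big1_seq ?oppr0 // => k /andP[_]; rewrite mem_index_iota => hk.
case: (ltnP e k) => h; first by rewrite (@clow_out R r hr k) ?mul0r //; apply/orP; right; lia.
by rewrite (@clow_out R r hr (n - k)%N) ?mulr0 //; apply/orP; right; lia.
Qed.

Lemma is_part_cons a l :
  is_part (a :: l) = [&& (0 < a)%N, is_part l & all (fun b => b <= a)%N l].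
Proof.
rewrite /is_part /= (path_sortedE (rev_trans leq_trans)).
by case: (0 < a)%N; case: (sorted _ _); case: (all _ _); case: (all _ _).
Qed.

Lemma sumn_rem (k : nat) l : k \in l -> (k + sumn (rem k l) = sumn l)%N.
Proof.
elim: l => // a l IHl; rewrite inE /= eq_sym; case: eqP => [->//|_] /= /IHl <-.
by rewrite addnCA.
Qed.

Lemma is_part_rem k l : is_part l -> is_part (rem k l).
Proof.
case/andP=> sl al; apply/andP; split.
  exact: (subseq_sorted (rev_trans leq_trans) (rem_subseq k l)).
by apply/allP => x /mem_rem /(allP al).
Qed.

Section Filtration.
Variable S : K -> Prop.
Hypothesis hS : is_subring S.

(** The bound is an integer because operators of large index push weights below 0, where only the
    zero vector is left. The ring [S] of coefficients is a parameter: the Whittaker argument uses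
    the whole field, the integrality argument uses A. *)
Inductive fil (d : int) : M -> Prop :=
  | Fil0 : fil d 0
  | FilStep x a l : fil d x -> S a -> is_part l -> (sumn l)%:Z <= d ->
      fil d (x + a *: pbw l).

Lemma filD d x y : fil d x -> fil d y -> fil d (x + y).
Proof.
move=> hx; elim: y / => [|y a l _ IHy Sa pl dl]; first by rewrite addr0.
by rewrite addrA; apply: FilStep.
Qed.

Lemma filZ d c x : S c -> fil d x -> fil d (c *: x).
Proof.
move=> Sc; elim: x / => [|x a l _ IHx Sa pl dl]; first by rewrite scaler0; apply: Fil0.
by rewrite scalerDr scalerA; apply: FilStep => //; apply: (subringM hS).
Qed.

Lemma filN d x : fil d x -> fil d (- x).
Proof.
by rewrite -scaleN1r; apply: filZ; apply: (subringN hS); apply: (subring1 hS).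
Qed.

Lemma filB d x y : fil d x -> fil d y -> fil d (x - y).
Proof. by move=> hx /filN; apply: filD. Qed.

Lemma fil_le d d' x : d <= d' -> fil d x -> fil d' x.
Proof.
move=> dd'; elim: x / => [|x a l _ IHx Sa pl dl]; first exact: Fil0.
by apply: FilStep => //; apply: le_trans dd'.
Qed.

Lemma fil_pbw d l : is_part l -> (sumn l)%:Z <= d -> fil d (pbw l).
Proof.
move=> pl dl; rewrite -[pbw l]add0r -[X in _ + X]scale1r.
by apply: FilStep => //; [apply: Fil0 | apply: (subring1 hS)].
Qed.

Hypothesis S_Lam : forall n, S (Lamlow R r n).
Hypothesis S_clow : S (clow R r e).
Hypothesis S_central : S ((1 + 6%:R * Qpar R r ^+ 2) / 12%:R).

Let tail k l : M := ((2 * k * count_mem k l)%:R * clow R r e ^+ 2) *: pbw (rem k l).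

Let lower l := forall a : nat, (0 < a)%N ->
  fil ((sumn l)%:Z + a%:Z) (L (e%:Z - a%:Z) (pbw l)).
Let raise l := forall k : nat, fil ((sumn l)%:Z - k%:Z - 1)
  (L (e%:Z + k%:Z) (pbw l) - Lamlow R r (e + k) *: pbw l + tail k l).

Lemma fil_tail k l d : is_part l -> (sumn l)%:Z - k%:Z <= d -> fil d (tail k l).
Proof.
move=> pl hd; rewrite /tail; have [kl|/count_memPn ->] := boolP (k \in l); last first.
  by rewrite muln0 mul0r scale0r; apply: Fil0.
apply: filZ.
  by apply: (subringM hS); [apply: subring_nat | apply: subringX].
apply: fil_pbw; first exact: is_part_rem.
by apply: le_trans hd; have := sumn_rem kl; lia.
Qed.

Let fil_L l m d : is_part l -> lower l -> raise l ->
  (sumn l)%:Z <= d -> (sumn l)%:Z + e%:Z - m <= d -> fil d (L m (pbw l)).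
Proof.
move=> pl low rai d1 d2; have [h|h] := ltP m e%:Z.
  have -> : m = e%:Z - `|e%:Z - m|%N%:Z by lia.
  by apply: fil_le (low _ _); lia.
have em : m = e%:Z + `|m - e%:Z|%N%:Z by lia.
have := rai `|m - e%:Z|%N; rewrite -em; set k := `|_|%N => rk.
have -> : L m (pbw l) = (L m (pbw l) - Lamlow R r (e + k) *: pbw l + tail k l)
    + Lamlow R r (e + k) *: pbw l - tail k l by module_eq M.
apply: filB; last by apply: fil_tail => //; lia.
apply: filD; first by apply: fil_le rk; lia.
by apply: filZ => //; apply: fil_pbw.
Qed.

(* Write x_a for L_(r-1-a), of weight a. Modulo lower weight, L_(r-1+k) - Lambda'
   acts on the PBW basis as - 2k c_(r-1)^2 d/dx_k: the only contribution of weight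
   sumn l - k is [L_(r-1+k), L_(r-1-k)] = 2k L_(2r-2), and L_(2r-2) v0 =
   - c_(r-1)^2 v0. *)
Lemma pbw_straight n l : is_part l -> (sumn l < n)%N -> lower l /\ raise l.
Proof.
(* Strong induction on the weight. Both halves go together: moving an operator past the first factor
   b leaves bracket terms of arbitrary index on y, for which [fil_L] needs [lower] and [raise] at
   y. *)
elim: n l => // n IHn [|b y] pl hn.
  split=> [a a0|k].
    by apply: (@fil_pbw _ [:: a]); rewrite /is_part /= ?a0 //; lia.
  rewrite /tail muln0 mul0r scale0r addr0 -PoszD /=.
  by rewrite (verma_vec hM) ?leq_addr // subrr; apply: Fil0.
move: (pl); rewrite is_part_cons => /and3P[b0 py /allP hy].
have ny : (sumn y < n)%N by move: hn => /=; lia.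
have [lowy raiy] := IHn y py ny.
have Lfil d x a : (0 < a)%N -> d < n%:Z -> fil d x ->
    fil (d + a%:Z) (L (e%:Z - a%:Z) x).
  move=> a0 dn; elim: x / => [|x c z _ IHx Sc pz dz].
    by rewrite linear0; apply: Fil0.
  rewrite linearD linearZ; apply: filD => //; apply: filZ => //.
  have nz : (sumn z < n)%N by lia.
  by have [lowz _] := IHn z pz nz; apply: fil_le (lowz a a0); lia.
have cen (c : int) (m : bool) : fil (sumn y)%:Z
   (if m then ((1 + 6%:R * Qpar R r ^+ 2) / 12%:R * c%:~R) *: pbw y else 0).
  case: m; last exact: Fil0.
  apply: filZ; last exact: fil_pbw.
  by apply: (subringM hS) => //; apply: subring_int.
have vir m : L m (pbw (b :: y)) = L (e%:Z - b%:Z) (L m (pbw y))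
   + (m - (e%:Z - b%:Z))%:~R *: L (m + (e%:Z - b%:Z)) (pbw y)
   + (if m + (e%:Z - b%:Z) == 0 then
        ((1 + 6%:R * Qpar R r ^+ 2) / 12%:R * (m ^+ 3 - m)%:~R) *: pbw y else 0).
  have /subr_eqD /= -> := verma_rep hM m (e%:Z - b%:Z) (pbw y).
  by rewrite -[RHS]addrA [RHS]addrC.
have Sint (m : int) : S m%:~R by apply: subring_int.
split=> [a a0|k].
  (* If a >= b, prefixing a already gives a partition; otherwise the new factor must be moved past
     b. *)
  have [le_ba|lt_ab] := leqP b a.
    apply: (@fil_pbw _ [:: a, b & y]); last by rewrite /=; lia.
    rewrite is_part_cons a0 pl /= le_ba /=; apply/allP => c /hy; lia.
  rewrite vir; apply: filD; last by apply: fil_le (cen _ _); rewrite /=; lia.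
  apply: filD.
    apply: fil_le (Lfil ((sumn y)%:Z + a%:Z) _ b b0 _ (lowy a a0)).
      by rewrite /=; lia.
    by move: hn => /=; lia.
  by apply: filZ => //; apply: fil_L => //=; lia.
rewrite vir; set m := e%:Z + k%:Z; set q := e%:Z - b%:Z.
have absorb (x1 x2 : M) : L q (L m (pbw y)) + x1 + x2 - Lamlow R r (e + k) *: pbw (b :: y)
      + tail k (b :: y)
    = L q (L m (pbw y) - Lamlow R r (e + k) *: pbw y + tail k y) + x1 + x2
      + (tail k (b :: y) - L q (tail k y)).
  rewrite (linD (L q)) (linB (L q)) (linZ (L q)).
  rewrite -[pbw (b :: y)]/(L q (pbw y)); module_eq M.
rewrite absorb.
have E1 : fil ((sumn (b :: y))%:Z - k%:Z - 1)
    (L q (L m (pbw y) - Lamlow R r (e + k) *: pbw y + tail k y)).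
  apply: fil_le (Lfil ((sumn y)%:Z - k%:Z - 1) _ b b0 _ (raiy k)) => /=; first by lia.
  by lia.
have rot (x1 x2 x3 x4 : M) : x1 + x2 + x3 + x4 = x1 + (x4 + (x2 + x3)).
  by rewrite -!addrA; congr (_ + _); rewrite addrA addrC.
rewrite rot; apply: (filD E1).
(* The bracket with the first factor has index 2(r-1) + k - b. For k < b its weight is too small to
   matter; for k > b the index exceeds 2(r-1), where Lambda' vanishes, and the weight drops further;
   k = b is the critical case, with Lambda'_(2r-2) = - c_(r-1)^2. *)
have [lt_kb|lt_bk|eq_bk] := ltngtP k b.
- have -> : tail k (b :: y) = L q (tail k y).
    rewrite /tail linearZ /=.
    by have -> : (b == k) = false by apply/eqP; lia.
  rewrite subrr add0r; apply: filD; last by apply: fil_le (cen _ _); rewrite /=; lia.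
  by apply: filZ => //; apply: fil_L => //=; rewrite ?/m ?/q; lia.
- have ky : k \notin y by apply/negP => /hy; lia.
  have -> : tail k (b :: y) - L q (tail k y) = 0.
    rewrite /tail /= (count_memPn ky).
    have -> : (b == k) = false by apply/eqP; lia.
    by rewrite !muln0 !mul0r !scale0r linear0 subr0.
  have -> : (m + q == 0) = false by apply/eqP; rewrite /m /q; lia.
  rewrite add0r addr0; apply: filZ => //.
  have em : m + q = e%:Z + (e + k - b)%N%:Z by rewrite /m /q; lia.
  have := raiy (e + k - b)%N; rewrite -em Lamlow_big; last by lia.
  rewrite scale0r subr0; set t := tail _ y => h.
  rewrite -[L _ (pbw y)](addrK t); apply: filB; first by apply: fil_le h => /=; lia.
  by apply: fil_tail => //=; lia.
subst k.
have -> : (m + q == 0) = false by apply/eqP; rewrite /m /q; lia.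
have -> : tail b (b :: y) - L q (tail b y) = (2 * b)%:R * clow R r e ^+ 2 *: pbw y.
  rewrite /tail /= eqxx linearZ /=.
  have [by_|/count_memPn by_] := boolP (b \in y); last first.
    by rewrite by_ muln0 mul0r scale0r subr0 addn0 muln1.
  case: y py hy by_ {pl hn ny lowy raiy Lfil cen vir absorb E1} => // a y py hy by_.
  (* All parts of y are at most b, so if b occurs in y it is its head, and [rem] removes a head on
     both sides. *)
  have ab : a = b.
    apply/eqP; rewrite eqn_leq hy ?mem_head //=.
    move: py by_; rewrite is_part_cons inE => /and3P[_ _ /allP h].
    by case/orP => [/eqP->//|/h].
  rewrite ab /= eqxx -scalerBl -mulrBl -natrB; last by rewrite leq_mul2l leq_addl orbT.
  by rewrite -mulnBr addnK muln1.
rewrite addr0.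
have em : m + q = e%:Z + e%:Z by rewrite /m /q; lia.
have e2 : (m - q)%:~R = (2 * b)%:R :> K.
  by have -> : m - q = (2 * b)%N%:Z by rewrite /m /q; lia.
rewrite em e2 -scalerA -scalerDr; apply: filZ; first exact: subring_nat.
have := raiy e; rewrite Lamlow_double scaleNr opprK => h.
have -> : clow R r e ^+ 2 *: pbw y + L (e%:Z + e%:Z) (pbw y) =
    (L (e%:Z + e%:Z) (pbw y) + clow R r e ^+ 2 *: pbw y + tail e y) - tail e y.
  module_eq M.
apply: filB; first by apply: fil_le h => /=; lia.
by apply: fil_tail => //=; lia.
Qed.

Lemma pbw_raise l k : is_part l -> fil ((sumn l)%:Z - k%:Z - 1)
  (L (e%:Z + k%:Z) (pbw l) - Lamlow R r (e + k) *: pbw l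
   + ((2 * k * count_mem k l)%:R * clow R r e ^+ 2) *: pbw (rem k l)).
Proof. by move=> pl; have [_ h] := pbw_straight pl (ltnSn _); apply: h. Qed.

Lemma fil_act m d x : fil d x -> exists d', fil d' (L m x).
Proof.
elim: x / => [|x a l _ [d' IHx] Sa pl dl].
  by exists d; rewrite linear0; apply: Fil0.
have [low rai] := pbw_straight pl (ltnSn _).
exists (Num.max d' (Num.max (sumn l)%:Z ((sumn l)%:Z + e%:Z - m))).
rewrite linearD linearZ; apply: filD.
  by apply: fil_le IHx; rewrite le_max lexx.
by apply: filZ => //; apply: fil_L => //; rewrite !le_max lexx ?orbT.
Qed.

End Filtration.
End Straightening.

Lemma wt0 (B : comNzRingType) (c : nat -> B) Q : wt c Q 0 = c 0%N * (Q - c 0%N).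
Proof. by rewrite /wt big_ord1 subnn; ring. Qed.

Lemma wt_pos (B : comNzRingType) (c : nat -> B) Q n : (0 < n)%N ->
  wt c Q n = (n.+1%:R * Q - 2%:R * c 0%N) * c n - \sum_(1 <= k < n) c k * c (n - k)%N.
Proof.
move=> n0; rewrite /wt -(big_mkord xpredT (fun k => c k * c (n - k)%N)).
by rewrite big_ltn // big_nat_recr //= subn0 subnn; ring.
Qed.

Lemma big_uniq_eq (V : nmodType) (I : eqType) (s : seq I) (x : I) (f : I -> V) :
  uniq s -> x \in s -> \sum_(l <- s | x == l) f l = f x.
Proof.
move=> us xs; rewrite -big_filter (eq_filter (a2 := pred1 x)); last exact: eq_sym.
by rewrite filter_pred1_uniq // big_seq1.
Qed.

(** * PBW coordinates and the line of Whittaker vectors *)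

Section Coordinates.
Variables (R : realType) (r : nat).
Hypothesis hr : (2 <= r)%N.
Notation K := (parField R r).
Notation e := r.-1.
Variables (M : lmodType K) (L : int -> {linear M -> M}) (v0 : M).
Hypothesis hM : is_irregular_verma L v0.
Notation pbw := (pbw L v0).

Let comb (ps : seq (K * seq nat)) : M := \sum_(p <- ps) p.1 *: pbw p.2.
Let good (ps : seq (K * seq nat)) := all (fun p => is_part p.2) ps.
Let cf l (ps : seq (K * seq nat)) := \sum_(p <- ps | p.2 == l) p.1.

Lemma verma_ind_pbw (P : M -> Prop) : (forall x y, P x -> P y -> P (x + y)) ->
  (forall a l, is_part l -> P (a *: pbw l)) -> forall x, P x.
Proof.
move=> PD PZ x; have [s [a [ps ->]]] := verma_span hM x.
elim: s ps => [_|l s IHs /= /andP[pl /IHs Ps]].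
  by rewrite big_nil -(scale0r (pbw [::])); apply: PZ.
by rewrite big_cons; apply: PD => //; apply: PZ.
Qed.

Lemma comb_eq0 ps l : good ps -> comb ps = 0 -> cf l ps = 0.
Proof.
move=> gp c0; have [hl|hl] := boolP (l \in map snd ps); last first.
  rewrite /cf big_seq_cond big1 // => p /andP[hp /eqP pl].
  by case/negP: hl; rewrite -pl; apply: map_f.
apply: (@verma_free _ _ _ _ _ hM (undup (map snd ps)) (cf ^~ ps)).
- rewrite all_undup; apply/allP => _ /mapP[p /(allP gp) pp ->]; exact: pp.
- exact: undup_uniq.
- rewrite -[RHS]c0 /comb /cf.
  under eq_bigr do rewrite scaler_suml.
  rewrite (exchange_big_dep xpredT) //= [LHS]big_seq [RHS]big_seq.
  apply: eq_bigr => p hp.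
  have hp2 : p.2 \in undup (map snd ps) by rewrite mem_undup map_f.
  by rewrite big_uniq_eq ?undup_uniq.
- by rewrite mem_undup.
Qed.

Lemma ex_repr x : {ps | good ps & x = comb ps}.
Proof.
apply: cid2; have [s [a [ps ->]]] := verma_span hM x.
exists [seq (a l, l) | l <- s]; first by rewrite /good all_map.
by rewrite /comb big_map.
Qed.

(** Some expansion is chosen, possibly with repeated partitions, which [cf] adds up; freeness of the
    PBW family makes the choice irrelevant ([coord_comb]). *)
Definition coord (l : seq nat) (x : M) : K := cf l (s2val (ex_repr x)).

Lemma coord_comb l ps : good ps -> coord l (comb ps) = cf l ps.
Proof.
move=> gp; rewrite /coord; case: (ex_repr _) => qs /= gq e.
have gn : good ([seq (- p.1, p.2) | p <- qs] ++ ps).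
  by rewrite /good all_cat all_map; apply/andP.
have /(comb_eq0 l gn) : comb ([seq (- p.1, p.2) | p <- qs] ++ ps) = 0.
  rewrite /comb big_cat big_map /= -/(comb ps) e.
  under eq_bigr do rewrite scaleNr.
  by rewrite sumrN addNr.
rewrite /cf big_cat big_map /= sumrN => /eqP.
by rewrite addrC subr_eq0 => /eqP.
Qed.

Lemma coord_pbw l m : is_part m -> coord l (pbw m) = (m == l)%:R.
Proof.
move=> pm; have -> : pbw m = comb [:: (1, m)] by rewrite /comb big_seq1 scale1r.
rewrite coord_comb /cf ?big_cons ?big_nil /= ?addr0; first by case: eqP.
by rewrite /good /= pm.
Qed.

Lemma coord_pbw_nil : coord [::] v0 = 1.
Proof. exact: (@coord_pbw [::] [::]). Qed.

Lemma coordD l x y : coord l (x + y) = coord l x + coord l y.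
Proof.
case: (ex_repr x) (ex_repr y) => ps gp -> [qs gq ->].
have gpq : good (ps ++ qs) by rewrite /good all_cat; apply/andP.
have -> : comb ps + comb qs = comb (ps ++ qs) by rewrite /comb big_cat.
by rewrite !coord_comb // /cf big_cat.
Qed.

Lemma coordZ l a x : coord l (a *: x) = a * coord l x.
Proof.
case: (ex_repr x) => ps gp ->.
have -> : a *: comb ps = comb [seq (a * p.1, p.2) | p <- ps].
  rewrite /comb big_map scaler_sumr; apply: eq_bigr => p _; exact: scalerA.
rewrite !coord_comb // /cf ?big_map /= ?mulr_sumr //.
by rewrite /good all_map.
Qed.

Lemma coord0 l : coord l 0 = 0.
Proof. by rewrite -[X in coord l X](scale0r (0 : M)) coordZ mul0r. Qed.

Lemma coord_sum l I (t : seq I) (f : I -> M) :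
  coord l (\sum_(i <- t) f i) = \sum_(i <- t) coord l (f i).
Proof.
exact: (big_morph _ (coordD l) (coord0 l)).
Qed.

Lemma coord_fil S d l x : is_subring S -> fil L v0 S d x ->
  S (coord l x) /\ (d < (sumn l)%:Z -> coord l x = 0).
Proof.
move=> hS; elim: x / => [|x a m _ [Sx x0] Sa pm dm].
  rewrite coord0; split; [exact (subring0 hS) | by []].
rewrite coordD coordZ coord_pbw //; split=> [|dl].
  by apply: (subringD hS) => //; apply: (subringM hS) => //; exact: (subring_nat hS).
rewrite x0 // add0r; case: eqP => [e|]; last by rewrite mulr0.
by move: dm dl; rewrite e => /le_lt_trans h /h; rewrite ltxx.
Qed.

Lemma coord_support x : exists s, [/\ uniq s, all is_part s,
  forall l, l \notin s -> coord l x = 0 & x = \sum_(l <- s) coord l x *: pbw l].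
Proof.
case: (ex_repr x) => ps gp ex; exists (undup (map snd ps)); split.
- exact: undup_uniq.
- rewrite all_undup; apply/allP => _ /mapP[p /(allP gp) pp ->]; exact: pp.
- move=> l; rewrite mem_undup => hl; rewrite ex coord_comb // /cf big_seq_cond big1 //.
  by move=> p /andP[hp /eqP pl]; case/negP: hl; rewrite -pl; apply: map_f.
- rewrite ex; under eq_bigr => l _ do rewrite (coord_comb l gp) /cf scaler_suml.
  rewrite (exchange_big_dep xpredT) //= /comb [LHS]big_seq [RHS]big_seq.
  apply: eq_bigr => p hp.
  have hp2 : p.2 \in undup (map snd ps) by rewrite mem_undup map_f.
  by rewrite big_uniq_eq ?undup_uniq.
Qed.

Lemma part_rem_inj k l m : is_part l -> is_part m -> k \in l -> k \in m ->
  rem k l = rem k m -> l = m.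
Proof.
move=> /andP[sl _] /andP[sm _] kl km e1.
apply: (sorted_eq (rev_trans leq_trans) _ sl sm).
  by move=> x y /andP[h1 h2]; apply/eqP; rewrite eqn_leq; apply/andP.
rewrite (perm_trans (perm_to_rem kl)) // perm_sym e1.
exact: perm_to_rem.
Qed.

(* By pbw_raise, u has no component of maximal positive weight. *)
Lemma whittaker_line u :
    (forall n, (r <= n)%N -> L n%:Z u = Lamlow R r n *: u) ->
  exists b, u = b *: v0.
Proof.
move=> hu; exists (coord [::] u).
have [s [us ps s0 es]] := coord_support u.
pose N := \max_(l <- s) sumn l.
have hN l : l \in s -> (sumn l <= N)%N by move=> ls; apply: leq_bigmax_seq.
(* Descending induction on the weight of l: the larger n, the further l may lie below the maximal
   weight N occurring in u. *)
suff h n l : is_part l -> l != [::] -> (N < sumn l + n)%N -> coord l u = 0.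
  rewrite {1}es.
  have [h0|h0] := boolP ([::] \in s); last first.
    rewrite s0 // scale0r big_seq big1 // => l ls.
    rewrite (h N.+1) ?scale0r ?(allP ps) //; last by lia.
    by apply: contraNneq h0 => <-.
  rewrite (bigD1_seq [::]) //= big_seq_cond big1 ?addr0 // => l /andP[ls l0].
  by rewrite (h N.+1) ?scale0r ?(allP ps) //; lia.
elim: n l => [|n IHn] l pl l0 hl.
  by rewrite s0 //; apply/negP => /hN; lia.
case: l pl l0 hl => // k m pl _ hl.
have [kms|/s0//] := boolP (k :: m \in s).
move: (pl); rewrite is_part_cons => /and3P[k0 pm _].
(* Test with k the largest part: in weight |m| the operator L_(r-1+k) - Lambda' sees only the
   vectors l with [rem k l = m], and k :: m is the only such partition containing k. As k > 0, the
   index is at least r, so the hypothesis on u applies. *)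
have := congr1 (coord m) (hu (e + k)%N ltac:(lia)).
rewrite coordZ => /eqP; rewrite -subr_eq0.
have -> : coord m (L (e + k)%:Z u) - Lamlow R r (e + k) * coord m u =
   - \sum_(l <- s) coord l u * ((2 * k * count_mem k l)%:R * clow R r e ^+ 2
       * (rem k l == m)%:R).
  rewrite -coordZ -[- coord m _]mulN1r -coordZ -coordD {1 2}es.
  rewrite linear_sum !scaler_sumr -big_split coord_sum -sumrN big_seq [RHS]big_seq.
  apply: eq_bigr => l ls /=; have pl' := allP ps _ ls.
  have [lt_l|le_l] := ltnP (sumn (k :: m)) (sumn l).
    rewrite (IHn l) //; last by lia.
      by rewrite !scale0r (linear0 (L _)) !scaler0 addr0 coord0 mul0r oppr0.
    by apply: contraTneq lt_l => ->.
  have ST := subringT K.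
  have [_ h] := coord_fil m ST (pbw_raise hr hM ST (fun=> I) I I k pl').
  rewrite linearZ /= !scaleN1r scalerA mulrC -scalerA -scalerBr coordZ -mulrN.
  congr (_ * _); apply/eqP; rewrite -addr_eq0; apply/eqP.
  rewrite -(coord_pbw m) ?is_part_rem // -coordZ -coordD PoszD h //.
  by move: le_l => /=; lia.
rewrite oppr_eq0 (bigD1_seq (k :: m)) //=.
rewrite big_seq_cond big1 ?addr0 => [|l /andP[ls ne]]; last first.
  have [kl|/count_memPn ->] := boolP (k \in l); last by rewrite muln0 !mul0r mulr0.
  case: eqP => [em|]; last by rewrite !mulr0.
  case/eqP: ne; apply: (part_rem_inj _ pl kl (mem_head _ _)) => //.
    exact: (allP ps).
  by rewrite /= eqxx.
rewrite !eqxx mulr1 mulf_eq0 mulf_eq0 par_natr_eq0.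
rewrite (negPf (expf_neq0 2 (clow_last_neq0 R hr))) orbF.
by case/orP=> [/eqP//|]; rewrite !muln_eq0 /=; lia.
Qed.

End Coordinates.

(** * Flatness in rank r - 1 *)

Section LowerRank.
Variables (R : realType) (r : nat).
Hypothesis hr : (2 <= r)%N.
Notation K := (parField R r).
Notation e := r.-1.
Variables (M : lmodType K) (L : int -> {linear M -> M}) (v0 : M).
Hypothesis hM : is_irregular_verma L v0.
Variable D : nat -> {additive M -> M}.
Hypothesis hD : is_par_derivation L D.
Hypothesis hlow : lower_deformation L D v0.
Notation pbw := (pbw L v0).

Definition clow0 (k : nat) : K := if k == 0%N then c0p R r else clow R r k.

Let dK (k : 'I_e) : {additive K -> K} := @dpar R r k.+1.
Let DM (k : 'I_e) : {additive M -> M} := D k.+1.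
Let LM (n : nat) : {linear M -> M} := L n%:Z.

Let ord_lt (k : 'I_e) : (0 < k.+1 < r)%N.
Proof. by have := ltn_ord k; lia. Qed.

Lemma clow0_big n : (e < n)%N -> clow0 n = 0.
Proof.
case: n => // n h; rewrite /clow0 /= clow_out //; apply/orP; right; lia.
Qed.

Lemma dpar_clow0 (k : 'I_e) n : dpar k.+1 (clow0 n) = (n == k.+1)%:R.
Proof.
rewrite /clow0; case: n => [|n] /=; first by rewrite dpar_base.
by rewrite dpar_clow.
Qed.

Lemma dpar_Q k : dpar k (Qpar R r) = 0.
Proof. exact: dpar_base. Qed.

Lemma wt_low n : (0 < n)%N -> wt clow0 (Qpar R r) n = Lamlow R r n.
Proof.
move=> n0; rewrite wt_pos // /Lamlow /clow0 eqxx.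
case: eqP n0 => [->//|_] _; congr (_ - _); apply: eq_big_nat => k hk.
have -> : (k == 0%N) = false by apply/eqP; lia.
by have -> : (n - k == 0)%N = false by apply/eqP; lia.
Qed.

(** Among non-negative indices m + n = 0 forces m = 0, where m^3 - m = 0, so the central term
    disappears. *)
Lemma Vir_nat (V : lmodType K) (L' : int -> {linear V -> V}) : is_Vir_rep L' ->
  forall m n v, L' m%:Z (L' n%:Z v) - L' n%:Z (L' m%:Z v)
    = (m%:R - n%:R) *: L' (m + n)%N%:Z v.
Proof.
move=> h m n v; rewrite h rmorphB /= PoszD; case: eqP => [e0|_]; last by rewrite addr0.
have z0 : (m%:Z ^+ 3 - m%:Z)%:~R = 0 :> K.
  by have -> : m%:Z ^+ 3 - m%:Z = 0 by (have -> : m = 0%N by lia); rewrite ?mulr0z.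
by rewrite z0 mulr0 scale0r addr0.
Qed.

Let leibDM k (p : K) v : DM k (p *: v) = dK k p *: v + p *: DM k v.
Proof. exact: (par_leibniz hD _ _ (ord_lt k)). Qed.

Notation Rlow := (Rfl clow0 (Qpar R r) DM LM).

Lemma vf_lowE n v : vf_low D n v = vfv clow0 DM n v.
Proof.
rewrite /vf_low /vfv big_add1 /=.
have -> : \sum_(k < e) frame clow0 n k *: DM k v =
   \sum_(0 <= k < e) (k.+1%:R * clow0 (n + k.+1)) *: D k.+1 v.
  by rewrite big_mkord.
have le : ((r - n).-1 <= e)%N by lia.
rewrite [RHS](big_cat_nat (n := (r - n).-1)) //= [X in _ + X](_ : _ = 0).
  by rewrite addr0; apply: eq_bigr => k _; rewrite /clow0 addnS.
rewrite big_nat big1 // => k hk.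
by rewrite clow0_big ?mulr0 ?scale0r //; lia.
Qed.

(** The deformation equations cover n <= r - 2; from r - 1 on the lower vector field is empty and
    the Whittaker condition suffices. *)
Lemma Rlow_v0 n : Rlow n v0 = 0.
Proof.
rewrite /Rfl -vf_lowE; have [hL0 hLi] := hlow.
case: (posnP n) => [->|n0].
  by rewrite wt0 /clow0 eqxx /LM hL0 /Delta; module_eq M.
rewrite wt_low // /LM; have [le_n|lt_n] := leqP e n.
  by rewrite (verma_vec hM) // subrr /vf_low big_geq ?subr0 //; lia.
by rewrite hLi; [module_eq M | lia].
Qed.

Definition low_mx := @frame_mx K e clow0.

Lemma det_low_mx_neq0 : \det low_mx != 0.
Proof.
have [b ->] := @det_frame_mx K e clow0 clow0_big.
rewrite mulf_neq0 ?signr_eq0 // mulf_neq0 ?expf_neq0 //.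
  by rewrite par_natr_eq0 -lt0n fact_gt0.
have e0 : (e == 0%N) = false by apply/eqP; lia.
by rewrite /clow0 e0; apply: clow_last_neq0.
Qed.

Let adj_low : \adj low_mx *m low_mx = (\det low_mx)%:M.
Proof. exact: mul_adj_mx. Qed.

Lemma frame_inj (F : 'I_e -> M) :
  (forall n : 'I_e, \sum_k frame clow0 n k *: F k = 0) -> forall k, F k = 0.
Proof.
move=> h k; have := ell_sum_frame adj_low k F.
rewrite big1 => [/esym/eqP|n _]; last by rewrite h scaler0.
by rewrite scaler_eq0 (negPf det_low_mx_neq0) => /eqP.
Qed.

Let low_bracket := Rfl_bracket (N := DM) (L := LM) (d := dK)
  (fun k => @dparM R r k.+1) dpar_clow0 (fun k => dpar_Q k.+1) clow0_big leibDM
  (Vir_nat (verma_rep hM)).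

Lemma Rlow0 n : Rlow n 0 = 0.
Proof. by rewrite -[X in Rlow n X](subrr v0) RflD RflN subrr. Qed.

Lemma D_comm_v0 (p : int) k : (0 < k < r)%N -> D k (L p v0) = L p (D k v0).
Proof.
case: k => // k hk; have hk' : (k < e)%N by lia.
have [p_lt|p_ge] := ltP p e%:Z; first exact: (par_comm hD).
have -> : p = `|p|%N%:Z by lia.
have hp : (e <= `|p|)%N by lia.
suff : comLN DM LM `|p|%N (Ordinal hk') v0 = 0.
  by move=> /eqP; rewrite /comLN subr_eq0 => /eqP/esym.
apply: (@frame_inj (fun k => comLN DM LM `|p|%N k v0)) => n.
(* Here p >= r - 1, so row p of the frame vanishes. Of the bracket at v0 only the sum of
   [frame clow0 n k] times [L_p, D_k] v0 remains, and the frame is invertible. *)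
have := low_bracket `|p|%N n v0; rewrite !Rlow_v0 !Rlow0 scaler0 subr0 add0r.
have fz k' : frame clow0 `|p|%N k' = 0 :> K by rewrite /frame clow0_big ?mulr0 //; lia.
rewrite [X in X - _ + _]big1 => [|k' _]; last first.
  by rewrite big1 // => l _; rewrite fz mul0r scale0r.
rewrite [X in _ + X]big1 => [|k' _]; last by rewrite fz scale0r.
by rewrite sub0r addr0 => /eqP; rewrite eq_sym oppr_eq0 => /eqP.
Qed.

Lemma dpar_central k (z : int) :
  dpar k ((1 + 6%:R * Qpar R r ^+ 2) / 12%:R * z%:~R : K) = 0.
Proof.
pose S (x : K) := dpar k x = 0.
have hS : is_subring S.
  split=> [|x y hx hy|x y hx hy]; rewrite /S; first by rewrite -(baseF1 R r) dpar_base.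
    by rewrite (raddfB (@dpar R r k)) /= hx hy subr0.
  by rewrite dparM hx hy mulr0 mul0r addr0.
rewrite -/(S _); apply: (subringM hS); last exact: (subring_int hS).
apply: (subringM hS); last by rewrite /S natV_baseF dpar_base.
apply: (subringD hS); first exact: (subring1 hS).
by apply: (subringM hS); [exact: subring_nat | apply: subringX => //; exact: dpar_Q].
Qed.

(** From v0 to PBW words: L_p is moved past the first factor L_q by the Virasoro relation. Since q <
    r - 1, L_q commutes with D_k by hypothesis, and the structure constants and central charge are
    killed by d/dc_k. *)
Lemma D_comm_L k (p : int) x : (0 < k < r)%N -> D k (L p x) = L p (D k x).
Proof.
move=> hk; elim/(verma_ind_pbw hM): x => [x y hx hy|a l pl].
  by rewrite !(linearD, raddfD) /= hx hy.
rewrite linearZ /= !(par_leibniz hD) // linearD !linearZ /=; congr (_ + _ *: _).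
case/andP: pl => _; elim: l p => [|b y IHl] p /=; first by rewrite D_comm_v0.
case/andP=> b0 /IHl {}IHl; set q := e%:Z - b%:Z; set Y := pbw y.
have q_lt : q < e%:Z by rewrite /q; lia.
have /subr_eqD -> := verma_rep hM p q Y.
rewrite !(raddfD (D k)) /= [X in _ + X = _](par_comm hD) // IHl.
rewrite (par_comm hD Y) //.
have /subr_eqD -> := verma_rep hM p q (D k Y); congr (_ + _ + _).
  by rewrite (par_leibniz hD) // IHl dpar_int scale0r add0r.
case: eqP => _; last exact: raddf0.
by rewrite (par_leibniz hD) // dpar_central scale0r add0r.
Qed.

(** Now that the L_p commute with the D_k, the bracket formula at v0 retains only the curvature
    [D_k, D_l] v0, contracted with the frame in both indices; the frame is inverted twice. *)
Lemma D_comm k l x : (0 < k < r)%N -> (0 < l < r)%N -> D k (D l x) = D l (D k x).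
Proof.
move=> hk hl; elim/(verma_ind_pbw hM): x => [x y hx hy|a m pm].
  by rewrite !raddfD /= hx hy.
have h : D k (D l (pbw m)) = D l (D k (pbw m)).
  elim: m {pm} => [|b y IHm] /=; last by rewrite !D_comm_L // IHm.
  case: k hk => // k hk; case: l hl => // l hl.
  have hk' : (k < e)%N by lia.
  have hl' : (l < e)%N by lia.
  suff : comNN DM (Ordinal hk') (Ordinal hl') v0 = 0.
    by move=> /eqP; rewrite /comNN subr_eq0 => /eqP.
  apply: (@frame_inj (fun l => comNN DM (Ordinal hk') l v0)) => n.
  apply: (@frame_inj (fun k => \sum_l frame clow0 n l *: comNN DM k l v0)) => p.
  have := low_bracket p n v0; rewrite !Rlow_v0 !Rlow0 scaler0 subr0 add0r.
  rewrite [X in _ - X + _]big1 => [|k' _]; last first.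
    by rewrite /comLN /DM D_comm_L // subrr scaler0.
  rewrite [X in _ + X]big1 => [|k' _]; last first.
    by rewrite /comLN /DM D_comm_L // subrr scaler0.
  rewrite subr0 addr0 => e0; rewrite [RHS]e0; apply: eq_bigr => k' _.
  by rewrite scaler_sumr; apply: eq_bigr => l' _; rewrite scalerA.
rewrite !(par_leibniz hD) // (raddfD (D k)) (raddfD (D l)) /=.
rewrite !(par_leibniz hD) // h dpar_comm; exact: addrACA.
Qed.

(** The A-span of the PBW basis, phrased through the filtration so that stability under each L_m
    follows from [fil_act]. *)
Definition MA x := exists d, fil L v0 (@inA R r) d x.

Let SA := inA_subring R hr.

Lemma MA_D x y : MA x -> MA y -> MA (x + y).
Proof.
move=> [d hx] [d' hy]; exists (Num.max d d'); apply: filD.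
  by apply: fil_le hx; rewrite le_max lexx.
by apply: fil_le hy; rewrite le_max lexx orbT.
Qed.

Lemma MA_Z a x : inA a -> MA x -> MA (a *: x).
Proof. by move=> ha [d hx]; exists d; apply: filZ. Qed.

Lemma MA_0 : MA 0.
Proof. by exists 0; apply: Fil0. Qed.

Lemma MA_N x : MA x -> MA (- x).
Proof. by rewrite -scaleN1r; apply: MA_Z; apply/(subringN SA)/(subring1 SA). Qed.

Lemma MA_sum I (t : seq I) (P : pred I) F :
  (forall i, P i -> MA (F i)) -> MA (\sum_(i <- t | P i) F i).
Proof. by move=> h; apply: big_ind => //; [exact: MA_0 | exact: MA_D]. Qed.

Lemma MA_v0 : MA v0.
Proof. by exists 0; exact: (@fil_pbw _ _ _ L v0 _ SA 0 [::]). Qed.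

Lemma inA_Q : inA (Qpar R r). Proof. exact: inA_baseF. Qed.

Lemma inA_Lamlow n : inA (Lamlow R r n).
Proof.
apply: (subringB SA); last first.
  by apply: (subring_sum SA) => k _; apply: (subringM SA); apply: inA_clow.
apply: (subringM SA); last exact: inA_clow.
by apply: (subringB SA); apply: (subringM SA); try exact: (subring_nat SA); exact: inA_baseF.
Qed.

Lemma MA_L m x : MA x -> MA (L m x).
Proof.
move=> [d]; apply: (fil_act hr hM SA) => [n||].
- exact: inA_Lamlow.
- exact: inA_clow.
- apply: (subringM SA); last exact: inA_natV.
  apply: (subringD SA); first exact: (subring1 SA).
  apply: (subringM SA); first exact: (subring_nat SA).
  by apply: (subringX SA); apply: inA_Q.
Qed.

Lemma MA_inMA x : inMA L v0 x -> MA x.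
Proof.
move=> [s [a [ps ha ->]]]; rewrite big_seq; apply: MA_sum => l ls.
apply: MA_Z; first exact: ha.
by exists (sumn l)%:Z; exact: (@fil_pbw _ _ _ L v0 _ SA (sumn l)%:Z l (allP ps _ ls)).
Qed.

Lemma inA_clow0 k : inA (clow0 k).
Proof. by rewrite /clow0; case: eqP => _; [apply: inA_baseF | apply: inA_clow]. Qed.

Lemma inA_detV : inA (\det low_mx)^-1.
Proof.
have [b ->] := @det_frame_mx K e clow0 clow0_big.
rewrite !invfM -signr_odd; apply: (subringM SA).
  by rewrite signr_odd invr_sign; apply: (subring_sign SA).
apply: (subringM SA); first exact: inA_natV.
have e0 : (e == 0%N) = false by apply/eqP; lia.
by rewrite -exprVn; apply: (subringX SA); rewrite /clow0 e0; apply: inA_inv_clow.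
Qed.

(** The lower deformation equations are solved for D_k v0 by Cramer's rule; the determinant is a
    unit of A, being +-(r-1)! c_(r-1)^(r-1). *)
Lemma MA_Dv0 k : (0 < k < r)%N -> MA (D k v0).
Proof.
case: k => // k hk; have hk' : (k < e)%N by lia.
have := ell_sum_frame adj_low (Ordinal hk') (fun k => DM k v0).
move=> /(congr1 (fun v => (\det low_mx)^-1 *: v)).
rewrite scalerA mulVf ?det_low_mx_neq0 // scale1r => <-.
apply: MA_Z; first exact: inA_detV.
apply: MA_sum => n _; apply: MA_Z.
  apply: (subring_adj SA) => i j; rewrite mxE.
  by apply: (subringM SA); [exact: (subring_nat SA) | exact: inA_clow0].
rewrite -/(vfv _ _ _ _) (_ : vfv _ _ _ _ = LM n v0 - wt clow0 (Qpar R r) n *: v0); last first.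
  have := Rlow_v0 n; rewrite /Rfl => /eqP; rewrite subr_eq0 => /eqP ->; exact.
apply: MA_D; first exact: MA_L MA_v0.
apply/MA_N/MA_Z; last exact: MA_v0.
apply: (subringB SA); last first.
  by apply: (subring_sum SA) => i _; apply: (subringM SA); apply: inA_clow0.
apply: (subringM SA); last exact: inA_clow0.
by apply: (subringM SA); [exact: (subring_nat SA) | exact: inA_Q].
Qed.

Lemma MA_line_inA b : MA (b *: v0) -> inA b.
Proof.
move=> [d /(coord_fil hM [::] SA)[]].
by rewrite (coordZ hM) (coord_pbw_nil hM) mulr1.
Qed.

Lemma v0_neq0 : v0 != 0.
Proof.
apply/eqP => h; have := coord_pbw_nil hM.
by rewrite {2}h (coord0 hM) => /esym/eqP; rewrite oner_eq0.
Qed.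

End LowerRank.

(** * Series in c_r *)

Section SeriesModule.
Variables (F : fieldType) (M : lmodType F).

(** Series in c_r and log c_r are made a module over polynomials in c_r, so that the abstract
    bracket calculus applies with c_r as one more parameter. *)
HB.instance Definition _ := GRing.Zmodule.copy (fser M) (int -> nat -> M).

Lemma fser_ext (s t : fser M) : s =2 t -> s = t.
Proof. by move=> h; apply/funext => n; apply/funext => m; apply: h. Qed.

Lemma fserD (s t : fser M) n m : (s + t) n m = s n m + t n m.
Proof. by []. Qed.

Lemma fserN (s : fser M) n m : (- s) n m = - s n m.
Proof. by []. Qed.

Lemma fser0 n m : (0 : fser M) n m = 0.
Proof. by []. Qed.

Lemma fser_sum I (t : seq I) (P : pred I) (f : I -> fser M) n m :
  (\sum_(i <- t | P i) f i) n m = \sum_(i <- t | P i) f i n m.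
Proof. by rewrite (big_morph (fun s : fser M => s n m) (fun s t => fserD s t n m) (fser0 n m)). Qed.

Definition ser_shift (i : int) (s : fser M) : fser M := fun n m => s (n + i) m.

Lemma ser_pmul_wide (p : {poly F}) N (s : fser M) n m : (size p <= N)%N ->
  ser_pmul p s n m = \sum_(i < N) p`_i *: s (n - i%:Z) m.
Proof.
move=> h; rewrite /ser_pmul -(big_mkord xpredT (fun i => p`_i *: s (n - i%:Z) m)).
rewrite -[RHS](big_mkord xpredT (fun i => p`_i *: s (n - i%:Z) m)).
rewrite [RHS](big_cat_nat (n := size p)) //= [X in _ + X](_ : _ = 0) ?addr0 //.
by rewrite big_nat big1 // => i /andP[hi _]; rewrite nth_default // scale0r.
Qed.

Lemma ser_pmulDl p q (s : fser M) : ser_pmul (p + q) s = ser_pmul p s + ser_pmul q s.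
Proof.
apply: fser_ext => n m; set N := maxn (size p) (size q).
rewrite fserD !(@ser_pmul_wide _ N) ?leq_maxl ?leq_maxr //; last exact: size_polyD.
by rewrite -big_split; apply: eq_bigr => i _; rewrite coefD scalerDl.
Qed.

Lemma ser_pmulDr p (s t : fser M) : ser_pmul p (s + t) = ser_pmul p s + ser_pmul p t.
Proof.
apply: fser_ext => n m; rewrite fserD /ser_pmul -big_split.
by apply: eq_bigr => i _; rewrite fserD scalerDr.
Qed.

Lemma ser_pmulC c (s : fser M) n m : ser_pmul c%:P s n m = c *: s n m.
Proof. by rewrite (@ser_pmul_wide _ 1) ?size_polyC_leq1 // big_ord1 coefC subr0. Qed.

Lemma ser_pmulMX p (s : fser M) :
  ser_pmul (p * 'X) s = ser_pmul p (ser_shift (-1) s).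
Proof.
apply: fser_ext => n m; rewrite (@ser_pmul_wide _ (size p).+1); last first.
  by rewrite (leq_trans (size_polyMleq _ _)) // size_polyX addn2.
rewrite big_ord_recl coefMX /= scale0r add0r /ser_pmul.
by apply: eq_bigr => i _; rewrite coefMX /= /ser_shift /bump /=; congr (_ *: s _ _); lia.
Qed.

Lemma ser_pmul_shift p i (s : fser M) :
  ser_pmul p (ser_shift i s) = ser_shift i (ser_pmul p s).
Proof.
apply: fser_ext => n m; apply: eq_bigr => j _; rewrite /ser_shift.
by congr (_ *: s _ _); lia.
Qed.

Lemma ser_pmulA p q (s : fser M) : ser_pmul p (ser_pmul q s) = ser_pmul (p * q) s.
Proof.
elim/poly_ind: p s => [s|p c IHp s].
  by rewrite mul0r; apply: fser_ext => n m; rewrite /ser_pmul size_poly0 !big_ord0.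
rewrite mulrDl !ser_pmulDl -mulrA ['X * q]mulrC mulrA !ser_pmulMX; congr (_ + _).
  by rewrite -ser_pmul_shift IHp.
apply: fser_ext => n m; rewrite ser_pmulC [RHS](@ser_pmul_wide _ (size q)); last first.
  by rewrite mul_polyC size_scale_leq.
rewrite scaler_sumr; apply: eq_bigr => i _.
by rewrite scalerA coefCM.
Qed.

Lemma ser_pmul1 : left_id 1 (@ser_pmul F M).
Proof. by move=> s; apply: fser_ext => n m; rewrite ser_pmulC scale1r. Qed.

HB.instance Definition _ := GRing.Zmodule_isLmodule.Build {poly F} (fser M)
  ser_pmulA ser_pmul1 ser_pmulDr (fun s p q => ser_pmulDl p q s).

Notation V := (fser M : lmodType {poly F}).

Lemma fserZ (p : {poly F}) (s : fser M) : p *: (s : V) = ser_pmul p s.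
Proof. by []. Qed.

Lemma fserZC c (s : fser M) n m : (c%:P *: (s : V)) n m = c *: s n m.
Proof. exact: ser_pmulC. Qed.

Lemma fserZX (s : fser M) : 'X *: (s : V) = ser_shift (-1) s.
Proof.
rewrite -[X in X *: _]mul1r fserZ ser_pmulMX; exact: ser_pmul1.
Qed.

Lemma fserZXn k (s : fser M) n m : ('X^k *: (s : V)) n m = s (n - k%:Z) m.
Proof.
elim: k n => [|k IHk] n; first by rewrite expr0 scale1r subr0.
rewrite exprS -scalerA fserZX /ser_shift IHk; congr (s _ _); lia.
Qed.

Lemma fserZXn_eq0 k (s : fser M) : 'X^k *: (s : V) = 0 -> s = 0 :> V.
Proof.
move=> h; apply: fser_ext => n m; have := congr1 (fun t : fser M => t (n + k%:Z) m) h.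
by rewrite /= fserZXn addrK.
Qed.

End SeriesModule.

Section SeriesOperators.
Variables (F : fieldType) (M : lmodType F).
Notation V := (fser M : lmodType {poly F}).

Definition ser_map (f : M -> M) (s : fser M) : fser M := fun n m => f (s n m).

Lemma ser_map_is_linear (f : {linear M -> M}) :
  linear (ser_map f : V -> V).
Proof.
move=> p s t; apply: fser_ext => n m; rewrite /ser_map !fserD linearD; congr (_ + _).
by rewrite /= linear_sum; apply: eq_bigr => i _; rewrite linearZ.
Qed.

HB.instance Definition _ (f : {linear M -> M}) :=
  GRing.isLinear.Build {poly F} (fser M) (fser M) *:%R (ser_map f)
    (ser_map_is_linear f).

Lemma ser_logB (s t : V) : ser_log (s - t) = (ser_log s : V) - ser_log t.
Proof. by apply: fser_ext => n [|m]; rewrite fserD fserN ?subr0. Qed.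

Lemma ser_log0 : ser_log (0 : V) = 0 :> V.
Proof. by apply: fser_ext => n [|m]. Qed.

Lemma ser_logZ (p : {poly F}) (s : V) : ser_log (p *: s) = p *: (ser_log s : V).
Proof.
apply: fser_ext => n [|m] //; rewrite -[LHS]/(0 : M) [in RHS]fserZ /ser_pmul.
by rewrite big1 // => i _; apply: scaler0.
Qed.

Lemma ser_log_sum I (t : seq I) (f : I -> V) :
  ser_log (\sum_(i <- t) f i) = \sum_(i <- t) (ser_log (f i) : V).
Proof.
apply: fser_ext => n m; rewrite fser_sum.
case: m => [|m]; first by rewrite [RHS]big1.
by rewrite -[LHS]/((\sum_(i <- t) f i) n m) fser_sum.
Qed.

End SeriesOperators.

(** This and the next two identities are stated over an abstract module, so that the operator terms
    enter [module_eq] as atoms. *)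
Lemma leibniz_horner_id (B : comNzRingType) (W : lmodType B)
    (p x c dp dx dc : B) (s t : W) :
  dp *: (x *: s) + p *: (dx *: s + x *: t) + (dc *: s + c *: t)
  = (dp * x + p * dx + dc) *: s + (p * x + c) *: t.
Proof. by module_eq W. Qed.

Lemma nabla_flat_low_id (B : comNzRingType) (W : lmodType B) (a b z : B)
    (x1 x2 x3 x4 x5 x6 x7 x8 x9 x10 x11 : W) :
  x1 + (z *: x2 + b *: x3) + (x4 + x5) + a *: (x6 + b *: x7 + x8)
    + (x9 + b *: x10 + x11)
  = x1 + (z *: x2 + a *: x6) + (x4 + x9) + b *: (x3 + a *: x7 + x10)
    + (x5 + a *: x8 + x11).
Proof. module_eq W. Qed.

Lemma nabla_flat_top_id (B : comNzRingType) (W : lmodType B) (a c1 c2 u : B)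
    (x1 x2 x3 x4 x5 y1 y2 z1 z2 z3 : W) :
  c1 *: x1 + c2 *: x2 + (a *: x3 + u *: x1) - (x4 + x5)
    + a *: (c1 *: y1 + (c2 - 1) *: x3 + u *: y1 - y2)
    + (c1 *: z1 + x4 + c2 *: z2 + u *: z1 - z3)
  = c1 *: (x1 + a *: y1 + z1) + c2 *: (x2 + a *: x3 + z2)
    + u *: (x1 + a *: y1 + z1) - (x5 + a *: y2 + z3).
Proof. by module_eq W. Qed.

(** * Parameter derivatives on series: Leibniz rule and flatness *)

Section RankOperators.
Variables (R : realType) (r : nat).
Hypothesis hr : (2 <= r)%N.
Notation K := (parField R r).
Variables (M : lmodType K) (D : nat -> {additive M -> M}).
Variables (nu : K) (g : nat -> K).
Hypothesis D_leibniz : forall k a x, (0 < k < r)%N ->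
  D k (a *: x) = dpar k a *: x + a *: D k x.
Hypothesis D_D : forall k l x, (0 < k < r)%N -> (0 < l < r)%N ->
  D k (D l x) = D l (D k x).
Notation V := (fser M : lmodType {poly K}).

Definition dpoly (k : nat) (p : {poly K}) : {poly K} :=
  if k == r then p^`() else map_poly (@dpar R r k) p.

Lemma coef_dpoly k p i : k != r -> (dpoly k p)`_i = dpar k p`_i.
Proof.
by move=> /negPf kr; rewrite /dpoly kr coef_map_id0 // dpar0.
Qed.

Lemma dpoly_is_nmod_morphism k : nmod_morphism (dpoly k).
Proof.
split=> [|p q]; case: (eqVneq k r) => kr; try by rewrite /dpoly kr eqxx ?deriv0 ?derivD.
  by apply/polyP => i; rewrite coef_dpoly // !coef0 dpar0.
by apply/polyP => i; rewrite coefD !coef_dpoly // coefD dparD.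
Qed.

HB.instance Definition _ k := GRing.isNmodMorphism.Build {poly K} {poly K}
  (dpoly k) (dpoly_is_nmod_morphism k).

Lemma dpolyM k p q : dpoly k (p * q) = dpoly k p * q + p * dpoly k q.
Proof.
case: (eqVneq k r) => kr; first by rewrite /dpoly kr eqxx derivM.
apply/polyP => i; rewrite coefD coef_dpoly // !coefM (raddf_sum (@dpar R r k)).
rewrite -big_split; apply: eq_bigr => j _ /=.
by rewrite !coef_dpoly // dparM.
Qed.

Lemma dpolyC k c : k != r -> dpoly k c%:P = (dpar k c)%:P.
Proof.
by move=> /negPf kr; rewrite /dpoly kr (map_polyC (@dpar R r k)).
Qed.

Lemma dpolyX k : dpoly k 'X = (k == r)%:R.
Proof.
case: (eqVneq k r) => kr; first by rewrite /dpoly kr eqxx derivX.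
apply/polyP => i; rewrite coef_dpoly // coefX mulr0n coef0.
exact: (@dpar_int R r k (nat_of_bool (i == 1%N))%:Z).
Qed.

Let P0 : prefactor K := Prefactor (fun=> 0) nu g.

Definition gsum (k : nat) (s : fser M) : fser M :=
  fun n m => \sum_(1 <= i < r) dpar k (g i) *: s (n + i%:Z) m.

Definition gsum_top (s : fser M) : fser M :=
  fun n m => \sum_(1 <= i < r) (i%:R * g i) *: s (n + i.+1%:Z) m.

Lemma nabla_low k s n m : k != r -> nabla D P0 k s n m =
  D k (s n m) + dpar k nu *: ser_log s n m + gsum k s n m.
Proof. by move=> /negPf kr; rewrite /nabla kr /= scale0r addr0. Qed.

Lemma nabla_top s n m : nabla D P0 r s n m =
  (n + 1)%:~R *: s (n + 1) m + m.+1%:R *: s (n + 1) m.+1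
  + nu *: s (n + 1) m - gsum_top s n m.
Proof. by rewrite /nabla eqxx. Qed.

Lemma gsumD k (s t : fser M) n m :
  gsum k (s + t : V) n m = gsum k s n m + gsum k t n m.
Proof. by rewrite /gsum -big_split; apply: eq_bigr => i _; rewrite fserD scalerDr. Qed.

Lemma gsum_topD (s t : fser M) n m :
  gsum_top (s + t : V) n m = gsum_top s n m + gsum_top t n m.
Proof. by rewrite /gsum_top -big_split; apply: eq_bigr => i _; rewrite fserD scalerDr. Qed.

Lemma nabla_is_nmod_morphism k : nmod_morphism (nabla D P0 k : V -> V).
Proof.
have hD (s t : V) : nabla D P0 k (s + t : V) = nabla D P0 k s + nabla D P0 k t :> V.
  apply: fser_ext => n m; rewrite fserD.
  case: (eqVneq k r) => [->|kr].
    by rewrite !nabla_top gsum_topD !fserD; module_eq M.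
  rewrite !nabla_low // gsumD fserD raddfD /=.
  have -> : ser_log (s + t : V) n m = ser_log s n m + ser_log t n m.
    by case: m => [|m] /=; rewrite ?addr0.
  by move: (dpar k nu) => a; module_eq M.
split; last exact: hD.
by apply: (addrI (nabla D P0 k (0 : V) : V)); rewrite -hD !addr0.
Qed.

HB.instance Definition _ k := GRing.isNmodMorphism.Build V V
  (nabla D P0 k : V -> V) (nabla_is_nmod_morphism k).

Lemma gsum_shift k i (s : fser M) n m :
  gsum k (ser_shift i s) n m = gsum k s (n + i) m.
Proof. by apply: eq_bigr => j _; rewrite /ser_shift addrAC. Qed.

Lemma nabla_C k c (s : V) : (0 < k <= r)%N ->
  nabla D P0 k (c%:P *: s : V) = dpoly k c%:P *: s + c%:P *: (nabla D P0 k s : V).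
Proof.
move=> hk; have hz n m : (c%:P *: s : V) n m = c *: s n m by exact: fserZC.
case: (eqVneq k r) => [->|kr].
  have dC : dpoly r c%:P = 0 by rewrite /dpoly eqxx derivC.
  have -> : dpoly r c%:P *: s = 0 by rewrite dC; exact: scale0r.
  rewrite add0r; apply: fser_ext => n m.
  have -> : (c%:P *: (nabla D P0 r s : V)) n m = c *: nabla D P0 r s n m.
    exact: fserZC.
  rewrite !nabla_top !hz.
  have -> : gsum_top (c%:P *: s : V) n m = c *: gsum_top s n m.
    rewrite /gsum_top scaler_sumr; apply: eq_bigr => i _.
    by rewrite hz !scalerA [c * _]mulrC.
  by module_eq M.
apply: fser_ext => n m; rewrite dpolyC //.
transitivity (dpar k c *: s n m + c *: nabla D P0 k s n m); last first.
  exact: (congr2 +%R (esym (fserZC _ s n m)) (esym (fserZC c (nabla D P0 k s) n m))).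
rewrite !nabla_low // hz D_leibniz; last by lia.
have -> : gsum k (c%:P *: s : V) n m = c *: gsum k s n m.
  rewrite /gsum scaler_sumr; apply: eq_bigr => i _.
  by rewrite hz !scalerA [c * _]mulrC.
have -> : ser_log (c%:P *: s : V) n m = c *: ser_log s n m.
  by case: m => [|m]; rewrite /ser_log ?scaler0 // hz.
by move: (dpar k nu) (dpar k c) => a b; module_eq M.
Qed.

Lemma nabla_X k (s : V) : (0 < k <= r)%N ->
  nabla D P0 k ('X *: s : V) = dpoly k 'X *: s + 'X *: (nabla D P0 k s : V).
Proof.
move=> hk; apply: fser_ext => n m; rewrite fserD dpolyX !fserZX {2}/ser_shift.
case: (eqVneq k r) => [->|kr].
  rewrite scale1r !nabla_top /ser_shift !addrNK !addrK.
  have -> : gsum_top (fun n m => s (n - 1) m) n m = gsum_top s (n - 1) m.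
    by apply: eq_bigr => i _; congr (_ *: s _ _); lia.
  have -> : (n + 1)%:~R = n%:~R + 1 :> K by rewrite intrD.
  by module_eq M.
rewrite scale0r fser0 add0r !nabla_low // gsum_shift; congr (_ + _ *: _ + _).
Qed.

Lemma nabla_leibniz k p (s : V) : (0 < k <= r)%N ->
  nabla D P0 k (p *: s : V) = dpoly k p *: s + p *: (nabla D P0 k s : V).
Proof.
move=> hk; elim/poly_ind: p s => [|p c IHp] s.
  by rewrite !scale0r !raddf0 scale0r addr0.
rewrite scalerDl raddfD /= nabla_C // -scalerA IHp nabla_X //.
rewrite (raddfD (dpoly k)) /= dpolyM.
exact: leibniz_horner_id.
Qed.

Lemma ser_log_nabla k s n m : k != r -> (0 < k)%N ->
  ser_log (nabla D P0 k s) n m = D k (ser_log s n m)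
    + dpar k nu *: ser_log (ser_log s) n m + gsum k (ser_log s) n m.
Proof.
move=> kr k0; case: m => [|m]; last by rewrite /= nabla_low.
rewrite /= raddf0 scaler0 !add0r /gsum big1 // => i _; exact: scaler0.
Qed.

Lemma D_gsum k l s n m : (0 < k < r)%N ->
  D k (gsum l s n m) = \sum_(1 <= i < r) dpar k (dpar l (g i)) *: s (n + i%:Z) m
    + gsum l (ser_map (D k) s) n m.
Proof.
move=> hk; rewrite /gsum raddf_sum -big_split; apply: eq_bigr => i _.
exact: D_leibniz.
Qed.

Lemma gsum_nabla k l s n m : k != r -> (0 < k)%N -> gsum l (nabla D P0 k s) n m =
  gsum l (ser_map (D k) s) n m + dpar k nu *: gsum l (ser_log s) n m
  + gsum l (gsum k s) n m.
Proof.
move=> kr k0; rewrite {2}/gsum scaler_sumr -!big_split; apply: eq_bigr => i _ /=.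
by rewrite nabla_low // !scalerDr !scalerA [dpar k nu * _]mulrC.
Qed.

Lemma gsum_gsum k l s n m : gsum k (gsum l s) n m = gsum l (gsum k s) n m.
Proof.
rewrite /gsum; under eq_bigr do rewrite scaler_sumr.
under [RHS]eq_bigr do rewrite scaler_sumr.
rewrite exchange_big; apply: eq_bigr => i _; apply: eq_bigr => j _.
by rewrite !scalerA mulrC addrAC.
Qed.

Lemma nabla_flat_low k l s : (0 < k < r)%N -> (0 < l < r)%N ->
  nabla D P0 k (nabla D P0 l s) =2 nabla D P0 l (nabla D P0 k s).
Proof.
move=> hk hl n m.
have [kr lr] : k != r /\ l != r by split; apply/eqP; lia.
have [k0 l0] : (0 < k)%N /\ (0 < l)%N by lia.
have e a b : a != r -> b != r -> (0 < a < r)%N -> (0 < b)%N ->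
   nabla D P0 a (nabla D P0 b s) n m =
   D a (D b (s n m)) + (dpar a (dpar b nu) *: ser_log s n m
     + dpar b nu *: D a (ser_log s n m))
   + (\sum_(1 <= i < r) dpar a (dpar b (g i)) *: s (n + i%:Z) m
     + gsum b (ser_map (D a) s) n m)
   + dpar a nu *: (D b (ser_log s n m) + dpar b nu *: ser_log (ser_log s) n m
      + gsum b (ser_log s) n m)
   + (gsum a (ser_map (D b) s) n m + dpar b nu *: gsum a (ser_log s) n m
      + gsum a (gsum b s) n m).
  move=> ar br ha b0; rewrite nabla_low // nabla_low // ser_log_nabla // gsum_nabla //.
  by rewrite !raddfD /= D_leibniz // D_gsum.
rewrite (e k l) // (e l k) // D_D // gsum_gsum (dpar_comm k l nu).
under eq_bigr do rewrite (dpar_comm k l).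
exact: nabla_flat_low_id.
Qed.

(** Both orders produce the mixed derivatives of log P. The delicate one is d nu/dc_k times 1/c_r:
    it comes from differentiating nu in one order and log c_r in the other. *)
Lemma nabla_flat_top k s : (0 < k < r)%N ->
  nabla D P0 k (nabla D P0 r s) =2 nabla D P0 r (nabla D P0 k s).
Proof.
move=> hk n m.
have kr : k != r by apply/eqP; lia.
rewrite nabla_low // 2!nabla_top !(raddfD (D k)) raddfN /= !D_leibniz //.
rewrite !nabla_low //.
have di (z : int) : dpar k (z%:~R : K) = 0 by exact: dpar_int.
rewrite di (di m.+1%:Z) !scale0r !add0r.
have Dg : D k (gsum_top s n m) = \sum_(1 <= i < r) (i%:R * dpar k (g i)) *: s (n + i.+1%:Z) m
    + gsum_top (ser_map (D k) s) n m.
  rewrite /gsum_top raddf_sum -big_split; apply: eq_bigr => i _ /=.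
  by rewrite D_leibniz // dparM (di i%:Z) mul0r add0r.
rewrite Dg.
(* The coefficient m + 1 of the shifted series appears as (m + 1) - 1; the - 1 supplies the 1/c_r
   term of the mixed derivative. *)
have lg : ser_log (nabla D P0 r s) n m = (n + 1)%:~R *: ser_log s (n + 1) m
   + (m.+1%:R - 1) *: s (n + 1) m + nu *: ser_log s (n + 1) m - gsum_top (ser_log s) n m.
  case: m {Dg} => [|m]; last by rewrite /= nabla_top -[m.+2%:R]natr1 addrK.
  rewrite /= subrr !scaler0 scale0r !add0r /gsum_top big1 ?oppr0 // => i _.
  exact: scaler0.
rewrite lg.
have gg : gsum k (nabla D P0 r s) n m = (n + 1)%:~R *: gsum k s (n + 1) m
   + \sum_(1 <= i < r) (i%:R * dpar k (g i)) *: s (n + i.+1%:Z) m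
   + m.+1%:R *: gsum k s (n + 1) m.+1 + nu *: gsum k s (n + 1) m
   - gsum k (gsum_top s) n m.
  rewrite /gsum !scaler_sumr -sumrN -!big_split; apply: eq_bigr => i _ /=.
  rewrite nabla_top.
  have -> : n + i.+1%:Z = n + 1 + i%:Z by lia.
  have -> : n + i%:Z + 1 = n + 1 + i%:Z by lia.
  have -> : (n + 1 + i%:Z)%:~R = (n + 1)%:~R + i%:R :> K by rewrite intrD.
  by move: (dpar k (g i)) => a; module_eq M.
rewrite gg.
have gn : gsum_top (nabla D P0 k s) n m = gsum_top (ser_map (D k) s) n m
   + dpar k nu *: gsum_top (ser_log s) n m + gsum k (gsum_top s) n m.
  have -> : gsum k (gsum_top s) n m = gsum_top (gsum k s) n m.
    rewrite /gsum /gsum_top; under eq_bigr do rewrite scaler_sumr.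
    under [RHS]eq_bigr do rewrite scaler_sumr.
    rewrite exchange_big; apply: eq_bigr => i _; apply: eq_bigr => j _.
    by rewrite !scalerA mulrC addrAC.
  rewrite /gsum_top scaler_sumr -!big_split; apply: eq_bigr => i _ /=.
  by rewrite nabla_low // !scalerDr !scalerA [dpar k nu * _]mulrC.
rewrite gn; exact: nabla_flat_top_id.
Qed.

End RankOperators.

(** * The canonical vector *)

Section TopRank.
Variables (R : realType) (q : nat).
Notation r := q.+1.
Hypothesis hr : (2 <= r)%N.
Notation K := (parField R r).
Variables (M : lmodType K) (L : int -> {linear M -> M}) (v0 : M).
Hypothesis hM : is_irregular_verma L v0.
Variable D : nat -> {additive M -> M}.
Hypothesis hD : is_par_derivation L D.
Hypothesis hlow : lower_deformation L D v0.
Variables (nu : K) (g : nat -> K).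
Notation V := (fser M : lmodType {poly K}).
Notation P0 := (Prefactor (fun=> 0) nu g).

Definition ctop (k : nat) : {poly K} := if k == 0%N then (c0 R r)%:P else cpar R r k.
Definition Qtop : {poly K} := (Qpar R r)%:P.

Definition dtop (k : 'I_r) : {additive {poly K} -> {poly K}} := @dpoly R r k.+1.
Definition Ntop (k : 'I_r) : {additive V -> V} := nabla D P0 k.+1.
Definition Ltop (n : nat) : {linear V -> V} := ser_map (L n%:Z).

Lemma dpoly_const k (x : K) : (k != r -> dpar k x = 0) -> dpoly k x%:P = 0.
Proof.
case: (eqVneq k r) => [->|kr] h; first by rewrite /dpoly eqxx derivC.
by rewrite (dpolyC _ kr) (h isT); exact: polyC0.
Qed.

Lemma dpoly_ctop (k : 'I_r) n : dpoly k.+1 (ctop n) = (n == k.+1)%:R :> {poly K}.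
Proof.
rewrite /ctop; case: eqP => [->|n0].
  by apply: dpoly_const => _; apply: dpar_base.
rewrite /cpar; case: (eqVneq n r) => [->|nr]; first by rewrite dpolyX eq_sym.
case: (eqVneq k.+1 r) => [->|kr].
  by rewrite (negPf nr) /dpoly eqxx derivC.
rewrite (dpolyC _ kr) dpar_clow //; last by have := ltn_ord k; lia.
exact: (rmorph_nat (@polyC K)).
Qed.

Lemma dpoly_Qtop k : dpoly k Qtop = 0.
Proof. by apply: dpoly_const => _; apply: dpar_base. Qed.

Lemma ctop_big n : (r < n)%N -> ctop n = 0.
Proof.
move=> h; rewrite /ctop /cpar; case: eqP => [e|_]; first by lia.
case: eqP => [e|_]; first by lia.
rewrite clow_out; [exact: polyC0 | exact: hr | by apply/orP; right; lia].
Qed.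

Let leibD k a x : (0 < k < r)%N -> D k (a *: x) = dpar k a *: x + a *: D k x.
Proof. exact: (par_leibniz hD). Qed.

Lemma Ntop_leibniz (k : 'I_r) p s : Ntop k (p *: s) = dtop k p *: s + p *: Ntop k s.
Proof. exact: (@nabla_leibniz R r hr M D nu g leibD k.+1 p s (ltn_ord k)). Qed.

Lemma Ntop_flat k l s : Ntop k (Ntop l s) = Ntop l (Ntop k s).
Proof.
apply: fser_ext => n m; have DD := D_comm hr hM hD hlow.
have [hk hl] := (ltn_ord k, ltn_ord l).
case: (eqVneq k.+1 r) (eqVneq l.+1 r) => [ek|nk] [el|nl].
- by rewrite (_ : k = l) //; apply/val_inj => /=; lia.
- rewrite /Ntop ek; symmetry; apply: (nabla_flat_top hr nu g leibD); lia.
- rewrite /Ntop el; apply: (nabla_flat_top hr nu g leibD); lia.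
- by apply: (nabla_flat_low hr nu g leibD DD); lia.
Qed.

Lemma Ltop_Ntop m k s : Ltop m (Ntop k s) = Ntop k (Ltop m s).
Proof.
apply: fser_ext => a b; rewrite /Ltop /Ntop /= /ser_map.
case: (eqVneq k.+1 r) => [->|kr].
  rewrite !nabla_top (linB (L m)) !(linD (L m)) !(linZ (L m)); congr (_ - _).
  by rewrite /gsum_top linear_sum; apply: eq_bigr => i _; rewrite linearZ.
rewrite !nabla_low // !(linD (L m)) (linZ (L m)) (D_comm_L hr hM hD hlow) //.
  congr (_ + _ *: _ + _); first by case: b => //=; rewrite linear0.
  by rewrite /gsum linear_sum; apply: eq_bigr => i _; rewrite linearZ.
by have := ltn_ord k; lia.
Qed.

Lemma Ltop_vir m n v :
  Ltop m (Ltop n v) - Ltop n (Ltop m v) = (m%:R - n%:R) *: Ltop (m + n) v.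
Proof.
apply: fser_ext => a b; rewrite fserD fserN.
have -> : (m%:R - n%:R : {poly K}) = (m%:R - n%:R)%:P.
  by rewrite polyCB !(rmorph_nat (@polyC K)).
transitivity ((m%:R - n%:R) *: Ltop (m + n) v a b : M); last exact/esym/fserZC.
exact: (@Vir_nat R r hr M L (verma_rep hM) m n (v a b)).
Qed.

(** The adjugate divided by +-r!, the determinant being +-r! c_r^r. Its entries stay polynomial in
    c_r with coefficients in A. *)
Lemma ex_ell : exists ell : 'M[{poly K}]_r,
  [/\ ell *m frame_mx r ctop = ('X^r)%:M, frame_mx r ctop *m ell = ('X^r)%:M &
   forall i j k, inA (ell i j)`_k].
Proof.
have SA := inA_subring R hr; have SP := subring_poly SA.
have [b hb] := det_frame_mx ctop_big.
pose u : {poly K} := (-1) ^+ b * (r`!%:R^-1)%:P.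
have hu : u * \det (frame_mx r ctop) = 'X^r.
  rewrite hb /u mulrACA -signr_addb addbb mul1r mulrA -(rmorph_nat (@polyC K)).
  rewrite -polyCM mulVf ?polyC1 ?mul1r ?par_natr_eq0 -?lt0n ?fact_gt0 //.
  by rewrite /ctop /cpar eqxx.
have [h1 h2] := frame_mx_inv hu.
exists (u *: \adj (frame_mx r ctop)); split=> // i j; rewrite mxE.
have cA n k : inA (ctop n)`_k.
  have h (x : K) : inA x -> inA (x%:P)`_k.
    by move=> hx; rewrite coefC; case: eqP => // _; apply: (subring0 SA).
  rewrite /ctop /cpar; case: eqP => _; first by apply/h/inA_baseF.
  case: eqP => _; last by apply/h/inA_clow.
  by rewrite coefX; apply: (subring_nat SA).
apply: (subringM SP).
  apply: (subringM SP); first exact: (subring_sign SP).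
  by move=> k; rewrite coefC; case: eqP => _; [apply: inA_natV | apply: (subring0 SA)].
apply: (subring_adj SP) => i' j'; rewrite mxE; apply: (subringM SP); last exact: cA.
exact: (subring_nat SP).
Qed.

End TopRank.

(** * The first-order equation in c_r and its resonant exponent *)

Section LeadingTerm.
Variables (F : fieldType) (M : lmodType F) (q : nat).
Notation r := q.+1.
Notation V := (fser M : lmodType {poly F}).
Variables (v0 : M) (W : V) (Z : V -> V) (whit : V -> Prop).
Hypothesis charF : forall n, (n%:R == 0 :> F) = (n == 0%N).
Hypothesis v0_neq0 : v0 != 0.
Hypothesis W_neg : forall n m, n < 0 -> W n m = 0.
Hypothesis W_log : forall n m, W n m.+1 = 0.
Hypothesis W_0 : W 0 0%N = v0.
Hypothesis ZB : forall s t, Z (s - t) = Z s - Z t.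
Hypothesis ZZ : forall p s, Z (p *: s) = p *: Z s - ('X^r * p^`()) *: s.
Hypothesis ZW : Z W = 0.
Hypothesis whitB : forall s t, whit s -> whit t -> whit (s - t).
Hypothesis whitZ : forall p s, whit s -> whit (p *: s).
Hypothesis whitW : whit W.

Definition ordge (d : nat) (s : V) := forall n m, n < d%:Z -> s n m = 0.
Definition logfree (s : V) := forall n m, s n m.+1 = 0.

Hypothesis Z_ord : forall d s, ordge d s -> ordge d (Z s).
Hypothesis whit_lead : forall d s, whit s -> ordge d s ->
  exists b, s d%:Z 0%N = b *: v0.

Lemma monomZ b k (s : V) n m : ((b%:P * 'X^k) *: s) n m = b *: s (n - k%:Z) m.
Proof. by rewrite -scalerA fserZC fserZXn. Qed.

Lemma Z_monom b d :
  Z ((b%:P * 'X^d) *: W) = - (((b *+ d)%:P * 'X^(r + d.-1)) *: W).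
Proof.
rewrite ZZ ZW scaler0 sub0r; congr (- (_ *: _)).
rewrite derivM derivC mul0r add0r derivXn exprD polyCMn.
by rewrite mulrCA !mulrnAr mulrnAl.
Qed.

Lemma Z_monom_eval b d n m :
  Z ((b%:P * 'X^d) *: W) n m = - ((b *+ d) *: W (n - (r + d.-1)%:Z) m).
Proof. by rewrite Z_monom fserN monomZ. Qed.

Lemma sub_lead d s b : ordge d s -> logfree s -> s d%:Z 0%N = b *: v0 ->
  ordge d.+1 (s - (b%:P * 'X^d) *: W) /\ logfree (s - (b%:P * 'X^d) *: W).
Proof.
move=> os ls hb; split=> n m; last first.
  by rewrite fserD fserN monomZ ls W_log scaler0 subrr.
move=> hn; rewrite fserD fserN monomZ.
have [lt_nd|le_dn] := ltP n d%:Z.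
  by rewrite os // W_neg ?scaler0 ?subrr //; lia.
have -> : n = d%:Z by lia.
case: m => [|m]; last by rewrite ls W_log scaler0 subrr.
by rewrite subrr W_0 hb subrr.
Qed.

(** The leading term is cancelled by a multiple of c_r^d W, whose image under Z is known and starts
    only at order d + q (it is 0 if d = 0). The remainder has order d + 1 and the argument repeats,
    up to q times. *)
Lemma Z_gain t d s : (t <= q)%N -> ordge d s -> whit s -> logfree s ->
  ordge (d + t) (Z s).
Proof.
elim: t d s => [|t IHt] d s ht os ws ls; first by rewrite addn0; apply: Z_ord.
have [b hb] := whit_lead ws os.
have [os' ls'] := sub_lead os ls hb.
have ws' : whit (s - (b%:P * 'X^d) *: W) by apply: whitB => //; apply: whitZ.
have := IHt d.+1 _ (ltnW ht) os' ws' ls'; rewrite addSnnS => o' n m hn.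
have := o' n m hn; rewrite ZB fserD fserN Z_monom_eval => /eqP.
rewrite subr_eq0 => /eqP ->; case: d {os os' hb ls' ws' o'} hn => [|d] hn.
  by rewrite mulr0n scale0r oppr0.
by rewrite W_neg ?scaler0 ?oppr0 //=; lia.
Qed.

Lemma Z_lead d s b : ordge d s -> whit s -> logfree s -> s d%:Z 0%N = b *: v0 ->
  Z s (d + q)%N%:Z 0%N = - ((b *+ d) *: v0).
Proof.
move=> os ws ls hb; have [os' ls'] := sub_lead os ls hb.
have ws' : whit (s - (b%:P * 'X^d) *: W) by apply: whitB => //; apply: whitZ.
have := @Z_gain q d.+1 _ (leqnn q) os' ws' ls' (d + q)%N%:Z 0%N ltac:(lia).
rewrite ZB fserD fserN Z_monom_eval => /eqP; rewrite subr_eq0 => /eqP ->.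
case: d {os os' hb ls' ws'} => [|d]; first by rewrite mulr0n !scale0r.
by rewrite /= (_ : _ - _ = 0) ?W_0 //; lia.
Qed.

Lemma whit_ode_unique (kappa : F) (U : V) :
    whit U -> logfree U -> ordge 0 U ->
    Z U = - ((r%:R%:P * 'X^q) *: U) - (kappa%:P * 'X^(r + q)) *: W ->
  kappa = 0 /\ exists b, U = (b%:P * 'X^r) *: W.
Proof.
move=> wU lU oU eU.
(* At order d + q the equation reads - d b = - r b, as the source begins at order r + q. Hence b = 0
   unless d = r. *)
have vanish (s : V) d kap : whit s -> logfree s -> ordge d s ->
    Z s = - ((r%:R%:P * 'X^q) *: s) - (kap%:P * 'X^(r + q)) *: W ->
    d != r -> (d < r)%N || (kap == 0) -> ordge d.+1 s.
  move=> ws ls os es dr hk; have [b hb] := whit_lead ws os.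
  have := Z_lead os ws ls hb; rewrite es fserD !fserN !monomZ.
  have -> : (d + q)%N%:Z - q%:Z = d%:Z by lia.
  have -> : kap *: W ((d + q)%N%:Z - (r + q)%N%:Z) 0%N = 0.
    case/orP: hk => [h|/eqP->]; last exact: scale0r.
    by rewrite W_neg ?scaler0 //; lia.
  rewrite hb subr0 scalerA => /eqP; rewrite eqr_opp -subr_eq0 -scalerBl scaler_eq0.
  rewrite (negPf v0_neq0) orbF -[b *+ d]mulr_natl -mulrBl mulf_eq0 => /orP[|/eqP b0].
    rewrite subr_eq0 => /eqP e.
    have [lt|le] := ltnP d r.
      have : (r - d)%:R == 0 :> F by rewrite natrB ?e ?subrr // ltnW.
      by rewrite charF; lia.
    have : (d - r)%:R == 0 :> F by rewrite natrB // -e subrr.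
    by rewrite charF; lia.
  move=> n m hn; have [lt|le] := ltP n d%:Z; first exact: os.
  have -> : n = d%:Z by lia.
  by case: m => [|m]; rewrite ?ls // hb b0 scale0r.
have oUd d : (d <= r)%N -> ordge d U.
  elim: d => // d IHd hd; have od := IHd (ltnW hd).
  by apply: vanish eU _ _ => //; [lia | rewrite hd].
have [b hb] := whit_lead wU (oUd r (leqnn r)).
have [oU' lU'] := sub_lead (oUd r (leqnn r)) lU hb.
set U' := U - _ in oU' lU'.
have wU' : whit U' by apply: whitB => //; apply: whitZ.
have eU' : Z U' = - ((r%:R%:P * 'X^q) *: U') - (kappa%:P * 'X^(r + q)) *: W.
  rewrite ZB eU Z_monom scalerBr opprK opprB addrAC; congr (_ - _).
  rewrite [RHS]addrC; congr (_ + _); rewrite scalerA; congr (_ *: _).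
  rewrite mulrACA -exprD -polyCM mulr_natl addnC.
  by congr (_ * 'X^_); lia.
(* Subtracting b c_r^r W does not change the equation, because c_r^r W solves its homogeneous part.
   The remainder has order r + 1, so at order r + q only the source is left. *)
have k0 : kappa = 0.
  have [b' hb'] := whit_lead wU' oU'.
  have := @Z_gain q r.+1 _ (leqnn q) oU' wU' lU' (r + q)%N%:Z 0%N ltac:(lia).
  rewrite eU' fserD !fserN !monomZ oU' ?scaler0 ?oppr0 ?add0r; last by lia.
  by rewrite subrr W_0 => /eqP; rewrite oppr_eq0 scaler_eq0 (negPf v0_neq0) orbF => /eqP.
split=> //; exists b; apply/eqP; rewrite -subr_eq0 -/U'; apply/eqP.
have oUd' d : ordge (r.+1 + d) U'.
  elim: d => [|d IHd]; first by rewrite addn0.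
  rewrite addnS; apply: vanish eU' _ _ => //; first by lia.
  by rewrite k0 eqxx orbT.
apply: fser_ext => n m; rewrite (oUd' `|n|%N) //; lia.
Qed.

End LeadingTerm.

Lemma log_shift_id (B : comNzRingType) (N : lmodType B) (a b u : B) (x y z : N) :
  a *: x + (b + 1) *: y + u *: x - z = a *: x + b *: y + u *: x - z + y.
Proof. by module_eq N. Qed.

Lemma cancel_log_id (B : comNzRingType) (N : lmodType B) (x k : B) (a n l : N) :
  a - x *: (n + k *: l) + (k * x) *: l = a - x *: n.
Proof. by module_eq N. Qed.

Lemma eigen_log_id (B : comNzRingType) (N : lmodType B) (x y k t : B) (z l w : N) :
  - ((t * y) *: z) + ((k * x) *: - (y *: w) - (x * (k * (t * y))) *: l)
  = - ((t * y) *: (z + (k * x) *: l)) - (k * (x * y)) *: w.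
Proof. by module_eq N. Qed.

Lemma scale_comm_id (B : comNzRingType) (N : lmodType B) (a p q : B) (w : N) :
  a *: (p *: w) - q *: (a *: w) = a *: (p *: w - q *: w).
Proof. by module_eq N. Qed.

Lemma prefactor_id (B : comNzRingType) (N : lmodType B) (a : B) (x y z w : N) :
  x + a *: y + z + w = x + z + w + a *: y.
Proof. by module_eq N. Qed.

Lemma scale_swap_id (B : comNzRingType) (N : lmodType B) (x a b p q : B) (w : N) :
  (b * x) *: ((a * x) *: w) - (x * (p * x)) *: w
    - ((a * x) *: ((b * x) *: w) - (x * (q * x)) *: w)
  = ((q - p) * (x * x)) *: w.
Proof. by module_eq N. Qed.

(** * X_j W as a multiple of W, and the scalar correction *)

Section Canonical.
Variables (R : realType) (q : nat).
Notation r := q.+1.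
Hypothesis hr : (2 <= r)%N.
Notation K := (parField R r).
Variables (M : lmodType K) (L : int -> {linear M -> M}) (v0 : M).
Hypothesis hM : is_irregular_verma L v0.
Variable D : nat -> {additive M -> M}.
Hypothesis hD : is_par_derivation L D.
Hypothesis hlow : lower_deformation L D v0.
Variables (nu : K) (g : nat -> K) (v : nat -> M).
Hypothesis hW : is_canonical L D v0 nu g v.
Notation V := (fser M : lmodType {poly K}).
Notation P0 := (Prefactor (fun=> 0) nu g).
Variable ell : 'M[{poly K}]_r.
Hypothesis ellM : ell *m frame_mx r (ctop R q) = ('X^r)%:M.
Hypothesis Mell : frame_mx r (ctop R q) *m ell = ('X^r)%:M.
Hypothesis inA_ell : forall i j k, inA (ell i j)`_k.

Notation ctop := (ctop R q).
Notation Qtop := (Qtop R q).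
Notation Ntop := (Ntop D nu g).
Notation Ltop := (Ltop L).
Notation W := (ser_of v : V).
Notation Rt := (Rfl ctop Qtop Ntop Ltop).
Notation Zt := (Zfl ctop Qtop Ntop Ltop ell).
Notation wtt := (wt ctop Qtop).

Let dM := fun k : 'I_r => @dpolyM R r k.+1.
Let dC := @dpoly_ctop R q hr.
Let dQ := fun k : 'I_r => @dpoly_Qtop R q k.+1.
Let c_big := @ctop_big R q hr.
Let leib := Ntop_leibniz hr hD nu g.
Let vir := Ltop_vir hr hM.
Let flat := Ntop_flat hr hM hD hlow nu g.
Let LN := Ltop_Ntop hr hM hD hlow nu g.

Lemma wt_top n : wtt n = weight R r n.
Proof.
case: n => [|n]; rewrite /weight /=.
  by rewrite wt0 /Delta /= /Qtop /ctop eqxx polyCM polyCB.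
rewrite wt_pos // /Lam /ctop eqxx /=.
rewrite polyCB !polyCM !(rmorph_nat (@polyC K)); congr (_ - _).
apply: eq_big_nat => k hk.
have -> : (k == 0%N) = false by apply/eqP; lia.
by have -> : (n.+1 - k == 0)%N = false by apply/eqP; lia.
Qed.

(** The constants c_0 and c_0' enter only through the factor c_n, which vanishes at c_r = 0 as soon
    as n >= r. At n = r - 1 they would differ, which is why the Whittaker conditions start at r. *)
Lemma coef0_wt_top n : (r <= n)%N -> (wtt n)`_0 = Lamlow R r n.
Proof.
case: n => // n hn; rewrite wt_top /weight /= /Lam /Lamlow.
have cc k : (cpar R r k)`_0 = clow R r k.
  rewrite /cpar; case: eqP => [->|_]; last by rewrite coefC.
  by rewrite coefX clow_out // leqnn orbT.
rewrite coefB coef0M cc (@clow_out R r hr n.+1) ?mulr0; last by rewrite hn orbT.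
rewrite coef_sum; congr (_ - _); apply: eq_bigr => k _.
by rewrite coef0M; exact: (congr2 *%R (cc k) (cc (n.+1 - k)%N)).
Qed.

Lemma frame_top_big n (k : 'I_r) : (r <= n)%N -> frame ctop n k = 0 :> {poly K}.
Proof. by move=> h; rewrite /frame c_big ?mulr0 //; lia. Qed.

Lemma vfd_top_big n (p : {poly K}) : (r <= n)%N -> vfd ctop (@dtop R q) n p = 0.
Proof. by move=> h; rewrite /vfd big1 // => k _; rewrite frame_top_big // mul0r. Qed.

Lemma Rt_big n s : (r <= n)%N -> Rt n s = Ltop n s - wtt n *: s.
Proof.
move=> h; rewrite /Rfl /vfv big1 ?subr0 // => k _.
by rewrite frame_top_big // scale0r.
Qed.

Definition whit (s : V) := forall n, (r <= n)%N -> Rt n s = 0.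

Lemma whitD s t : whit s -> whit t -> whit (s + t).
Proof. by move=> hs ht n hn; rewrite RflD hs // ht // addr0. Qed.

Lemma whitN s : whit s -> whit (- s).
Proof. by move=> hs n hn; rewrite RflN hs // oppr0. Qed.

Lemma whitZ p s : whit s -> whit (p *: s).
Proof.
move=> hs n hn; rewrite (RflZ _ _ _ leib) vfd_top_big // hs // scaler0 scale0r.
exact: subrr.
Qed.

(** For n >= r the operator R_n contains no derivative, so it commutes with multiplication by log
    c_r. *)
Lemma whit_log s : whit s -> whit (ser_log s).
Proof.
move=> hs n hn; rewrite Rt_big //.
have -> : Ltop n (ser_log s) = ser_log (Ltop n s) :> V.
  by apply: fser_ext => a [|b] //; apply: linear0.
rewrite -(ser_logZ (wtt n) s) -(ser_logB (Ltop n s) (wtt n *: s)) -Rt_big // hs //.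
exact: ser_log0.
Qed.

Lemma fser_const_eq0 (c : K) (s : V) : c != 0 -> c%:P *: s = 0 -> s = 0.
Proof.
move=> c0 h; apply: fser_ext => n m.
have : c *: s n m = 0 by rewrite -fserZC h.
by move/eqP; rewrite scaler_eq0 (negPf c0) => /eqP.
Qed.

(** Beyond 2r the conditions are consequences: [R_r, R_(n-r)] = (2r - n) R_n with 2r - n nonzero. *)
Lemma whit_W : whit W.
Proof.
have hle n : (r <= n <= 2 * r)%N -> Rt n W = 0.
  move=> hn; rewrite Rt_big; last by case/andP: hn.
  apply/eqP; rewrite subr_eq0; apply/eqP; apply: fser_ext => a b.
  rewrite wt_top /weight; case: n hn => [|n] hn; first by [].
  exact: (can_L hW hn).
move=> n hn; have [le_n|lt_n] := leqP n (2 * r); first by rewrite hle // hn.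
elim/ltn_ind: n hn lt_n => n IHn hn lt_n.
have h1 : Rt (n - r) W = 0.
  have [?|?] := leqP (n - r) (2 * r); [apply: hle; lia | apply: IHn; lia].
have h0 : Rt r W = 0 by apply: hle; lia.
have := Rfl_add_eq0 dM dC dQ c_big leib vir flat LN h0 h1.
have e : (r + (n - r))%N = n by lia.
have -> : (r%:R - (n - r)%:R : {poly K}) = (- (n - r - r)%:R)%:P.
  by rewrite polyCN (rmorph_nat (@polyC K)) [(n - r - r)%:R]natrB ?opprB //; lia.
rewrite e.
by apply: fser_const_eq0; rewrite oppr_eq0 par_natr_eq0 //; apply/eqP; lia.
Qed.

(** Ties the abstract [ell] to the rational inverse in L_*: over the fraction field c_r^r M^-1 is
    unique. The equation for L_* thus becomes Z_r W = 0. *)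
Lemma Lstar_coefE (n : 'I_r) : @Lstar_coef R r n = ell ord_max n.
Proof.
pose tf : {rmorphism {poly K} -> {fraction {poly K}}} := @FracField.tofrac {poly K}.
rewrite /Lstar_coef; set A := Mmat R r.
have eA : A = map_mx tf (frame_mx r ctop).
  apply/matrixP => i k; rewrite !mxE; apply: (congr1 tf); rewrite /frame addn1 addnS.
  by case: ifP => [_|h]; [rewrite /ctop | rewrite c_big ?mulr0 // ltnNge h].
have e1 : map_mx tf ell *m A = (tf 'X^r)%:M.
  by rewrite eA -map_mxM ellM map_scalar_mx.
have X0 : tf ('X^r : {poly K}) != 0.
  by rewrite tofrac_eq0 expf_neq0 // polyX_eq0.
have uA : A \in unitmx.
  have e2 : ((tf 'X^r)^-1 *: map_mx tf ell) *m A = 1%:M.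
    by rewrite -scalemxAl e1 scale_scalar_mx mulVf.
  by have [] := mulmx1_unit e2.
have -> : tf 'X^r * invmx A ord_max n = tf (ell ord_max n).
  have : (tf 'X^r)%:M *m invmx A = map_mx tf ell.
    by rewrite -e1 mulmxK.
  by rewrite mul_scalar_mx => /matrixP/(_ ord_max n); rewrite !mxE.
exact: fracpolyK.
Qed.

Lemma Zt_top_W : Zt ord_max W = 0.
Proof.
rewrite (ZflE _ _ _ ellM); apply/eqP; rewrite subr_eq0; apply/eqP.
apply: fser_ext => a b; apply: etrans (can_Lstar hW a b).
rewrite fser_sum /Lstar; apply: eq_bigr => n _.
by rewrite Lstar_coefE wt_top.
Qed.

Lemma dpoly_topE (p : {poly K}) : dpoly r p = p^`().
Proof. by rewrite /dpoly eqxx. Qed.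

Lemma ordgeB d (s t : V) : ordge d s -> ordge d t -> ordge d (s - t).
Proof. by move=> hs ht n m hn; rewrite fserD fserN hs // ht // subr0. Qed.

Lemma ordgeZ d (p : {poly K}) (s : V) : ordge d s -> ordge d (p *: s).
Proof.
move=> hs n m hn; rewrite fserZ /ser_pmul big1 // => i _.
by rewrite hs ?scaler0 //; lia.
Qed.

Lemma ordge_sum d I (t : seq I) (f : I -> V) :
  (forall i, ordge d (f i)) -> ordge d (\sum_(i <- t) f i).
Proof. by move=> h n m hn; rewrite fser_sum big1 // => i _; apply: h. Qed.

Lemma ordge_Ltop d n (s : V) : ordge d s -> ordge d (Ltop n s).
Proof. by move=> h a b hn; rewrite /Ltop /= /ser_map h // linear0. Qed.

Let Lpart (j : 'I_r) (s : V) : V := \sum_n ell j n *: (Ltop n s - wtt n *: s).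

Lemma ordge_Lpart d j s : ordge d s -> ordge d (Lpart j s).
Proof.
move=> h; apply: ordge_sum => n; apply/ordgeZ/ordgeB; first exact: ordge_Ltop.
exact: ordgeZ.
Qed.

Lemma Zt_Lpart j s : Zt j s = Lpart j s - 'X^r *: Ntop j s.
Proof. exact: (ZflE Qtop Ntop Ltop ellM). Qed.

Lemma Zt_ord d s : ordge d s -> ordge d (Zt ord_max s).
Proof.
move=> os; rewrite Zt_Lpart; apply: ordgeB; first exact: ordge_Lpart.
move=> n m hn; rewrite fserZXn.
rewrite -[Ntop ord_max s]/(nabla D P0 r s : V) nabla_top !os; try lia.
rewrite !scaler0 !add0r /gsum_top big_nat big1 ?oppr0 // => i hi.
by rewrite os ?scaler0 //; lia.
Qed.

Lemma coef0_ordge (d : nat) (p : {poly K}) (s : V) m : ordge d s ->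
  (p *: s) d%:Z m = p`_0 *: s d%:Z m.
Proof.
move=> os; rewrite fserZ (@ser_pmul_wide _ _ _ (size p).+1) // big_ord_recl subr0.
by rewrite big1 ?addr0 // => i _; rewrite os ?scaler0 //= /bump /=; lia.
Qed.

Lemma whit_lead d s : whit s -> ordge d s -> exists b, s d%:Z 0%N = b *: v0.
Proof.
move=> ws os; apply: (whittaker_line hr hM) => n hn.
have := ws n hn; rewrite Rt_big // => /eqP; rewrite subr_eq0 => /eqP.
move=> /(congr1 (fun t : V => t d%:Z 0%N)).
by rewrite coef0_ordge // coef0_wt_top.
Qed.

Lemma logfreeB (s t : V) : logfree s -> logfree t -> logfree (s - t).
Proof. by move=> hs ht n m; rewrite fserD fserN hs ht subr0. Qed.

Lemma logfreeZ (p : {poly K}) (s : V) : logfree s -> logfree (p *: s).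
Proof.
by move=> hs n m; rewrite fserZ /ser_pmul big1 // => i _; rewrite hs scaler0.
Qed.

Lemma logfree_W : logfree W.
Proof. by case. Qed.

Lemma W_neg n m : n < 0 -> W n m = 0.
Proof. by case: n. Qed.

Lemma logfree_Lpart j s : logfree s -> logfree (Lpart j s).
Proof.
move=> h n m; rewrite /Lpart fser_sum big1 // => i _.
apply/logfreeZ/logfreeB; last exact: logfreeZ.
by move=> a b; rewrite /Ltop /= /ser_map h linear0.
Qed.

(** The derivation c_r^r d/dc_r sends log c_r to c_r^(r-1); the rest vanishes with Z_r W. *)
Lemma Zt_log : Zt ord_max (ser_log W) = - ('X^q *: W).
Proof.
have eL : Lpart ord_max (ser_log W) = ser_log (Lpart ord_max W) :> V.
  rewrite /Lpart ser_log_sum; apply: eq_bigr => n _.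
  rewrite ser_logZ ser_logB ser_logZ; congr (_ *: (_ - _)).
  by apply: fser_ext => a [|b] //; apply: linear0.
have eN : Ntop ord_max (ser_log W) = (ser_log (Ntop ord_max W) : V) + ser_shift 1 W.
  apply: fser_ext => n m; rewrite fserD.
  rewrite -[Ntop ord_max (ser_log W)]/(nabla D P0 r (ser_log W) : V) nabla_top.
  case: m => [|m].
    rewrite /= !scaler0 add0r !addr0 scale1r /gsum_top big1 ?subr0 ?add0r // => i _.
    exact: scaler0.
  rewrite -[ser_log _ n m.+1]/(nabla D P0 r W n m) nabla_top.
  rewrite -[gsum_top g (ser_log W) n m.+1]/(gsum_top g W n m).
  rewrite -[ser_log W (n + 1) m.+1]/(W (n + 1) m).
  rewrite -[ser_log W (n + 1) m.+2]/(W (n + 1) m.+1).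
  rewrite -[ser_shift 1 W n m.+1]/(W (n + 1) m.+1) -[m.+2%:R]natr1.
  exact: log_shift_id.
rewrite Zt_Lpart eL eN scalerDr opprD addrA.
rewrite -(ser_logZ 'X^r (Ntop ord_max W)) -ser_logB -Zt_Lpart Zt_top_W ser_log0 sub0r.
congr (- _); apply: fser_ext => n m; rewrite !fserZXn /ser_shift.
by congr (W _ m); lia.
Qed.

Definition MAser (s : V) := forall n m, MA L v0 (s n m).

Let SA := inA_subring R hr.
Let SP := subring_poly SA.

Lemma MAserB s t : MAser s -> MAser t -> MAser (s - t).
Proof.
move=> hs ht n m; rewrite fserD fserN; apply: MA_D => //.
exact: MA_N.
Qed.

Lemma MAserZ (p : {poly K}) s : (forall i, inA p`_i) -> MAser s -> MAser (p *: s).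
Proof.
move=> hp hs n m; rewrite fserZ /ser_pmul; apply: MA_sum => i _.
exact: MA_Z.
Qed.

Lemma inA_wt_top n i : inA (wtt n)`_i.
Proof.
have hC (x : K) k : inA x -> inA (x%:P)`_k.
  by move=> hx; rewrite coefC; case: eqP => // _; apply: (subring0 SA).
have cA n' k : inA (ctop n')`_k.
  rewrite /ctop /cpar; case: eqP => _; first by apply/hC/inA_baseF.
  case: eqP => _; last by apply/hC/inA_clow.
  by rewrite coefX; apply: (subring_nat SA).
move: i; apply: (subringB SP); last first.
  by apply: (subring_sum SP) => k _; apply: (subringM SP).
apply: (subringM SP) => //; apply: (subringM SP); first exact: (subring_nat SP).
by move=> k; apply/hC/inA_baseF.
Qed.

Lemma MAser_W : MAser W.
Proof.
move=> [n|n] [|m]; try exact: MA_0.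
exact: (MA_inMA hr (can_v hW n)).
Qed.

Lemma MAser_Lpart j : MAser (Lpart j W).
Proof.
move=> a b; rewrite /Lpart fser_sum; apply: MA_sum => n _; move: a b.
apply: MAserZ => //; apply: MAserB; last exact/MAserZ/MAser_W/inA_wt_top.
by move=> a b; apply: (MA_L hr hM); apply: MAser_W.
Qed.

Let Npart (k : nat) : V := fun n m => D k (W n m) + gsum g k W n m.

Lemma Ntop_Npart (j : 'I_r) : j.+1 != r ->
  Ntop j W = Npart j.+1 + (dpar j.+1 nu)%:P *: (ser_log W : V).
Proof.
move=> jr; apply: fser_ext => n m.
rewrite -[Ntop j W]/(nabla D P0 j.+1 W : V) nabla_low // fserD.
rewrite -(fserZC (dpar j.+1 nu) (ser_log W) n m) /Npart addrAC //.
Qed.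

Lemma canonical_eigen (j : 'I_r) : j.+1 != r ->
  exists b, inA b /\ Zt j W = (b%:P * 'X^r) *: W.
Proof.
move=> jr; set kap := dpar j.+1 nu.
(* U is Zt j W without its log c_r part, which is - c_r^r (d nu / d c_(j+1)) W;
   the Zt ord_max equation then forces d nu / d c_(j+1) = 0, a residue. *)
pose U : V := Zt j W + (kap%:P * 'X^r) *: (ser_log W : V).
have eU : U = Lpart j W - 'X^r *: Npart j.+1.
  by rewrite /U Zt_Lpart Ntop_Npart // -/kap; exact: cancel_log_id.
have wW := whit_W.
have wU : whit U.
  apply: whitD; last by apply/whitZ/whit_log.
  move=> n hn; exact: (Rfl_Zfl_whittaker dM dC dQ c_big leib vir flat LN ell wW j hn).
have lU : logfree U.
  rewrite eU; apply: logfreeB; first exact/logfree_Lpart/logfree_W.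
  apply: logfreeZ => n m; rewrite /Npart /gsum logfree_W raddf0 add0r.
  by rewrite big1 // => i _; rewrite logfree_W scaler0.
have oU : ordge 0 U.
  rewrite eU; apply: ordgeB.
    by apply: ordge_Lpart => n m; apply: W_neg.
  move=> n m hn; rewrite fserZXn /Npart W_neg ?raddf0 ?add0r; last by lia.
  rewrite /gsum big_nat big1 // => i hi.
  by rewrite W_neg ?scaler0 //; lia.
(* The source comes from [Zt_log]; the two contributions of d(c_r^r)/dc_r combine into the multiple
   of U. *)
have ZU : Zt ord_max U = - ((r%:R%:P * 'X^q) *: U) - (kap%:P * 'X^(r + q)) *: W.
  have dX : dpoly r ('X^r : {poly K}) = r%:R%:P * 'X^q.
    rewrite dpoly_topE derivXn /= -mulr_natl; congr (_ * _).
    exact/esym/(rmorph_nat (@polyC K)).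
  have h1 := Zfl_Zfl_ker dM dC dQ c_big leib vir flat LN ellM Mell
    (@fserZXn_eq0 K M r) wW j
    Zt_top_W.
  rewrite /U ZflD (ZflZ _ _ leib ellM) h1 Zt_log.
  rewrite -[dtop R ord_max 'X^r]/(dpoly r ('X^r : {poly K})) dX.
  rewrite -[dtop R ord_max _]/(dpoly r (kap%:P * 'X^r : {poly K})).
  have -> : dpoly r (kap%:P * 'X^r : {poly K}) = kap%:P * (r%:R%:P * 'X^q).
    have e0 : dpoly r (kap%:P) * 'X^r = 0 by rewrite dpoly_topE derivC mul0r.
    by rewrite dpolyM e0 add0r; exact: (congr1 ( *%R kap%:P) dX).
  have eX : 'X^(r + q) = 'X^r * 'X^q :> {poly K} by exact (exprD 'X r q).
  rewrite eX.
  exact (eigen_log_id 'X^r 'X^q kap%:P r%:R%:P (Zt j W) (ser_log W : V) W).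
have ZtB s t : Zt ord_max (s - t) = Zt ord_max s - Zt ord_max t.
  by rewrite ZflD ZflN.
have ZtZ p s : Zt ord_max (p *: s) = p *: Zt ord_max s - ('X^r * p^`()) *: s.
  by rewrite (ZflZ _ _ leib ellM) -dpoly_topE.
have whB s t : whit s -> whit t -> whit (s - t).
  by move=> hs ht; apply: whitD => //; apply: whitN.
have [k0 [b hb]] := whit_ode_unique (@par_natr_eq0 R r) (v0_neq0 hM) W_neg logfree_W
  (can_v0 hW) ZtB ZtZ Zt_top_W whB whitZ wW
  Zt_ord whit_lead wU lU oU ZU.
exists b; split; last first.
  rewrite -hb /U k0.
  have -> : (0%:P * 'X^r : {poly K}) = 0 by exact: mul0r.
  by rewrite scale0r addr0.
apply: (MA_line_inA hr hM).
(* The coefficient b is read off at order c_r^r, where the derivative part only contributes D_j v0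
   and terms (d g_i / dc_j) v_i, all in M_A. *)
have <- : U r%:Z 0%N = b *: v0 by rewrite hb monomZ subrr -(can_v0 hW).
rewrite eU fserD fserN fserZXn subrr; apply: MA_D; first exact: MAser_Lpart.
have hj : (0 < j.+1 < r)%N by have := ltn_ord j; lia.
have hv : W 0 0%N = v0 := can_v0 hW.
apply: (MA_N hr); rewrite /Npart hv.
apply: MA_D; first exact: (MA_Dv0 hr hM hlow hj).
rewrite /gsum big_nat; apply: MA_sum => i hi; apply: (MA_Z hr); last exact: MAser_W.
exact: (inA_dpar hr _ (can_g hW hi)).
Qed.

(* A scalar function does not depend on c_r, hence the value 0 at k = r-1. *)
Definition trunc (h : nat -> K) (k : 'I_r) : K := if k.+1 == r then 0 else h k.+1.

(** The one-form dh contracted with the vector field D_n, with no c_r component. *)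
Definition hform (h : nat -> K) (n : nat) : {poly K} :=
  \sum_(k < r) frame ctop n k * (trunc h k)%:P.

Lemma nabla_prefactor h (k : 'I_r) (s : V) :
  (nabla D (Prefactor h nu g) k.+1 s : V) = Ntop k s + (trunc h k)%:P *: s.
Proof.
apply: fser_ext => n m; rewrite fserD.
transitivity (nabla D P0 k.+1 s n m + trunc h k *: s n m); last first.
  exact: (congr2 +%R erefl (esym (fserZC _ s n m))).
rewrite /nabla /trunc; case: eqP => _; first by rewrite scale0r addr0.
by rewrite /= scale0r addr0; exact: prefactor_id.
Qed.

Lemma vf_prefactor h n (s : V) : (n <= r)%N ->
  (vf D (Prefactor h nu g) n s : V) = vfv ctop Ntop n s + hform h n *: s.
Proof.
move=> hn.
have -> : vfv ctop Ntop n s + hform h n *: s =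
    \sum_(k < r) frame ctop n k *: (nabla D (Prefactor h nu g) k.+1 s : V).
  rewrite /vfv /hform scaler_suml -big_split; apply: eq_bigr => k _.
  by rewrite nabla_prefactor scalerDr scalerA.
apply: fser_ext => a b; rewrite fser_sum /vf big_add1 /=.
rewrite -(big_mkord xpredT (fun k => ser_pmul (k.+1%:R * ctop (n + k.+1))
  (nabla D (Prefactor h nu g) k.+1 s) a b)).
rewrite [RHS](big_cat_nat (n := (r - n)%N)) ?leq_subr //= [X in _ + X](_ : _ = 0).
  by rewrite addr0; apply: eq_bigr => k _; rewrite /ctop addnS.
rewrite big_nat big1 // => k hk; rewrite c_big; last by lia.
by rewrite mulr0 /ser_pmul size_poly0 big_ord0.
Qed.

Lemma hform_scale h n (s : V) :
  hform h n *: s = \sum_(k < r) frame ctop n k *: ((trunc h k)%:P *: s).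
Proof.
by rewrite /hform scaler_suml; apply: eq_bigr => k _; exact/esym/scalerA.
Qed.

Lemma Rop_prefactor h n (s : V) : (n <= r)%N ->
  (Rop L D (Prefactor h nu g) n s : V) = Rt n s - hform h n *: s.
Proof.
move=> hn; rewrite /Rfl -addrA -opprD -(vf_prefactor h s hn).
by apply: fser_ext => a b; rewrite /Rop /Dop wt_top.
Qed.

Lemma monom_W_eq0 (c : K) k : (c%:P * 'X^k) *: W = 0 -> c = 0.
Proof.
move=> /(congr1 (fun t : V => t k%:Z 0%N)); rewrite monomZ subrr /= (can_v0 hW).
by move/eqP; rewrite scaler_eq0 (negPf (v0_neq0 hM)) orbF => /eqP.
Qed.

Lemma ex_dlog : exists h : nat -> K,
  (forall k, (0 < k < r)%N -> inA (h k)) /\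
  forall j : 'I_r, Zt j W = ((trunc h j)%:P * 'X^r) *: W.
Proof.
have /choice[h hh] : forall k, exists b : K, forall j : 'I_r, j.+1 = k -> k != r ->
    inA b /\ Zt j W = (b%:P * 'X^r) *: W.
  move=> k; case: (boolP ((0 < k < r)%N)) => hk; last first.
    exists 0 => j ej kr; exfalso; case/negP: hk; have := ltn_ord j.
    by move/eqP: kr; lia.
  have hk' : (k.-1 < r)%N by lia.
  have ne : (Ordinal hk').+1 != r by apply/eqP => /=; lia.
  have [b hb] := canonical_eigen ne.
  exists b => j ej _; have -> : j = Ordinal hk' by apply/val_inj => /=; lia.
  exact: hb.
exists h; split=> [k hk|j].
  have hk' : (k.-1 < r)%N by lia.
  have ek : (Ordinal hk').+1 = k by rewrite /=; lia.
  have kr : k != r by apply/eqP; lia.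
  exact: (proj1 (hh k _ ek kr)).
rewrite /trunc; case: eqP => [ej|/eqP nj]; last exact: (proj2 (hh _ j erefl nj)).
have -> : (0%:P * 'X^r : {poly K}) = 0 by exact: mul0r.
rewrite scale0r; have -> : j = ord_max by apply/val_inj => /=; lia.
exact: Zt_top_W.
Qed.

Variable h : nat -> K.
Hypothesis hZ : forall j : 'I_r, Zt j W = ((trunc h j)%:P * 'X^r) *: W.

Lemma Rt_hform n : (n < r)%N -> Rt n W = hform h n *: W.
Proof.
move=> hn; apply/eqP; rewrite -subr_eq0; apply/eqP/(@fserZXn_eq0 K M r).
have e := Rfl_Zfl Qtop Ntop Ltop Mell (Ordinal hn) W.
rewrite scalerBr [X in X - _]e; apply/eqP; rewrite subr_eq0; apply/eqP.
rewrite /hform scalerA mulr_sumr scaler_suml; apply: eq_bigr => k _.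
by rewrite hZ scalerA mulrA [in RHS]mulrC.
Qed.

(** For i, j < r the factor c_r^r is constant, so [Zfl_bracket] says that Z_i and Z_j commute on W.
    The products of eigenvalues cancel and the curl of h, times c_r^(2r) W, is left. *)
Lemma dlog_closed i j : (0 < i < r)%N -> (0 < j < r)%N ->
  dpar i (h j) = dpar j (h i).
Proof.
case: i => // i hi; case: j => // j hj.
have [hi' hj'] : (i < r)%N /\ (j < r)%N by lia.
have [ir jr] : i.+1 != r /\ j.+1 != r by split; apply/eqP; lia.
have tr k (hk : (k < r)%N) : k.+1 != r -> trunc h (Ordinal hk) = h k.+1.
  by rewrite /trunc /= => /negPf ->.
have Xm k m : k != r -> dpoly k ('X^m : {poly K}) = 0.
  move=> kr; elim: m => [|m IHm].
    rewrite expr0 -(polyC1 K); apply: dpoly_const => _.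
    by rewrite -(baseF1 R r) dpar_base.
  by rewrite exprS dpolyM IHm dpolyX (negPf kr) mulr0n mul0r mulr0 addr0.
have Xk k := Xm k r.
have Zk (k : 'I_r) (c : K) : k.+1 != r -> Zt k ((c%:P * 'X^r) *: W) =
    (c%:P * 'X^r) *: (((trunc h k)%:P * 'X^r) *: W)
    - ('X^r * ((dpar k.+1 c)%:P * 'X^r)) *: W.
  move=> kr; rewrite (ZflZ _ _ leib ellM) hZ; congr (_ - (_ * _) *: _).
  transitivity (dpoly k.+1 c%:P * 'X^r + c%:P * dpoly k.+1 'X^r).
    exact: dpolyM.
  have e0 : c%:P * dpoly k.+1 'X^r = 0.
    exact (etrans (congr1 ( *%R c%:P) (Xk _ kr)) (mulr0 _)).
  exact (etrans (congr2 +%R (congr1 ( *%R^~ 'X^r) (dpolyC c kr)) e0) (addr0 _)).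
have := Zfl_bracket dM dC dQ c_big leib vir flat LN ellM Mell (@fserZXn_eq0 K M r) whit_W
  (Ordinal hi') (Ordinal hj').
rewrite -[dtop R (Ordinal hj') _]/(dpoly j.+1 ('X^r : {poly K})) (Xk _ jr).
rewrite -[dtop R (Ordinal hi') _]/(dpoly i.+1 ('X^r : {poly K})) (Xk _ ir).
rewrite !scale0r subr0 !hZ !Zk // !tr //.
move=> /(etrans (esym (scale_swap_id _ _ _ _ _ _))).
have -> : 'X^r * 'X^r = 'X^(r + r) :> {poly K} by exact (esym (exprD 'X r r)).
have -> (a b : K) : a%:P - b%:P = (a - b)%:P by exact/esym/polyCB.
by move=> /monom_W_eq0/eqP; rewrite subr_eq0 => /eqP.
Qed.

(** Two solutions give one-forms with the same contraction against every D_n; the frame being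
    invertible, they coincide. The constant a is not differentiated and drops out. *)
Lemma Rop_dlog_unique h' (a : K) : a != 0 -> (forall k, dpar k a = 0) ->
    (forall n, (n < r)%N -> (Rop L D (Prefactor h' nu g) n (a%:P *: W) : V) = 0) ->
  forall k, (0 < k < r)%N -> h' k = h k.
Proof.
move=> a0 da hR k hk.
have hBW n : hform h n *: W - hform h' n *: W =
    \sum_(k < r) frame ctop n k *: ((trunc h k - trunc h' k)%:P *: W).
  transitivity (\sum_(k < r) frame ctop n k *: ((trunc h k)%:P *: W)
     - \sum_(k < r) frame ctop n k *: ((trunc h' k)%:P *: W)).
    exact (congr2 (fun t u : V => t - u) (hform_scale h n W) (hform_scale h' n W)).
  rewrite -sumrB; apply: eq_bigr => i _.
  have eB : (trunc h i - trunc h' i)%:P = (trunc h i)%:P - (trunc h' i)%:P :> {poly K}.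
    exact: polyCB.
  by rewrite eB scalerBl scalerBr.
have eq n : (n < r)%N -> \sum_(k < r) frame ctop n k *: ((trunc h k - trunc h' k)%:P *: W) = 0.
  move=> hn; apply: (fser_const_eq0 a0).
  have := hR n hn; rewrite Rop_prefactor; last exact: ltnW.
  rewrite (RflZ _ _ _ leib) Rt_hform //.
  have evf : vfd ctop (dtop R (q:=q)) n a%:P = 0.
    rewrite /vfd big1 // => i _.
    have -> : dtop R i a%:P = 0 by apply: dpoly_const => _; apply: da.
    exact: mulr0.
  have e0 : vfd ctop (dtop R (q:=q)) n a%:P *: W = 0 by rewrite evf; exact: scale0r.
  rewrite e0 subr0 => hz; rewrite -hBW.
  exact: etrans (esym (scale_comm_id _ _ _ _)) hz.
have hk' : (k.-1 < r)%N by lia.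
have := ell_sum_frame ellM (Ordinal hk') (fun k => (trunc h k - trunc h' k)%:P *: W).
rewrite big1 => [/esym|n _]; last by rewrite eq ?scaler0.
rewrite scalerA mulrC => /monom_W_eq0/eqP.
have nk : k == r = false by apply/eqP; lia.
by rewrite /trunc /= prednK ?nk ?subr_eq0 => [/eqP //|]; lia.
Qed.

End Canonical.

Theorem theorem3p5 (R : realType) (r : nat) (hr : (2 <= r)%N)
    (M : lmodType (parField R r)) (L : int -> {linear M -> M}) (v0 : M)
    (hM : is_irregular_verma L v0)
    (D : nat -> {additive M -> M}) (hD : is_par_derivation L D)
    (hlow : lower_deformation L D v0)
    (nu : parField R r) (g : nat -> parField R r) (v : nat -> M)
    (hW : is_canonical L D v0 nu g v) :
  exists f : scalar_fun R r,
    [/\ is_scalar_fun f, sf_nonzero f, solves_R L D nu g v f &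
     forall f' : scalar_fun R r,
       is_scalar_fun f' -> sf_nonzero f' -> solves_R L D nu g v f' ->
       exists kappa : baseField R, kappa != 0 /\ sf_is_multiple kappa f f'].
Proof.
(* With r a successor, the dimension [r.-1.+1] of [Mmat] is r by computation. *)
case: r hr M L v0 hM D hD hlow nu g v hW => // q hr M L v0 hM D hD hlow nu g v hW.
have [ell [ellM Mell inA_ell]] := @ex_ell R q hr.
have [h [hA hZ]] := ex_dlog hr hM hD hlow hW ellM Mell inA_ell.
have scaleE (a : parField R q.+1) :
    ser_scale a (ser_of v) = a%:P *: (ser_of v : (fser M : lmodType {poly parField R q.+1})).
  by apply: fser_ext => n m; exact/esym/fserZC.
exists (ScalarFun 1 h); split.
- split=> [k hk|i j hi hj]; first exact/(inA_inALaur hr)/hA.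
  exact: (dlog_closed hr hM hD hlow hW ellM Mell hZ).
- exact: oner_neq0.
- move=> n hn a b; rewrite /= scaleE baseF1.
  have -> : (1%:P : {poly parField R q.+1}) = 1 by exact: polyC1.
  rewrite scale1r.
  have e := Rop_prefactor hr L D nu g h (ser_of v) (leqW hn).
  apply: etrans (congr1 (fun s : fser M => s a b) e) _.
  by rewrite (Rt_hform Mell hZ) // subrr.
(* As the witness has coefficient 1, the proportionality constant is the coefficient of f'
   itself. *)
- move=> f' _ nz hf'; exists (sf_coef f'); split=> //; split; first by rewrite mulr1.
  apply: (Rop_dlog_unique hr hM hD hW ellM Mell hZ (a := baseF q.+1 (sf_coef f'))).
  + by rewrite baseF_eq0.
  + by move=> k; apply: dpar_base.
  + by move=> n hn; apply: fser_ext => a b; rewrite -scaleE; apply: hf'.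
Qed.
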